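(* Let $M=(M_n)_{n\in\mathbb{N}}$ be a sequence of strictly positive real numbers such that the Carleman class $C_M\{\mathbb{R}\}$ is regular and quasianalytic. Let $q\geq 3$ be an integer, let $\alpha_1<\dots<\alpha_q$ be real numbers, let $\delta>0$, let $\chi\in C_M\{\mathbb{R}\}$, and let $a_1,\dots,a_q$ be holomorphic functions on the strip $\mathbb{R}_\delta=\{z\in\mathbb{C}:|\operatorname{Im}(z)|<\delta\}$ such that $a_1$ and $a_q$ are nowhere vanishing on $\mathbb{R}_\delta$. Assume that, for some constant $C>0$, $$\sup_{z\in\mathbb{R}_\delta}\left(\left(\sum_{j=2}^{q}\left|\frac{a_j(z)}{a_1(z)}\right|+\sum_{j=1}^{q-1}\left|\frac{a_j(z)}{a_q(z)}\right|+\frac{1}{|a_1(z)|}+\frac{1}{|a_q(z)|}\right)e^{-e^{C|\operatorname{Re}(z)|}}\right)<+\infty .$$ Then the difference equation $$\sum_{j=1}^{q}a_j(x)\,\varphi(x+\alpha_j)=\chi(x)$$ is solvable in $C_M\{\mathbb{R}\}$, i.e. there exists $\varphi\in C_M\{\mathbb{R}\}$ satisfying this equation for every $x\in\mathbb{R}$.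
   Context: Let $M=(M_n)_{n\in\mathbb{N}}$ (with $\mathbb{N}=\{0,1,2,\dots\}$) be a sequence of strictly positive real numbers. The Carleman class $C_M\{\mathbb{R}\}$ is the set of all functions $f:\mathbb{R}\to\mathbb{C}$ of class $C^\infty$ such that for every compact interval $I\subset\mathbb{R}$ there are constants $C_I,\rho_I>0$ with $\|f^{(n)}\|_{\infty,I}\leq C_I\,\rho_I^{\,n}M_n$ for all $n\in\mathbb{N}$, where $\|\cdot\|_{\infty,I}$ is the supremum norm on $I$. The class $C_M\{\mathbb{R}\}$ is called quasianalytic if every $f\in C_M\{\mathbb{R}\}$ for which there is some $u\in\mathbb{R}$ with $f^{(n)}(u)=0$ for all $n\in\mathbb{N}$ is identically $0$. The class $C_M\{\mathbb{R}\}$ is called regular if the following three conditions hold: (i) $\left(\frac{M_{n+1}}{(n+1)!}\right)^2\leq\frac{M_n}{n!}\cdot\frac{M_{n+2}}{(n+2)!}$ for all $n\in\mathbb{N}$; (ii) $\sup_{n\geq 1}\left(\frac{M_{n+1}}{(n+1)M_n}\right)^{1/n}<+\infty$; (iii) $\lim_{n\to+\infty}M_n^{1/n}=+\infty$. *)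

(* Defs.v *)
From Stdlib Require Import Reals Factorial.
From Coquelicot Require Import Coquelicot.
Open Scope R_scope.

(* [D n] is the n-th derivative of [f]; a function [f] is of class C^infinity
   iff such a [D] exists, and then [D] is determined pointwise by [f].
   [C_R_NormedModule] is C as a real normed space. *)
Definition iterated_derivatives (f : R -> C) (D : nat -> R -> C) : Prop :=
  (forall x : R, D 0%nat x = f x) /\
  (forall (n : nat) (x : R),
     @is_derive R_AbsRing C_R_NormedModule (D n) x (D (S n) x)).

Definition carleman (M : nat -> R) (f : R -> C) : Prop :=
  exists D : nat -> R -> C, iterated_derivatives f D /\
  forall a b : R, exists K rho : R, 0 < K /\ 0 < rho /\
  forall (n : nat) (x : R), a <= x <= b -> Cmod (D n x) <= K * rho ^ n * M n.

Definition quasianalytic (M : nat -> R) : Prop :=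
  forall (f : R -> C) (D : nat -> R -> C),
    carleman M f -> iterated_derivatives f D ->
    (exists u : R, forall n : nat, D n u = RtoC 0) ->
    forall x : R, f x = RtoC 0.

(* [Rpower x y] is x^y only for x > 0, which holds wherever it is used here
   because M takes positive values. *)
Definition regular (M : nat -> R) : Prop :=
  (forall n : nat,
     (M (n + 1)%nat / INR (fact (n + 1))) ^ 2 <=
     (M n / INR (fact n)) * (M (n + 2)%nat / INR (fact (n + 2)))) /\
  (exists B : R, forall n : nat, (1 <= n)%nat ->
     Rpower (M (n + 1)%nat / (INR (n + 1) * M n)) (1 / INR n) <= B) /\
  is_lim_seq (fun n : nat => Rpower (M n) (1 / INR n)) p_infty.

Definition strip (delta : R) (z : C) : Prop := Rabs (Im z) < delta.

(* Values of [g] outside the (open) strip are irrelevant. *)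
Definition holomorphic_on_strip (delta : R) (g : C -> C) : Prop :=
  forall z : C, strip delta z -> @ex_derive C_AbsRing C_NormedModule g z.

(* Main.v *)
Require Import Defs.
From Stdlib Require Import Reals Lra Lia Factorial ClassicalEpsilon.
From Coquelicot Require Import Coquelicot.
Open Scope R_scope.

(* Solved for its last term, the equation reads psi = g - sum_j b_j psi(. - s_j)
   with b_j = a_j / a_q, g = chi / a_q and all s_j > 0.  If the right-hand side is
   analytic near -infinity, with derivatives of order n at most
   exp(-2 exp(kappa |x|)) r^n n! for a large kappa, then this decay beats the
   growth of the coefficients, the Neumann series converges near -infinity to an
   analytic function, and the equation extends the solution to the right step by
   step.  Solving for the first term is the same problem after x -> -x.

   It remains to write chi as a sum of two functions of the class which have this
   decay near -infinity and +infinity respectively.  Cut-off functions are not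
   available.  Instead, for f = chi exp(5 cosh(kappa x)), take the Chebyshev
   expansion f = sum_k c_k T_k on [-1,1], whose coefficients satisfy
   k^n |c_k| <= K A^n M_n, and cut the k-th term by a Gaussian step function of
   width k^(-1/2): sum_k c_k T_k theta_k is analytic for x <= -1/2 and in the
   class for x < 1/2, sum_k c_k T_k (1 - theta_k) is symmetric to it, and since
   their sum is f near 0 both extend to the real line.  The two halves are then
   multiplied by exp(-5 cosh(kappa x)).

   Quotients of holomorphic functions enter only through the bounds on their
   derivatives on the real line, which come from Cauchy's formula on squares.
   All estimates of products are pointwise and use bounds by k s^n (V)_n with the
   rising factorial (V)_n, since Leibniz' rule adds the parameters V. *)

(** The two kinds of bounds behave differently under products. Multiplying a function bounded by k
    s^n (V)_n by an analytic coefficient raises V but keeps the rate s; turning the (m+1)_n of the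
    m-th Neumann iterate back into n! costs exp(eps m) with eps at choice, which the geometric
    smallness of the iterates pays for. A bound by M_n instead loses a fixed factor in the rate at
    each product, which infinitely many iterations cannot afford. Hence the right-hand side must be
    analytic where the Neumann series is used, while membership in the class is enough afterwards,
    each compact interval being reached after finitely many steps.

    In the splitting, the width k^(-1/2) balances two demands. On [-1/2,1/2], away from the
    endpoints, derivatives of order n of T_k and of the step are at most (k+n)^n up to a geometric
    factor, so the decay of c_k suffices. Further out T_k may grow like (1+2|x|)^k, and the tail
    exp(-8(k+1)x^2) absorbs this together with the cost of (V)_n, leaving n! bounds uniform up to
    infinity. *)

(** * Derivatives of complex-valued functions of a real variable *)

Definition dC (f : R -> C) (x : R) (l : C) : Prop :=
  is_derive (fun t => Re (f t)) x (Re l) /\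
  is_derive (fun t => Im (f t)) x (Im l).

(** Both projections are linear, and a complex value is a real linear combination of 1 and i. This
    is the bridge from [iterated_derivatives] to real calculus. *)
Lemma dC_iff (f : R -> C) (x : R) (l : C) :
  @is_derive R_AbsRing C_R_NormedModule f x l <-> dC f x l.
Proof.
  split.
  - intros H. split.
    + apply (filterdiff_comp' f (fun z : C_R_NormedModule => fst z : R_NormedModule)
        x _ (fun z : C_R_NormedModule => fst z)) in H.
      2:{ apply filterdiff_linear. apply is_linear_fst. }
      exact H.
    + apply (filterdiff_comp' f (fun z : C_R_NormedModule => snd z : R_NormedModule)
        x _ (fun z : C_R_NormedModule => snd z)) in H.
      2:{ apply filterdiff_linear. apply is_linear_snd. }
      exact H.
  - intros [H1 H2].
    apply (is_derive_ext (fun t => @plus C_R_NormedModule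
       (@scal R_Ring C_R_NormedModule (Re (f t)) (1, 0))
       (@scal R_Ring C_R_NormedModule (Im (f t)) (0, 1)))).
    { intros t. unfold plus, scal; simpl. unfold prod_plus, prod_scal; simpl.
      unfold scal, plus; simpl. unfold mult; simpl.
      destruct (f t); simpl; f_equal; ring. }
    evar_last.
    + apply @is_derive_plus; apply @is_derive_scal_l; [exact H1 | exact H2].
    + unfold plus, scal; simpl. unfold prod_plus, prod_scal; simpl.
      unfold scal, plus; simpl. unfold mult; simpl.
      destruct l; simpl; f_equal; ring.
Qed.

Lemma dC_unique (f : R -> C) (x : R) (l l' : C) : dC f x l -> dC f x l' -> l = l'.
Proof.
  intros [A B] [A' B'].
  apply is_derive_unique in A, B, A', B'.
  apply injective_projections; unfold Re, Im in *; congruence.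
Qed.

Lemma dC_ext_loc (f g : R -> C) (x : R) (l : C) :
  locally x (fun t => f t = g t) -> dC f x l -> dC g x l.
Proof.
  intros H [A B]; split.
  - apply (is_derive_ext_loc (fun t => Re (f t))); [|exact A].
    revert H; apply filter_imp; intros t ->; reflexivity.
  - apply (is_derive_ext_loc (fun t => Im (f t))); [|exact B].
    revert H; apply filter_imp; intros t ->; reflexivity.
Qed.

Lemma dC_ext (f g : R -> C) (x : R) (l : C) :
  (forall t, f t = g t) -> dC f x l -> dC g x l.
Proof. intros H; apply dC_ext_loc; now apply filter_forall. Qed.

Lemma dC_plus (f g : R -> C) (x : R) (l m : C) :
  dC f x l -> dC g x m -> dC (fun t => f t + g t)%C x (l + m)%C.
Proof.
  intros [A B] [A' B']; split.
  - exact (is_derive_plus _ _ _ _ _ A A').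
  - exact (is_derive_plus _ _ _ _ _ B B').
Qed.

Lemma dC_minus (f g : R -> C) (x : R) (l m : C) :
  dC f x l -> dC g x m -> dC (fun t => f t - g t)%C x (l - m)%C.
Proof.
  intros [A B] [A' B']; split.
  - exact (is_derive_minus _ _ _ _ _ A A').
  - exact (is_derive_minus _ _ _ _ _ B B').
Qed.

Lemma is_derive_Rmult (f g : R -> R) (x df dg : R) :
  is_derive f x df -> is_derive g x dg ->
  is_derive (fun t => f t * g t) x (df * g x + f x * dg).
Proof.
  intros A B. apply (is_derive_mult f g x df dg A B). intros; apply Rmult_comm.
Qed.

Lemma dC_mult (f g : R -> C) (x : R) (l m : C) :
  dC f x l -> dC g x m -> dC (fun t => f t * g t)%C x (l * g x + f x * m)%C.
Proof.
  intros [A B] [A' B']; split.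
  - evar_last.
    + apply @is_derive_minus; apply is_derive_Rmult; eassumption.
    + unfold minus, plus, opp; simpl. unfold Re, Im; ring.
  - evar_last.
    + apply @is_derive_plus; apply is_derive_Rmult; eassumption.
    + unfold minus, plus, opp; simpl. unfold Re, Im; ring.
Qed.

Lemma dC_const (c : C) (x : R) : dC (fun _ => c) x 0%C.
Proof.
  split; [exact (is_derive_const (V := R_NormedModule) (Re c) x) |
          exact (is_derive_const (V := R_NormedModule) (Im c) x)].
Qed.

Lemma dC_RtoC (f : R -> R) (x l : R) :
  is_derive f x l -> dC (fun t => RtoC (f t)) x (RtoC l).
Proof.
  intros H; split; [exact H |].
  exact (is_derive_const (V := R_NormedModule) 0 x).
Qed.

Lemma dC_cmult (c : C) (f : R -> C) (x : R) (l : C) :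
  dC f x l -> dC (fun t => c * f t)%C x (c * l)%C.
Proof.
  intros H. generalize (dC_mult _ _ _ _ _ (dC_const c x) H).
  now replace (0 * f x + c * l)%C with (c * l)%C by ring.
Qed.

Lemma dC_comp (f : R -> C) (g : R -> R) (x d : R) (l : C) :
  is_derive g x d -> dC f (g x) l -> dC (fun t => f (g t)) x (RtoC d * l)%C.
Proof.
  intros G [A B]; split; (evar_last;
    [ first [exact (is_derive_comp (fun t => Re (f t)) g x _ _ A G)
            | exact (is_derive_comp (fun t => Im (f t)) g x _ _ B G)] | ]);
  unfold scal; simpl; unfold mult; simpl; unfold Re, Im; simpl; ring.
Qed.

Lemma dC_shift (f : R -> C) (s x : R) (l : C) :
  dC f (x + s) l -> dC (fun t => f (t + s)) x l.
Proof.
  intros H. replace l with (RtoC 1 * l)%C by ring.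
  apply dC_comp; [|exact H].
  evar_last; [apply @is_derive_plus; [apply @is_derive_id | apply @is_derive_const] |].
  unfold plus, zero, one; simpl; ring.
Qed.

Lemma locally_gt (a x : R) : a < x -> locally x (fun t => a < t).
Proof. apply (open_gt a). Qed.

Lemma locally_lt (a x : R) : x < a -> locally x (fun t => t < a).
Proof. apply (open_lt a). Qed.

(** * Towers of derivatives *)

(** Derivatives are carried as explicit sequences of functions, so that products, shifts and series
    of them can be written down before anything is known to be differentiable. Nothing is asked off
    [P]. *)
Definition tower (P : R -> Prop) (D : nat -> R -> C) : Prop :=
  forall n x, P x -> dC (D n) x (D (S n) x).

Definition sh (D : nat -> R -> C) (n : nat) : R -> C := D (S n).

(* Leibniz' rule without binomial coefficients. *)
Fixpoint prodT (D E : nat -> R -> C) (n : nat) (x : R) : C :=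
  match n with
  | O => (D O x * E O x)%C
  | S n' => (prodT (sh D) E n' x + prodT D (sh E) n' x)%C
  end.

Lemma tower_sub (P Q : R -> Prop) D :
  (forall x, Q x -> P x) -> tower P D -> tower Q D.
Proof. intros H T n x q; apply T; auto. Qed.

Lemma prodT_dC D E n x :
  (forall m, (m <= n)%nat -> dC (D m) x (D (S m) x)) ->
  (forall m, (m <= n)%nat -> dC (E m) x (E (S m) x)) ->
  dC (prodT D E n) x (prodT D E (S n) x).
Proof.
  revert D E. induction n as [|n IH]; intros D E HD HE.
  - simpl. unfold sh. apply dC_mult; [apply HD | apply HE]; auto.
  - change (prodT D E (S (S n)) x) with (prodT (sh D) E (S n) x + prodT D (sh E) (S n) x)%C.
    apply (dC_plus (fun t => prodT (sh D) E n t) (fun t => prodT D (sh E) n t));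
      apply IH; intros m Hm; unfold sh; auto with arith.
Qed.

Lemma tower_prodT P D E : tower P D -> tower P E -> tower P (prodT D E).
Proof. intros TD TE n x p. apply prodT_dC; auto. Qed.

Lemma prodT_ext D E D' E' n x :
  (forall m, (m <= n)%nat -> D m x = D' m x) ->
  (forall m, (m <= n)%nat -> E m x = E' m x) ->
  prodT D E n x = prodT D' E' n x.
Proof.
  revert D E D' E'; induction n as [|n IH]; intros D E D' E' H1 H2; simpl.
  - rewrite H1, H2; auto.
  - f_equal; apply IH; intros m Hm; unfold sh; auto with arith.
Qed.

Definition shiftT (s : R) (D : nat -> R -> C) (n : nat) (x : R) : C := D n (x + s).

Lemma tower_shiftT (P : R -> Prop) (s : R) D :
  tower P D -> tower (fun x => P (x + s)) (shiftT s D).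
Proof. intros T n x p. apply dC_shift. now apply T. Qed.

Definition plusT (D E : nat -> R -> C) (n : nat) (x : R) : C := (D n x + E n x)%C.
Definition minusT (D E : nat -> R -> C) (n : nat) (x : R) : C := (D n x - E n x)%C.
Definition cmultT (c : C) (D : nat -> R -> C) (n : nat) (x : R) : C := (c * D n x)%C.

Lemma tower_plusT P D E : tower P D -> tower P E -> tower P (plusT D E).
Proof. intros A B n x p. apply dC_plus; auto. Qed.

Lemma tower_minusT P D E : tower P D -> tower P E -> tower P (minusT D E).
Proof. intros A B n x p. apply dC_minus; auto. Qed.

Lemma tower_cmultT P c D : tower P D -> tower P (cmultT c D).
Proof. intros A n x p. apply dC_cmult; auto. Qed.

Definition reflT (D : nat -> R -> C) (n : nat) (x : R) : C := (RtoC ((-1) ^ n) * D n (- x)%R)%C.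

Lemma tower_reflT (P : R -> Prop) D :
  tower P D -> tower (fun x => P (- x)) (reflT D).
Proof.
  intros T n x p. unfold reflT.
  replace (RtoC ((-1) ^ S n) * D (S n) (- x)%R)%C
    with (RtoC ((-1) ^ n) * (RtoC (-1) * D (S n) (- x)%R))%C.
  - apply dC_cmult. apply (dC_comp (D n) Ropp).
    + evar_last; [apply @is_derive_opp, @is_derive_id |]. reflexivity.
    + now apply T.
  - rewrite Cmult_assoc, <- RtoC_mult. do 2 f_equal. simpl; ring.
Qed.

Lemma Cmod_reflT D n x : Cmod (reflT D n x) = Cmod (D n (- x)).
Proof.
  unfold reflT. rewrite Cmod_mult, Cmod_R, pow_1_abs. ring.
Qed.

(** Derivatives are unique, and openness of [P] lets an equality at order n be differentiated.
    Gluing and extending solutions thus only has to be checked at order 0. *)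
Lemma tower_eq (P : R -> Prop) D E :
  (forall x, P x -> locally x P) -> tower P D -> tower P E ->
  (forall x, P x -> D O x = E O x) -> forall n x, P x -> D n x = E n x.
Proof.
  intros O TD TE H n. induction n as [|n IH]; intros x p; [auto|].
  apply (dC_unique (D n) x); [now apply TD|].
  apply (dC_ext_loc (E n)); [|now apply TE].
  generalize (O x p). apply filter_imp. intros t pt; symmetry; auto.
Qed.

Lemma iterated_tower f D :
  iterated_derivatives f D <->
  ((forall x, D O x = f x) /\ tower (fun _ => True) D).
Proof.
  split; intros [A B]; split; auto.
  - intros n x _. now apply dC_iff.
  - intros n x. apply dC_iff. now apply B.
Qed.

(** * Majorants of product towers *)

(** The recursion of [prodT] on majorants: [i] and [j] count the derivatives already spent on each
    factor, [n] those still to be distributed. *)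
Fixpoint majR (A B : nat -> R) (n i j : nat) : R :=
  match n with
  | O => A i * B j
  | S n' => majR A B n' (S i) j + majR A B n' i (S j)
  end.

Lemma prodT_bound D E x (A B : nat -> R) n :
  (forall i, (i <= n)%nat -> Cmod (D i x) <= A i) ->
  (forall j, (j <= n)%nat -> Cmod (E j x) <= B j) ->
  Cmod (prodT D E n x) <= majR A B n 0 0.
Proof.
  intros HA HB.
  assert (G : forall m D' E' i j, (i + m <= n)%nat -> (j + m <= n)%nat ->
     (forall l, D' l = D (i + l)%nat) -> (forall l, E' l = E (j + l)%nat) ->
     Cmod (prodT D' E' m x) <= majR A B m i j).
  { induction m as [|m IH]; intros D' E' i j Hi Hj HD HE.
    - simpl. rewrite Cmod_mult, HD, HE, !Nat.add_0_r.
      apply Rmult_le_compat; try apply Cmod_ge_0; [apply HA | apply HB]; lia.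
    - simpl. eapply Rle_trans; [apply Cmod_triangle |].
      apply Rplus_le_compat; apply IH; try lia; intros l; unfold sh; rewrite ?HD, ?HE; f_equal; lia. }
  apply (G n); auto.
Qed.

Fixpoint rising (V : R) (n : nat) : R :=
  match n with O => 1 | S n' => rising V n' * (V + INR n') end.

Lemma rising_ge_0 V n : 0 <= V -> 0 <= rising V n.
Proof.
  intros H. induction n as [|n IH]; simpl; [lra|].
  apply Rmult_le_pos; [exact IH|]. generalize (pos_INR n); lra.
Qed.

Lemma rising_S_l V n : rising V (S n) = V * rising (V + 1) n.
Proof.
  induction n as [|n IH]; [simpl; ring|].
  change (rising V (S (S n))) with (rising V (S n) * (V + INR (S n))).
  rewrite IH, S_INR. simpl. ring.
Qed.

(* Vandermonde's identity for rising factorials. *)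
Lemma majR_rising a b kA kB s n i j :
  majR (fun l => kA * s ^ l * rising a l) (fun l => kB * s ^ l * rising b l) n i j
  = kA * kB * s ^ (n + i + j) * rising a i * rising b j * rising (a + b + INR i + INR j) n.
Proof.
  revert i j. induction n as [|n IH]; intros i j.
  - simpl. rewrite pow_add. ring.
  - change (majR (fun l => kA * s ^ l * rising a l) (fun l => kB * s ^ l * rising b l) (S n) i j)
      with (majR (fun l => kA * s ^ l * rising a l) (fun l => kB * s ^ l * rising b l) n (S i) j
          + majR (fun l => kA * s ^ l * rising a l) (fun l => kB * s ^ l * rising b l) n i (S j)).
    rewrite !IH, (rising_S_l (a + b + INR i + INR j) n), !S_INR.
    change (rising a (S i)) with (rising a i * (a + INR i)).
    change (rising b (S j)) with (rising b j * (b + INR j)).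
    replace (n + S i + j)%nat with (S n + i + j)%nat by lia.
    replace (n + i + S j)%nat with (S n + i + j)%nat by lia.
    replace (a + b + (INR i + 1) + INR j) with (a + b + INR i + INR j + 1) by ring.
    replace (a + b + INR i + (INR j + 1)) with (a + b + INR i + INR j + 1) by ring.
    ring.
Qed.

(** The rate [s] is the same in hypotheses and conclusion; only the parameters add. This is what
    lets products be iterated without limit. *)
Lemma prodT_rising D E x a b kA kB s n :
  (forall i, (i <= n)%nat -> Cmod (D i x) <= kA * s ^ i * rising a i) ->
  (forall j, (j <= n)%nat -> Cmod (E j x) <= kB * s ^ j * rising b j) ->
  Cmod (prodT D E n x) <= kA * kB * s ^ n * rising (a + b) n.
Proof.
  intros HA HB.
  eapply Rle_trans; [apply prodT_bound; [apply HA | apply HB]|].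
  rewrite majR_rising. simpl. rewrite !Nat.add_0_r, !Rplus_0_r. right; ring.
Qed.

Lemma rising_1 n : rising 1 n = INR (fact n).
Proof.
  induction n as [|n IH]; [reflexivity|].
  rewrite fact_simpl, mult_INR, <- IH, S_INR. simpl. ring.
Qed.

Lemma rising_le a b n : 0 <= a <= b -> rising a n <= rising b n.
Proof.
  intros H. induction n as [|n IH]; simpl; [lra|].
  generalize (pos_INR n); intros.
  apply Rmult_le_compat; try lra. now apply rising_ge_0.
Qed.

Lemma rising_pow V n : 0 <= V -> rising V n <= (V + INR n) ^ n.
Proof.
  intros H.
  assert (G : forall m, (m <= n)%nat -> rising V m <= (V + INR n) ^ m).
  { induction m as [|m IH]; intros Hm; simpl; [lra|].
    generalize (pos_INR m), (le_INR _ _ Hm); rewrite S_INR; intros.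
    rewrite Rmult_comm. apply Rmult_le_compat; try lra; [now apply rising_ge_0 | apply IH; lia]. }
  now apply G.
Qed.

Lemma pow_le_fact_exp y n : 0 <= y -> y ^ n <= INR (fact n) * exp y.
Proof.
  intros Hy.
  assert (F : 0 < INR (fact n)) by apply INR_fact_lt_0.
  assert (H : y ^ n / INR (fact n) <= exp y).
  { eapply Rle_trans; [|apply (exp_ge_taylor y n Hy)].
    destruct n as [|n]; [simpl; lra|].
    rewrite tech5.
    assert (0 <= sum_f_R0 (fun k : nat => y ^ k / INR (fact k)) n); [|lra].
    apply cond_pos_sum. intros k.
    apply Rdiv_le_0_compat; [now apply pow_le | apply INR_fact_lt_0]. }
  apply (Rmult_le_reg_r (/ INR (fact n))); [now apply Rinv_0_lt_compat|].
  replace (INR (fact n) * exp y * / INR (fact n)) with (exp y) by (field; lra). exact H.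
Qed.

Lemma exp_mul_INR y n : exp (INR n * y) = exp y ^ n.
Proof.
  induction n as [|n IH]; [simpl; rewrite Rmult_0_l; apply exp_0|].
  rewrite S_INR, Rmult_plus_distr_r, Rmult_1_l, exp_plus, IH. simpl. ring.
Qed.

(** Write (V + n)^n as eps^(-n) (eps (V + n))^n and use y^n <= n! exp y. A small [eps] makes the
    cost of a large [V] a small exponential, at the price of a larger geometric rate. *)
Lemma rising_exp V eps n : 0 <= V -> 0 < eps ->
  rising V n <= (exp eps / eps) ^ n * INR (fact n) * exp (eps * V).
Proof.
  intros HV He.
  eapply Rle_trans; [now apply rising_pow|].
  generalize (pos_INR n); intros Hn.
  assert (E : (V + INR n) ^ n = (/ eps) ^ n * (eps * (V + INR n)) ^ n).
  { rewrite <- Rpow_mult_distr. f_equal. field. lra. }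
  rewrite E.
  assert (E2 : exp (eps * (V + INR n)) = exp eps ^ n * exp (eps * V)).
  { rewrite <- exp_mul_INR, <- exp_plus. f_equal. ring. }
  replace ((exp eps / eps) ^ n * INR (fact n) * exp (eps * V))
    with ((/ eps) ^ n * (INR (fact n) * exp (eps * (V + INR n)))) by (unfold Rdiv; rewrite E2, Rpow_mult_distr; ring).
  apply Rmult_le_compat_l.
  - apply pow_le. left; now apply Rinv_0_lt_compat.
  - apply pow_le_fact_exp. apply Rmult_le_pos; lra.
Qed.

(** * Complex differentiability *)

Definition cder (f : C -> C) (z l : C) : Prop :=
  forall eps, 0 < eps -> exists eta, 0 < eta /\
  forall w, Cmod (w - z)%C < eta -> Cmod (f w - f z - l * (w - z))%C <= eps * Cmod (w - z)%C.

Lemma cder_iff (f : C -> C) (z l : C) :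
  @is_derive C_AbsRing C_NormedModule f z l <-> cder f z l.
Proof.
  split.
  - intros [_ H] eps He.
    destruct (H z (fun P p => p) (mkposreal eps He)) as [eta He2].
    exists eta; split; [apply cond_pos|].
    intros w Hw. specialize (He2 w Hw).
    eapply Rle_trans; [|exact He2]. right.
    unfold norm, minus, plus, opp, scal; simpl. f_equal. unfold mult; simpl. ring.
  - intros H. split; [apply is_linear_scal_l|].
    intros x Hx.
    assert (E : x = z).
    { symmetry. exact (is_filter_lim_locally_unique (V := AbsRing_NormedModule C_AbsRing) z x Hx). }
    subst x. intros eps.
    destruct (H eps (cond_pos eps)) as [eta [He1 He2]].
    exists (mkposreal eta He1). intros w Hw.
    eapply Rle_trans; [|exact (He2 w Hw)]. right.
    unfold norm, minus, plus, opp, scal; simpl. f_equal. unfold mult; simpl. ring.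
Qed.

(** The complex numbers carry two normed-module structures over themselves: holomorphy is stated in
    [C_NormedModule], the product rule in [AbsRing_NormedModule]. [cder] mediates between them. *)
Lemma cder_iff_ring (f : C -> C) (z l : C) :
  @is_derive C_AbsRing (AbsRing_NormedModule C_AbsRing) f z l <-> cder f z l.
Proof.
  split.
  - intros [_ H] eps He.
    destruct (H z (fun P p => p) (mkposreal eps He)) as [eta He2].
    exists eta; split; [apply cond_pos|].
    intros w Hw. specialize (He2 w Hw).
    eapply Rle_trans; [|exact He2]. right.
    unfold norm, minus, plus, opp, scal; simpl. unfold abs, mult; simpl. f_equal. ring.
  - intros H. split; [apply is_linear_scal_l|].
    intros x Hx.
    assert (E : x = z).
    { symmetry. exact (is_filter_lim_locally_unique (V := AbsRing_NormedModule C_AbsRing) z x Hx). }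
    subst x. intros eps.
    destruct (H eps (cond_pos eps)) as [eta [He1 He2]].
    exists (mkposreal eta He1). intros w Hw.
    eapply Rle_trans; [|exact (He2 w Hw)]. right.
    unfold norm, minus, plus, opp, scal; simpl. unfold abs, mult; simpl. f_equal. ring.
Qed.

Definition cdiff (f : C -> C) (z : C) : Prop := exists l, cder f z l.

Lemma cdiff_ex_derive (f : C -> C) (z : C) :
  @ex_derive C_AbsRing C_NormedModule f z <-> cdiff f z.
Proof. split; intros [l H]; exists l; now apply cder_iff. Qed.

Lemma cdiff_mult (f g : C -> C) (z : C) :
  cdiff f z -> cdiff g z -> cdiff (fun w => f w * g w)%C z.
Proof.
  intros [l Hl] [m Hm]. apply cder_iff_ring in Hl, Hm.
  eexists. apply cder_iff_ring.
  apply (@is_derive_mult C_AbsRing f g z l m Hl Hm). exact Cmult_comm.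
Qed.

Lemma cdiff_affine (a b z : C) : cdiff (fun w => a + b * w)%C z.
Proof.
  exists b. intros eps He. exists 1; split; [lra|]. intros w _.
  replace (a + b * w - (a + b * z) - b * (w - z))%C with (RtoC 0) by ring.
  rewrite Cmod_0. apply Rmult_le_pos; [lra | apply Cmod_ge_0].
Qed.

Lemma cder_bound (f : C -> C) (z l : C) : cder f z l ->
  exists eta, 0 < eta /\ forall w, Cmod (w - z)%C < eta ->
    Cmod (f w - f z)%C <= (Cmod l + 1) * Cmod (w - z)%C.
Proof.
  intros H. destruct (H 1 Rlt_0_1) as [eta [H1 H2]].
  exists eta; split; auto. intros w Hw. specialize (H2 w Hw).
  replace (f w - f z)%C with ((f w - f z - l * (w - z)) + l * (w - z))%C by ring.
  eapply Rle_trans; [apply Cmod_triangle|]. rewrite Cmod_mult. lra.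
Qed.

Lemma cder_Cinv (z : C) : z <> 0%C -> cder Cinv z (- / (z * z))%C.
Proof.
  intros Hz eps He.
  assert (P : 0 < Cmod z) by now apply Cmod_gt_0.
  set (m := Cmod z) in *.
  (* The error equals (w - z)^2 / (w z^2). The first bound keeps |w| >= m/2, and the second then
     makes |w - z| / (|w| m^2) at most [eps]. *)
  exists (Rmin (m / 2) (eps * (m * m * m) / 2)). split.
  { apply Rmin_pos; [lra|]. apply Rdiv_lt_0_compat; [|lra]. repeat apply Rmult_lt_0_compat; lra. }
  intros w Hw.
  assert (Hw1 : Cmod (w - z) < m / 2) by (eapply Rlt_le_trans; [exact Hw | apply Rmin_l]).
  assert (Hw2 : Cmod (w - z) < eps * (m * m * m) / 2) by (eapply Rlt_le_trans; [exact Hw | apply Rmin_r]).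
  assert (Hm : m / 2 <= Cmod w).
  { assert (m <= Cmod w + Cmod (w - z)).
    { unfold m. replace z with (w + - (w - z))%C at 1 by ring.
      eapply Rle_trans; [apply Cmod_triangle|]. rewrite Cmod_opp. lra. }
    lra. }
  assert (Hw0 : w <> 0%C) by (intros E; rewrite E, Cmod_0 in Hm; lra).
  replace (/ w - / z - - / (z * z) * (w - z))%C
    with ((w - z) * ((w - z) / (w * (z * z))))%C by (field; split; auto).
  rewrite Cmod_mult, Rmult_comm. apply Rmult_le_compat_r; [apply Cmod_ge_0|].
  rewrite Cmod_div by (repeat apply Cmult_neq_0; auto).
  rewrite !Cmod_mult. fold m.
  assert (D : m / 2 * (m * m) <= Cmod w * (m * m)).
  { apply Rmult_le_compat_r; [apply Rmult_le_pos; lra | exact Hm]. }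
  assert (D0 : 0 < m / 2 * (m * m)) by (repeat apply Rmult_lt_0_compat; lra).
  apply Rle_div_l; [lra|].
  left. eapply Rlt_le_trans; [exact Hw2|].
  replace (eps * (m * m * m) / 2) with (eps * (m / 2 * (m * m))) by field.
  apply Rmult_le_compat_l; lra.
Qed.

Lemma cdiff_div (f g : C -> C) (z : C) :
  cdiff f z -> cdiff g z -> g z <> 0%C -> cdiff (fun w => f w / g w)%C z.
Proof.
  intros Hf [m Hm] H0. apply cdiff_mult; [exact Hf|].
  apply cder_iff_ring in Hm.
  eexists. apply cder_iff.
  apply (@is_derive_comp C_AbsRing C_NormedModule Cinv g z).
  - apply cder_iff, cder_Cinv, H0.
  - exact Hm.
Qed.

(** * Integrals along segments and rectangles *)

Definition CInt (u : R -> C) (a b : R) : C :=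
  (RInt (fun t => Re (u t)) a b, RInt (fun t => Im (u t)) a b).

Definition ccont (u : R -> C) (t : R) : Prop :=
  continuous (fun s => Re (u s)) t /\ continuous (fun s => Im (u s)) t.

Definition ccont_on (u : R -> C) (a b : R) : Prop := forall t, a <= t <= b -> ccont u t.

Lemma ex_RInt_ccont u a b : a <= b -> ccont_on u a b ->
  ex_RInt (fun t => Re (u t)) a b /\ ex_RInt (fun t => Im (u t)) a b.
Proof.
  intros Hab H. split; apply (ex_RInt_continuous (V := R_CompleteNormedModule));
  intros z; rewrite Rmin_left, Rmax_right by lra; intros Hz; apply (H z Hz).
Qed.

Lemma CInt_ext u v a b : a <= b -> (forall t, a <= t <= b -> u t = v t) ->
  CInt u a b = CInt v a b.
Proof.
  intros Hab H. unfold CInt. f_equal; apply RInt_ext; intros t;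
  rewrite Rmin_left, Rmax_right by lra; intros Ht; rewrite H; auto; lra.
Qed.

Lemma CInt_Chasles u a b c : a <= b -> b <= c -> ccont_on u a c ->
  CInt u a c = (CInt u a b + CInt u b c)%C.
Proof.
  intros Hab Hbc H.
  destruct (ex_RInt_ccont u a b Hab) as [A1 A2]; [intros t Ht; apply H; lra|].
  destruct (ex_RInt_ccont u b c Hbc) as [B1 B2]; [intros t Ht; apply H; lra|].
  unfold CInt, Cplus; simpl. f_equal; symmetry.
  - exact (RInt_Chasles _ a b c A1 B1).
  - exact (RInt_Chasles _ a b c A2 B2).
Qed.

Lemma CInt_plus u v a b : a <= b -> ccont_on u a b -> ccont_on v a b ->
  CInt (fun t => u t + v t)%C a b = (CInt u a b + CInt v a b)%C.
Proof.
  intros Hab Hu Hv.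
  destruct (ex_RInt_ccont u a b Hab Hu) as [A1 A2].
  destruct (ex_RInt_ccont v a b Hab Hv) as [B1 B2].
  unfold CInt, Cplus; simpl. f_equal.
  - exact (RInt_plus _ _ a b A1 B1).
  - exact (RInt_plus _ _ a b A2 B2).
Qed.

Lemma CInt_cmult c u a b : a <= b -> ccont_on u a b ->
  CInt (fun t => c * u t)%C a b = (c * CInt u a b)%C.
Proof.
  intros Hab Hu.
  destruct (ex_RInt_ccont u a b Hab Hu) as [A1 A2].
  unfold CInt, Cmult; simpl. f_equal.
  - apply is_RInt_unique.
    apply (is_RInt_minus (V := R_NormedModule) (fun t => Re c * Re (u t)) (fun t => Im c * Im (u t)));
      apply (is_RInt_scal (V := R_NormedModule)); now apply (RInt_correct (V := R_CompleteNormedModule)).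
  - apply is_RInt_unique.
    apply (is_RInt_plus (V := R_NormedModule) (fun t => Re c * Im (u t)) (fun t => Im c * Re (u t)));
      apply (is_RInt_scal (V := R_NormedModule)); now apply (RInt_correct (V := R_CompleteNormedModule)).
Qed.

Lemma Cmod_le_Re_Im z : Cmod z <= Rabs (Re z) + Rabs (Im z).
Proof.
  destruct z as [x y]. unfold Re, Im; simpl.
  assert (E : Cmod (0, y) = Rabs y).
  { unfold Cmod; simpl. replace (0 * (0 * 1) + y * (y * 1)) with (Rsqr y) by (unfold Rsqr; ring).
    apply sqrt_Rsqr_abs. }
  rewrite <- E, <- (Cmod_R x).
  eapply Rle_trans; [|apply Cmod_triangle]. right. f_equal.
  unfold Cplus, RtoC; simpl; f_equal; ring.
Qed.

Lemma Re_le_Cmod z : Rabs (Re z) <= Cmod z.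
Proof.
  eapply Rle_trans; [|apply Rmax_Cmod]. apply Rmax_l.
Qed.

Lemma Im_le_Cmod z : Rabs (Im z) <= Cmod z.
Proof.
  eapply Rle_trans; [|apply Rmax_Cmod]. apply Rmax_r.
Qed.

Lemma CInt_bound u a b K : a <= b -> ccont_on u a b ->
  (forall t, a <= t <= b -> Cmod (u t) <= K) -> Cmod (CInt u a b) <= 2 * ((b - a) * K).
Proof.
  intros Hab Hu H.
  destruct (ex_RInt_ccont u a b Hab Hu) as [A1 A2].
  eapply Rle_trans; [apply Cmod_le_Re_Im|]. unfold CInt; simpl.
  assert (B1 : Rabs (RInt (fun t => Re (u t)) a b) <= (b - a) * K).
  { apply abs_RInt_le_const; auto. intros t Ht. eapply Rle_trans; [apply Re_le_Cmod | auto]. }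
  assert (B2 : Rabs (RInt (fun t => Im (u t)) a b) <= (b - a) * K).
  { apply abs_RInt_le_const; auto. intros t Ht. eapply Rle_trans; [apply Im_le_Cmod | auto]. }
  lra.
Qed.

Definition hor (u : C -> C) (y t : R) : C := u (t, y).
Definition ver (u : C -> C) (x t : R) : C := u (x, t).

(** The counterclockwise integral of u dz around [a,b] x [c,d]; the factor [Ci] is dz/dt on the
    vertical sides. *)
Definition contour (u : C -> C) (a b c d : R) : C :=
  (CInt (hor u c) a b + Ci * CInt (ver u b) c d
   - CInt (hor u d) a b - Ci * CInt (ver u a) c d)%C.

Lemma lipschitz_ccont (u : R -> C) (t L eta : R) : 0 < eta ->
  (forall s, Rabs (s - t) < eta -> Cmod (u s - u t)%C <= L * Rabs (s - t)) -> ccont u t.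
Proof.
  intros He H.
  assert (G : forall p : C -> R, (forall z w, Rabs (p z - p w) <= Cmod (z - w)%C) ->
    continuous (fun s => p (u s)) t).
  { intros p Hp. apply continuity_pt_filterlim.
    intros eps Heps.
    exists (Rmin eta (eps / (Rabs L + 1))). generalize (Rabs_pos L); intros HL. split.
    { apply Rmin_pos; [lra|]. apply Rdiv_lt_0_compat; lra. }
    intros s [_ Hs]. simpl in *. unfold R_dist in *.
    assert (S1 : Rabs (s - t) < eta) by (eapply Rlt_le_trans; [exact Hs | apply Rmin_l]).
    assert (S2 : Rabs (s - t) < eps / (Rabs L + 1)) by (eapply Rlt_le_trans; [exact Hs | apply Rmin_r]).
    eapply Rle_lt_trans; [apply Hp|].
    eapply Rle_lt_trans; [apply (H s S1)|].
    apply Rle_lt_trans with ((Rabs L + 1) * Rabs (s - t)).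
    - apply Rmult_le_compat_r; [apply Rabs_pos|]. generalize (RRle_abs L); lra.
    - rewrite Rmult_comm. apply Rlt_div_r; lra. }
  split; apply G; intros z w.
  - exact (Re_le_Cmod (z - w)%C).
  - exact (Im_le_Cmod (z - w)%C).
Qed.

Lemma hor_diff (x x' y : R) : ((x', y) - (x, y))%C = RtoC (x' - x).
Proof. unfold Cminus, Cplus, Copp, RtoC; simpl; f_equal; ring. Qed.

Lemma ver_diff (x y y' : R) : ((x, y') - (x, y))%C = (Ci * RtoC (y' - y))%C.
Proof. unfold Cminus, Cplus, Copp, RtoC, Cmult, Ci; simpl; f_equal; ring. Qed.

Lemma Cmod_Ci_R (y : R) : Cmod (Ci * RtoC y)%C = Rabs y.
Proof.
  rewrite Cmod_mult, Cmod_R. replace (Cmod Ci) with 1; [ring|].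
  unfold Cmod, Ci; simpl. replace (0 * (0 * 1) + 1 * (1 * 1)) with 1 by ring. now rewrite sqrt_1.
Qed.

Lemma ccont_hor (u : C -> C) (x y : R) : cdiff u (x, y) -> ccont (hor u y) x.
Proof.
  intros [l Hl]. destruct (cder_bound u _ l Hl) as [eta [H1 H2]].
  apply (lipschitz_ccont _ x (Cmod l + 1) eta H1).
  intros s Hs. unfold hor. specialize (H2 (s, y)).
  rewrite hor_diff, Cmod_R in H2. auto.
Qed.

Lemma ccont_ver (u : C -> C) (x y : R) : cdiff u (x, y) -> ccont (ver u x) y.
Proof.
  intros [l Hl]. destruct (cder_bound u _ l Hl) as [eta [H1 H2]].
  apply (lipschitz_ccont _ y (Cmod l + 1) eta H1).
  intros s Hs. unfold ver. specialize (H2 (x, s)).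
  rewrite ver_diff, Cmod_Ci_R in H2. auto.
Qed.

Definition bcont (u : C -> C) (a b c d : R) : Prop :=
  ccont_on (hor u c) a b /\ ccont_on (hor u d) a b /\
  ccont_on (ver u a) c d /\ ccont_on (ver u b) c d.

Lemma bcont_cdiff u a b c d : a <= b -> c <= d ->
  (forall x y, a <= x <= b -> c <= y <= d ->
     x = a \/ x = b \/ y = c \/ y = d -> cdiff u (x, y)) -> bcont u a b c d.
Proof.
  intros Hab Hcd H.
  split; [|split; [|split]]; intros t Ht; first [apply ccont_hor | apply ccont_ver]; apply H; auto; lra.
Qed.

Lemma contour_plus u v a b c d : a <= b -> c <= d -> bcont u a b c d -> bcont v a b c d ->
  contour (fun z => u z + v z)%C a b c d = (contour u a b c d + contour v a b c d)%C.
Proof.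
  intros Hab Hcd (A1 & A2 & A3 & A4) (B1 & B2 & B3 & B4). unfold contour.
  rewrite (CInt_plus (hor u c) (hor v c)), (CInt_plus (hor u d) (hor v d)),
    (CInt_plus (ver u a) (ver v a)), (CInt_plus (ver u b) (ver v b)); auto. ring.
Qed.

Lemma contour_cmult k u a b c d : a <= b -> c <= d -> bcont u a b c d ->
  contour (fun z => k * u z)%C a b c d = (k * contour u a b c d)%C.
Proof.
  intros Hab Hcd (A1 & A2 & A3 & A4). unfold contour.
  rewrite (CInt_cmult k (hor u c)), (CInt_cmult k (hor u d)),
    (CInt_cmult k (ver u a)), (CInt_cmult k (ver u b)); auto. ring.
Qed.

Lemma contour_ext u v a b c d : a <= b -> c <= d ->
  (forall x y, a <= x <= b -> c <= y <= d ->
     x = a \/ x = b \/ y = c \/ y = d -> u (x, y) = v (x, y)) ->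
  contour u a b c d = contour v a b c d.
Proof.
  intros Hab Hcd H. unfold contour.
  rewrite (CInt_ext (hor u c) (hor v c)), (CInt_ext (hor u d) (hor v d)),
    (CInt_ext (ver u a) (ver v a)), (CInt_ext (ver u b) (ver v b)); auto;
  intros t Ht; apply H; auto; lra.
Qed.

Lemma contour_bound u a b c d K : a <= b -> c <= d -> bcont u a b c d ->
  (forall x y, a <= x <= b -> c <= y <= d ->
     x = a \/ x = b \/ y = c \/ y = d -> Cmod (u (x, y)) <= K) ->
  Cmod (contour u a b c d) <= 4 * ((b - a) + (d - c)) * K.
Proof.
  intros Hab Hcd (A1 & A2 & A3 & A4) H. unfold contour.
  assert (M1 : Cmod (CInt (hor u c) a b) <= 2 * ((b - a) * K)).
  { apply CInt_bound; auto. intros t Ht; apply H; auto; lra. }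
  assert (M2 : Cmod (CInt (hor u d) a b) <= 2 * ((b - a) * K)).
  { apply CInt_bound; auto. intros t Ht; apply H; auto; lra. }
  assert (M3 : Cmod (CInt (ver u a) c d) <= 2 * ((d - c) * K)).
  { apply CInt_bound; auto. intros t Ht; apply H; auto; lra. }
  assert (M4 : Cmod (CInt (ver u b) c d) <= 2 * ((d - c) * K)).
  { apply CInt_bound; auto. intros t Ht; apply H; auto; lra. }
  assert (I : Cmod Ci = 1) by (generalize (Cmod_Ci_R 1); rewrite Cmult_1_r, Rabs_R1; auto).
  unfold Cminus. eapply Rle_trans; [apply Cmod_triangle|].
  rewrite Cmod_opp, Cmod_mult, I.
  eapply Rle_trans; [apply Rplus_le_compat_r, Cmod_triangle|]. rewrite Cmod_opp.
  eapply Rle_trans; [apply Rplus_le_compat_r, Rplus_le_compat_r, Cmod_triangle|].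
  rewrite Cmod_mult, I. lra.
Qed.

Lemma contour_split_x u a m b c d : a <= m <= b ->
  ccont_on (hor u c) a b -> ccont_on (hor u d) a b ->
  contour u a b c d = (contour u a m c d + contour u m b c d)%C.
Proof.
  intros H H1 H2. unfold contour.
  rewrite (CInt_Chasles (hor u c) a m b), (CInt_Chasles (hor u d) a m b); auto; try lra. ring.
Qed.

Lemma contour_split_y u a b c m d : c <= m <= d ->
  ccont_on (ver u a) c d -> ccont_on (ver u b) c d ->
  contour u a b c d = (contour u a b c m + contour u a b m d)%C.
Proof.
  intros H H1 H2. unfold contour.
  rewrite (CInt_Chasles (ver u a) c m d), (CInt_Chasles (ver u b) c m d); auto; try lra. ring.
Qed.

Lemma RInt_affine p q a b : RInt (fun t => p + q * t) a b = p * (b - a) + q * (b * b - a * a) / 2.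
Proof.
  apply is_RInt_unique.
  replace (p * (b - a) + q * (b * b - a * a) / 2)
    with (minus (p * b + q * b * b / 2) (p * a + q * a * a / 2))
    by (unfold minus, plus, opp; simpl; field).
  apply (is_RInt_derive (fun t => p * t + q * t * t / 2)).
  - intros x _. auto_derive; auto. field.
  - intros x _. apply (ex_derive_continuous (fun t => p + q * t)). auto_derive; auto.
Qed.

Lemma CInt_affine (u : R -> C) (p q : C) a b :
  (forall t, u t = p + q * RtoC t)%C ->
  CInt u a b = (p * RtoC (b - a) + q * RtoC ((b * b - a * a) / 2))%C.
Proof.
  intros H. unfold CInt.
  rewrite (RInt_ext _ (fun t => Re p + Re q * t)) by (intros t _; rewrite H; unfold Re, Im; simpl; ring).
  rewrite (RInt_ext (fun t => Im (u t)) (fun t => Im p + Im q * t)) by (intros t _; rewrite H; unfold Re, Im; simpl; ring).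
  rewrite !RInt_affine. unfold Re, Im, Cplus, Cmult; simpl. f_equal; field.
Qed.

Lemma contour_affine (p q : C) a b c d : contour (fun z => p + q * z)%C a b c d = 0%C.
Proof.
  unfold contour.
  rewrite (CInt_affine (hor _ c) (p + q * Ci * RtoC c)%C q),
    (CInt_affine (hor _ d) (p + q * Ci * RtoC d)%C q),
    (CInt_affine (ver _ a) (p + q * RtoC a)%C (q * Ci)%C),
    (CInt_affine (ver _ b) (p + q * RtoC b)%C (q * Ci)%C).
  - destruct p as [p1 p2], q as [q1 q2].
    apply injective_projections; unfold Cplus, Cminus, Cmult, Copp, Ci, RtoC; simpl; field.
  - intros t; destruct p as [p1 p2], q as [q1 q2].
    unfold ver, Cplus, Cminus, Cmult, Copp, Ci, RtoC; simpl. apply injective_projections; simpl; ring.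
  - intros t; destruct p as [p1 p2], q as [q1 q2].
    unfold ver, Cplus, Cminus, Cmult, Copp, Ci, RtoC; simpl. apply injective_projections; simpl; ring.
  - intros t; destruct p as [p1 p2], q as [q1 q2].
    unfold hor, Cplus, Cminus, Cmult, Copp, Ci, RtoC; simpl. apply injective_projections; simpl; ring.
  - intros t; destruct p as [p1 p2], q as [q1 q2].
    unfold hor, Cplus, Cminus, Cmult, Copp, Ci, RtoC; simpl. apply injective_projections; simpl; ring.
Qed.

(** * Goursat's theorem on rectangles *)

Lemma nested_intervals (u : nat -> R) (w : R) : 0 <= w ->
  (forall n, u n <= u (S n) /\ u (S n) + w / 2 ^ S n <= u n + w / 2 ^ n) ->
  exists l, forall n, u n <= l <= u n + w / 2 ^ n.
Proof.
  intros Hw H.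
  assert (P : forall n, 0 <= w / 2 ^ n).
  { intros n. apply Rdiv_le_0_compat; [lra | apply pow_lt; lra]. }
  assert (M : forall n k, u n <= u (n + k)%nat).
  { intros n k. induction k as [|k IH]; [rewrite Nat.add_0_r; lra|].
    rewrite Nat.add_succ_r. destruct (H (n + k)%nat). lra. }
  assert (N : forall n k, u (n + k)%nat + w / 2 ^ (n + k) <= u n + w / 2 ^ n).
  { intros n k. induction k as [|k IH]; [rewrite Nat.add_0_r; lra|].
    rewrite Nat.add_succ_r. destruct (H (n + k)%nat). lra. }
  assert (B : forall n m, u m <= u n + w / 2 ^ n).
  { intros n m. destruct (Nat.le_ge_cases n m) as [L|L].
    - replace m with (n + (m - n))%nat by lia.
      generalize (N n (m - n)%nat) (P (n + (m - n))%nat). lra.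
    - generalize (M m (n - m)%nat) (P n). replace (m + (n - m))%nat with n by lia. lra. }
  destruct (completeness (fun x => exists n, x = u n)) as [l [L1 L2]].
  - exists (u O + w / 2 ^ 0). intros x [n ->]. apply B.
  - exists (u O), O. reflexivity.
  - exists l. intros n. split.
    + apply L1. now exists n.
    + apply L2. intros x [m ->]. apply B.
Qed.

(* Cousin's lemma for quadrisections; [x, y, w, h] are the lower left corner, the
   width and the height of a rectangle. *)
Lemma rect_induction (Q : R -> R -> R -> R -> Prop) (x y w h : R) :
  0 <= w -> 0 <= h ->
  (forall x y w h, 0 <= w -> 0 <= h ->
     Q x y (w / 2) (h / 2) -> Q (x + w / 2) y (w / 2) (h / 2) ->
     Q x (y + h / 2) (w / 2) (h / 2) -> Q (x + w / 2) (y + h / 2) (w / 2) (h / 2) ->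
     Q x y w h) ->
  (forall p q, x <= p <= x + w -> y <= q <= y + h ->
     exists eta, 0 < eta /\ forall x' y' w' h', 0 <= w' < eta -> 0 <= h' < eta ->
       x' <= p <= x' + w' -> y' <= q <= y' + h' -> Q x' y' w' h') ->
  Q x y w h.
Proof.
  intros Hw Hh Hsplit Hloc. apply NNPP; intros HQ.
  (* A quarter on which [Q] fails is chosen. The last one is taken by default: by [Hsplit] it must
     fail if the other three do not. *)
  set (next := fun (n : nat) (p : R * R) =>
    let w' := w / 2 ^ S n in let h' := h / 2 ^ S n in
    if excluded_middle_informative (~ Q (fst p) (snd p) w' h') then p else
    if excluded_middle_informative (~ Q (fst p + w') (snd p) w' h') then (fst p + w', snd p) else
    if excluded_middle_informative (~ Q (fst p) (snd p + h') w' h') then (fst p, snd p + h') else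
    (fst p + w', snd p + h')).
  set (u := fix u n := match n with O => (x, y) | S n' => next n' (u n') end).
  assert (HalfW : forall v n, v / 2 ^ S n = v / 2 ^ n / 2).
  { intros v n. simpl. field. apply pow_nonzero; lra. }
  assert (P : forall v n, 0 <= v -> 0 <= v / 2 ^ n).
  { intros v n Hv. apply Rdiv_le_0_compat; [lra | apply pow_lt; lra]. }
  assert (Inv : forall n, ~ Q (fst (u n)) (snd (u n)) (w / 2 ^ n) (h / 2 ^ n)).
  { induction n as [|n IH].
    - simpl. replace (w / 1) with w by field. replace (h / 1) with h by field. exact HQ.
    - change (u (S n)) with (next n (u n)). unfold next.
      repeat (destruct (excluded_middle_informative _) as [?N|?N]; [assumption|]).
      intros N'. apply IH. apply Hsplit; auto; rewrite <- !HalfW;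
      first [exact N' | apply NNPP; assumption]. }
  assert (St : forall n,
     (fst (u n) <= fst (u (S n)) /\ fst (u (S n)) + w / 2 ^ S n <= fst (u n) + w / 2 ^ n) /\
     (snd (u n) <= snd (u (S n)) /\ snd (u (S n)) + h / 2 ^ S n <= snd (u n) + h / 2 ^ n)).
  { intros n. generalize (P w n Hw) (P h n Hh).
    change (u (S n)) with (next n (u n)). unfold next. rewrite !HalfW.
    repeat (destruct (excluded_middle_informative _) as [?N|?N]; [simpl; lra|]). simpl; lra. }
  destruct (nested_intervals (fun n => fst (u n)) w Hw (fun n => proj1 (St n))) as [p Hp].
  destruct (nested_intervals (fun n => snd (u n)) h Hh (fun n => proj2 (St n))) as [q Hq].
  assert (Hp0 := Hp O). assert (Hq0 := Hq O). simpl in Hp0, Hq0.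
  destruct (Hloc p q) as [eta [He1 He2]]; try lra.
  destruct (pow_lt_1_zero (/ 2)) with (y := eta / (w + h + 1)) as [N HN].
  { rewrite Rabs_pos_eq; lra. }
  { apply Rdiv_lt_0_compat; lra. }
  specialize (HN N (Nat.le_refl N)).
  rewrite pow_inv, Rabs_pos_eq in HN by (left; apply Rinv_0_lt_compat, pow_lt; lra).
  assert (HN' : (w + h + 1) * / 2 ^ N < eta).
  { rewrite Rmult_comm. apply Rlt_div_r; lra. }
  assert (I : 0 < / 2 ^ N) by (apply Rinv_0_lt_compat, pow_lt; lra).
  apply (Inv N). apply He2; auto; split; auto; unfold Rdiv; nra.
Qed.

Definition cdiff_on (u : C -> C) (a b c d : R) : Prop :=
  forall x y, a <= x <= b -> c <= y <= d -> cdiff u (x, y).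

Lemma Cmod_le_hor_ver (p q x y w h x' y' : R) :
  x' <= p <= x' + w -> y' <= q <= y' + h -> x' <= x <= x' + w -> y' <= y <= y' + h ->
  Cmod ((x, y) - (p, q))%C <= w + h.
Proof.
  intros. eapply Rle_trans; [apply Cmod_le_Re_Im|]. simpl.
  apply Rplus_le_compat; apply Rabs_le; lra.
Qed.

(** The bound eps (w + h)^2 passes from four quarters to the whole, since each quarter has half the
    width and half the height. So it only has to be shown for small rectangles around a point, where
    differentiability gives it. *)
Theorem Goursat (u : C -> C) (a b c d : R) : a <= b -> c <= d ->
  cdiff_on u a b c d -> contour u a b c d = 0%C.
Proof.
  intros Hab Hcd H.
  assert (G : forall eps, 0 < eps ->
    Cmod (contour u a b c d) <= eps * (((b - a) + (d - c)) * ((b - a) + (d - c)))).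
  { intros eps Heps.
    set (Q := fun x y w h => a <= x -> x + w <= b -> c <= y -> y + h <= d ->
      Cmod (contour u x (x + w) y (y + h)) <= eps * ((w + h) * (w + h))).
    assert (HQ : Q a c (b - a) (d - c)).
    { apply rect_induction; try lra.
      - intros x y w h Hw Hh Q1 Q2 Q3 Q4 X1 X2 Y1 Y2.
        unfold Q in *.
        rewrite (contour_split_x u x (x + w / 2) (x + w)),
          (contour_split_y u x (x + w / 2) y (y + h / 2) (y + h)),
          (contour_split_y u (x + w / 2) (x + w) y (y + h / 2) (y + h));
          try lra; try (intros t Ht; first [apply ccont_hor | apply ccont_ver]; apply H; lra).
        specialize (Q1 ltac:(lra) ltac:(lra) ltac:(lra) ltac:(lra)).
        specialize (Q2 ltac:(lra) ltac:(lra) ltac:(lra) ltac:(lra)).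
        specialize (Q3 ltac:(lra) ltac:(lra) ltac:(lra) ltac:(lra)).
        specialize (Q4 ltac:(lra) ltac:(lra) ltac:(lra) ltac:(lra)).
        replace (x + w / 2 + w / 2) with (x + w) in * by field.
        replace (y + h / 2 + h / 2) with (y + h) in * by field.
        eapply Rle_trans; [apply Cmod_triangle|].
        eapply Rle_trans; [apply Rplus_le_compat; apply Cmod_triangle|].
        replace (eps * ((w + h) * (w + h))) with
          (4 * (eps * ((w / 2 + h / 2) * (w / 2 + h / 2)))) by field.
        lra.
      - intros p q Hp Hq. destruct (H p q) as [l Hl]; try lra.
        destruct (Hl (eps / 4)) as [eta [He1 He2]]; [lra|].
        exists (eta / 2); split; [lra|].
        intros x y w h Hw Hh Hpx Hqy X1 X2 Y1 Y2.
        (* [r] is [u] minus its first-order Taylor polynomial at (p, q). Affine functions have zero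
           contour integral, and eps/4 cancels the 4 in [contour_bound]. *)
        set (A := (u (p, q) - l * (p, q))%C).
        set (r := fun z => (u z + (- A + - l * z))%C).
        assert (Hr : cdiff_on r x (x + w) y (y + h)).
        { intros s t Hs Ht. destruct (H s t) as [m Hm]; try lra.
          destruct (cdiff_affine (- A)%C (- l)%C (s, t)) as [m' Hm'].
          exists (m + m')%C. intros e He.
          destruct (Hm (e / 2)) as [e1 [E1 E2]]; [lra|].
          destruct (Hm' (e / 2)) as [e2 [E3 E4]]; [lra|].
          exists (Rmin e1 e2). split; [now apply Rmin_pos|]. intros z Hz.
          assert (Z1 := E2 z (Rlt_le_trans _ _ _ Hz (Rmin_l _ _))).
          assert (Z2 := E4 z (Rlt_le_trans _ _ _ Hz (Rmin_r _ _))).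
          unfold r.
          replace (u z + (- A + - l * z) - (u (s, t) + (- A + - l * (s, t))) - (m + m') * (z - (s, t)))%C
            with ((u z - u (s, t) - m * (z - (s, t))) +
                  (- A + - l * z - (- A + - l * (s, t)) - m' * (z - (s, t))))%C by ring.
          eapply Rle_trans; [apply Cmod_triangle|]. lra. }
        assert (Br : bcont r x (x + w) y (y + h)).
        { apply bcont_cdiff; try lra. intros; apply Hr; lra. }
        assert (E : contour u x (x + w) y (y + h) = contour r x (x + w) y (y + h)).
        { rewrite (contour_ext u (fun z => r z + (A + l * z))%C); try lra.
          2:{ intros. unfold r. ring. }
          rewrite (contour_plus r (fun z => A + l * z)%C); auto; try lra.
          - rewrite contour_affine. ring.
          - apply bcont_cdiff; try lra. intros; apply cdiff_affine. }
        rewrite E.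
        eapply Rle_trans; [apply (contour_bound r x (x + w) y (y + h) (eps / 4 * (w + h))); auto; try lra|].
        + intros s t Hs Ht _.
          assert (D : Cmod ((s, t) - (p, q))%C <= w + h)
            by (apply (Cmod_le_hor_ver p q s t w h x y); lra).
          replace (r (s, t)) with (u (s, t) - u (p, q) - l * ((s, t) - (p, q)))%C
            by (unfold r, A; ring).
          eapply Rle_trans; [apply He2; lra|].
          apply Rmult_le_compat_l; lra.
        + right. field. }
    unfold Q in HQ.
    replace (a + (b - a)) with b in HQ by ring. replace (c + (d - c)) with d in HQ by ring.
    apply HQ; lra. }
  apply Cmod_eq_0. apply Rle_antisym; [|apply Cmod_ge_0].
  set (S := ((b - a) + (d - c)) * ((b - a) + (d - c))) in *.
  assert (0 <= S) by (apply Rmult_le_pos; lra).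
  apply le_epsilon. intros eps He. rewrite Rplus_0_l.
  eapply Rle_trans; [apply (G (eps / (S + 1)))|].
  - apply Rdiv_lt_0_compat; lra.
  - apply Rle_trans with (eps / (S + 1) * (S + 1)); [|right; field; lra].
    apply Rmult_le_compat_l; [|lra]. apply Rdiv_le_0_compat; lra.
Qed.

(** Two full-height side strips and the pieces above and below the inner rectangle are cut off; by
    [Goursat] each of the four contributes nothing. *)
Lemma contour_frame (u : C -> C) (a a' b' b c c' d' d : R) :
  a <= a' -> a' <= b' -> b' <= b -> c <= c' -> c' <= d' -> d' <= d ->
  (forall x y, a <= x <= b -> c <= y <= d ->
     ~ (a' < x < b' /\ c' < y < d') -> cdiff u (x, y)) ->
  contour u a b c d = contour u a' b' c' d'.
Proof.
  intros A1 A2 A3 C1 C2 C3 H.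
  assert (Z : forall p q r s, a <= p -> p <= q -> q <= b -> c <= r -> r <= s -> s <= d ->
    (q <= a' \/ b' <= p \/ s <= c' \/ d' <= r) -> contour u p q r s = 0%C).
  { intros p q r s P1 P2 P3 P4 P5 P6 P7. apply Goursat; auto.
    intros x y Hx Hy. apply H; lra. }
  rewrite (contour_split_x u a a' b), (contour_split_x u a' b' b),
    (contour_split_y u a' b' c c' d), (contour_split_y u a' b' c' d' d);
    try lra; try (intros t Ht; first [apply ccont_hor | apply ccont_ver]; apply H; lra).
  rewrite (Z a a' c d), (Z b' b c d), (Z a' b' c c'), (Z a' b' d' d); try lra.
  ring.
Qed.

(** * Cauchy's integral formula on squares *)

Lemma RInt_Cauchy_kernel (x s : R) : 0 < s ->
  RInt (fun t => s / ((t - x) * (t - x) + s * s)) (x - s) (x + s) = PI / 2.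
Proof.
  intros Hs.
  assert (Pos : forall t, 0 < (t - x) * (t - x) + s * s).
  { intros t. generalize (Rle_0_sqr (t - x)) (Rmult_lt_0_compat _ _ Hs Hs). unfold Rsqr. lra. }
  apply is_RInt_unique.
  replace (PI / 2) with (minus (atan ((x + s - x) / s)) (atan ((x - s - x) / s))).
  - apply (is_RInt_derive (fun t => atan ((t - x) / s))).
    + intros t _. auto_derive; [auto|]. specialize (Pos t).
      replace (1 + (t + - x) * / s * ((t + - x) * / s * 1))
        with (((t - x) * (t - x) + s * s) / (s * s)) by (field; lra).
      field. split; lra.
    + intros t _. apply (ex_derive_continuous (fun t => s / ((t - x) * (t - x) + s * s))).
      auto_derive. specialize (Pos t). lra.
  - replace ((x + s - x) / s) with 1 by (field; lra).
    replace ((x - s - x) / s) with (- (1)) by (field; lra).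
    rewrite atan_opp, atan_1. unfold minus, plus, opp; simpl. field.
Qed.

Lemma RInt_conjugate_Cauchy_kernel (x s : R) : 0 < s ->
  RInt (fun t => (t - x) / ((t - x) * (t - x) + s * s)) (x - s) (x + s) = 0.
Proof.
  intros Hs.
  assert (Pos : forall t, 0 < (t - x) * (t - x) + s * s).
  { intros t. generalize (Rle_0_sqr (t - x)) (Rmult_lt_0_compat _ _ Hs Hs). unfold Rsqr. lra. }
  apply is_RInt_unique.
  set (F := fun t => ln ((t - x) * (t - x) + s * s) / 2).
  replace 0 with (minus (F (x + s)) (F (x - s))).
  - apply (is_RInt_derive F).
    + intros t _. specialize (Pos t). unfold F. auto_derive; [lra|]. field. lra.
    + intros t _. apply (ex_derive_continuous (fun t => (t - x) / ((t - x) * (t - x) + s * s))).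
      auto_derive. specialize (Pos t). lra.
  - unfold F, minus, plus, opp; simpl.
    replace ((x - s - x) * (x - s - x)) with ((x + s - x) * (x + s - x)) by ring. ring.
Qed.

(** The shape of 1/(z - x) on a side of a square centred at x. The [p] part is odd about the
    midpoint and integrates to 0; the [q] part is an arctangent running from -pi/4 to pi/4. *)
Lemma CInt_log_atan (u : R -> C) (p q : C) (y s : R) : 0 < s ->
  (forall t, u t = (p * RtoC ((t - y) / ((t - y) * (t - y) + s * s))
                   + q * RtoC (s / ((t - y) * (t - y) + s * s)))%C) ->
  CInt u (y - s) (y + s) = (q * RtoC (PI / 2))%C.
Proof.
  intros Hs H.
  assert (Pos : forall t, 0 < (t - y) * (t - y) + s * s).
  { intros t. generalize (Rle_0_sqr (t - y)) (Rmult_lt_0_compat _ _ Hs Hs). unfold Rsqr. lra. }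
  set (f := fun t => (t - y) / ((t - y) * (t - y) + s * s)) in *.
  set (g := fun t => s / ((t - y) * (t - y) + s * s)) in *.
  assert (F : ex_RInt f (y - s) (y + s)).
  { apply (ex_RInt_continuous (V := R_CompleteNormedModule)). intros t _.
    apply (ex_derive_continuous f). unfold f. auto_derive. specialize (Pos t). lra. }
  assert (G : ex_RInt g (y - s) (y + s)).
  { apply (ex_RInt_continuous (V := R_CompleteNormedModule)). intros t _.
    apply (ex_derive_continuous g). unfold g. auto_derive. specialize (Pos t). lra. }
  assert (L : forall k l, RInt (fun t => k * f t + l * g t) (y - s) (y + s) = l * (PI / 2)).
  { intros k l. apply is_RInt_unique.
    replace (l * (PI / 2)) with (plus (k * RInt f (y - s) (y + s)) (l * RInt g (y - s) (y + s))).
    - apply (is_RInt_plus (V := R_NormedModule) (fun t => k * f t) (fun t => l * g t));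
      apply (is_RInt_scal (V := R_NormedModule)); now apply (RInt_correct (V := R_CompleteNormedModule)).
    - unfold f, g. rewrite RInt_conjugate_Cauchy_kernel, RInt_Cauchy_kernel by auto. unfold plus; simpl. ring. }
  unfold CInt.
  rewrite (RInt_ext (fun t => Re (u t)) (fun t => Re p * f t + Re q * g t)).
  2:{ intros t _. rewrite H. unfold f, g, Re, Im; simpl. ring. }
  rewrite (RInt_ext (fun t => Im (u t)) (fun t => Im p * f t + Im q * g t)).
  2:{ intros t _. rewrite H. unfold f, g, Re, Im; simpl. ring. }
  rewrite !L. apply injective_projections; unfold Re, Im; simpl; ring.
Qed.

Lemma Cinv_pair (x y D : R) : x * x + y * y = D -> 0 < D -> (/ (x, y))%C = (x / D, - y / D).
Proof.
  intros <- HD. unfold Cinv; simpl. apply injective_projections; simpl; field; lra.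
Qed.

(** Each of the four sides contributes i pi/2. *)
Lemma contour_inv (x s : R) : 0 < s ->
  contour (fun z => / (z - RtoC x))%C (x - s) (x + s) (- s) s = (2 * PI * Ci)%C.
Proof.
  intros Hs.
  assert (Pos : forall t y, 0 < (t - y) * (t - y) + s * s).
  { intros t y. generalize (Rle_0_sqr (t - y)) (Rmult_lt_0_compat _ _ Hs Hs). unfold Rsqr. lra. }
  unfold contour.
  rewrite (CInt_log_atan (hor _ (- s)) 1 Ci x s Hs), (CInt_log_atan (hor _ s) 1 (- Ci)%C x s Hs).
  - assert (V : forall u p q, (forall t, u t = (p * RtoC ((t - 0) / ((t - 0) * (t - 0) + s * s))
        + q * RtoC (s / ((t - 0) * (t - 0) + s * s)))%C) -> CInt u (- s) s = (q * RtoC (PI / 2))%C).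
    { intros u p q H. generalize (CInt_log_atan u p q 0 s Hs H). now rewrite Rminus_0_l, Rplus_0_l. }
    rewrite (V (ver _ (x + s)) (- Ci)%C 1), (V (ver _ (x - s)) (- Ci)%C (- 1)%C).
    + apply injective_projections; simpl; field.
    + intros t. unfold ver.
      replace (((x - s)%R, t) - RtoC x)%C with ((- s, t - 0)%R : C) by (apply injective_projections; simpl; ring).
      rewrite (Cinv_pair _ _ ((t - 0) * (t - 0) + s * s)) by (auto; ring).
      specialize (Pos t 0). apply injective_projections; simpl; field; lra.
    + intros t. unfold ver.
      replace (((x + s)%R, t) - RtoC x)%C with ((s, t - 0)%R : C) by (apply injective_projections; simpl; ring).
      rewrite (Cinv_pair _ _ ((t - 0) * (t - 0) + s * s)) by (auto; ring).
      specialize (Pos t 0). apply injective_projections; simpl; field; lra.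
  - intros t. unfold hor.
    replace ((t, s) - RtoC x)%C with ((t - x, s)%R : C) by (apply injective_projections; simpl; ring).
    rewrite (Cinv_pair _ _ ((t - x) * (t - x) + s * s)) by auto.
    specialize (Pos t x). apply injective_projections; simpl; field; lra.
  - intros t. unfold hor.
    replace ((t, (- s)%R) - RtoC x)%C with ((t - x, - s)%R : C) by (apply injective_projections; simpl; ring).
    rewrite (Cinv_pair _ _ ((t - x) * (t - x) + s * s)) by (auto; ring).
    specialize (Pos t x). apply injective_projections; simpl; field; lra.
Qed.

Lemma cdiff_ext (f g : C -> C) (z : C) : (forall w, f w = g w) -> cdiff f z -> cdiff g z.
Proof.
  intros H [l Hl]. exists l. intros e He. destruct (Hl e He) as [eta [E1 E2]].
  exists eta; split; auto. intros w Hw. rewrite <- !H. auto.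
Qed.

Lemma cdiff_plus (f g : C -> C) (z : C) :
  cdiff f z -> cdiff g z -> cdiff (fun w => f w + g w)%C z.
Proof.
  intros [l Hl] [m Hm]. apply cder_iff in Hl, Hm.
  eexists. apply cder_iff. apply (@is_derive_plus C_AbsRing C_NormedModule f g z l m Hl Hm).
Qed.

Lemma cdiff_const (c z : C) : cdiff (fun _ => c) z.
Proof. apply (cdiff_ext (fun w => c + 0 * w)%C); [intros; ring | apply cdiff_affine]. Qed.

Lemma cdiff_minus_R (x : R) (z : C) : cdiff (fun w => w - RtoC x)%C z.
Proof. apply (cdiff_ext (fun w => - RtoC x + 1 * w)%C); [intros; ring | apply cdiff_affine]. Qed.

Lemma cdiff_cmult (c : C) (f : C -> C) (z : C) : cdiff f z -> cdiff (fun w => c * f w)%C z.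
Proof. intros H. apply cdiff_mult; [apply cdiff_const | exact H]. Qed.

Lemma cdiff_pow (f : C -> C) (z : C) (n : nat) : cdiff f z -> cdiff (fun w => f w ^ n)%C z.
Proof.
  intros H. induction n as [|n IH]; [exact (cdiff_const 1 z)|].
  apply (cdiff_ext (fun w => f w * f w ^ n)%C); [intros; now rewrite Cpow_S | now apply cdiff_mult].
Qed.

Lemma RtoC_minus_neq_0 (p q x : R) : (p, q) <> (x, 0) -> ((p, q) - RtoC x)%C <> 0%C.
Proof.
  intros H E. apply H. unfold Cminus, Cplus, Copp, RtoC in E; simpl in E.
  injection E as H1 H2. f_equal; lra.
Qed.

Lemma square_boundary_dist (x s p q : R) : 0 < s ->
  x - s <= p <= x + s -> - s <= q <= s ->
  p = x - s \/ p = x + s \/ q = - s \/ q = s ->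
  s <= Cmod ((p, q) - RtoC x)%C.
Proof.
  intros Hs Hp Hq H.
  destruct H as [H|[H|H]].
  - eapply Rle_trans; [|apply Re_le_Cmod]. simpl. rewrite Rabs_left1; lra.
  - eapply Rle_trans; [|apply Re_le_Cmod]. simpl. rewrite Rabs_right; lra.
  - eapply Rle_trans; [|apply Im_le_Cmod]. simpl.
    destruct H; [rewrite Rabs_left1 | rewrite Rabs_right]; lra.
Qed.

(** The contour shrinks to a square of half side s about x. There g(z)/(z - x) is g(x)/(z - x) plus
    a difference quotient bounded by [L], whose integral is at most 16 L s and vanishes with s. *)
Lemma Cauchy_formula (g : C -> C) (x0 x r : R) :
  0 < r -> Rabs (x - x0) < r -> cdiff_on g (x0 - r) (x0 + r) (- r) r ->
  contour (fun z => g z / (z - RtoC x))%C (x0 - r) (x0 + r) (- r) r = (2 * PI * Ci * g (RtoC x))%C.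
Proof.
  intros Hr Hx Hg. apply Rabs_lt_between in Hx.
  destruct (Hg x 0) as [l Hl]; try lra.
  destruct (cder_bound g _ l Hl) as [eta [H1 H2]].
  set (L := Cmod l + 1) in *.
  assert (L0 : 0 < L) by (unfold L; generalize (Cmod_ge_0 l); lra).
  (* Points of the small square are estimated at distance at most s + s from x, hence eta/2; the
     other two entries keep the square inside the large one. *)
  set (d := Rmin (eta / 2) (Rmin (x - (x0 - r)) (x0 + r - x))).
  assert (Hd : 0 < d <= eta / 2 /\ d <= x - (x0 - r) /\ d <= x0 + r - x).
  { unfold d. repeat split.
    - repeat apply Rmin_pos; lra.
    - apply Rmin_l.
    - eapply Rle_trans; [apply Rmin_r | apply Rmin_l].
    - eapply Rle_trans; [apply Rmin_r | apply Rmin_r]. }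
  assert (Hq : forall p q, x0 - r <= p <= x0 + r -> - r <= q <= r -> (p, q) <> (x, 0) ->
     cdiff (fun z => g z / (z - RtoC x))%C (p, q)).
  { intros p q Hp Hq N.
    apply cdiff_div; [apply Hg; auto | apply cdiff_minus_R | now apply RtoC_minus_neq_0]. }
  set (I := contour (fun z => g z / (z - RtoC x))%C (x0 - r) (x0 + r) (- r) r) in *.
  assert (G : forall s, 0 < s < d -> Cmod (I - 2 * PI * Ci * g (RtoC x))%C <= 16 * L * s).
  { intros s Hs. unfold I.
    rewrite (contour_frame _ _ (x - s) (x + s) _ _ (- s) s _); try lra.
    2:{ intros p q Hp Hq' N. apply Hq; auto. intros E. injection E as -> ->. apply N; lra. }
    assert (BD : forall p q, p = x - s \/ p = x + s \/ q = - s \/ q = s ->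
      ((p, q) - RtoC x)%C <> 0%C).
    { intros p q H. apply RtoC_minus_neq_0. intros E. injection E as -> ->. lra. }
    set (u := fun z => ((g z - g (RtoC x)) / (z - RtoC x))%C).
    set (v := fun z => (/ (z - RtoC x))%C).
    assert (Dv : forall p q, p = x - s \/ p = x + s \/ q = - s \/ q = s -> cdiff v (p, q)).
    { intros p q B. apply (cdiff_ext (fun z => 1 / (z - RtoC x))%C).
      - intros w. unfold v, Cdiv. ring.
      - apply cdiff_div; [apply cdiff_const | apply cdiff_minus_R | auto]. }
    assert (Du : bcont u (x - s) (x + s) (- s) s).
    { apply bcont_cdiff; try lra. intros p q Hp Hq' B.
      apply cdiff_div; [|apply cdiff_minus_R | auto].
      apply (cdiff_plus g (fun _ => - g (RtoC x))%C); [apply Hg; lra | apply cdiff_const]. }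
    rewrite (contour_ext _ (fun z => g (RtoC x) * v z + u z)%C); try lra.
    2:{ intros p q _ _ _. unfold u, v, Cdiv. ring. }
    rewrite (contour_plus (fun z => g (RtoC x) * v z)%C u); auto; try lra.
    2:{ apply bcont_cdiff; try lra. intros; now apply cdiff_cmult, Dv. }
    rewrite (contour_cmult (g (RtoC x)) v); auto; try lra.
    2:{ apply bcont_cdiff; try lra. intros; now apply Dv. }
    unfold v. rewrite contour_inv by lra.
    replace (g (RtoC x) * (2 * PI * Ci) + contour u (x - s) (x + s) (- s) s - 2 * PI * Ci * g (RtoC x))%C
      with (contour u (x - s) (x + s) (- s) s) by ring.
    eapply Rle_trans; [apply (contour_bound u _ _ _ _ L); auto; try lra | right; ring].
    intros p q Hp Hq' B.
    assert (S1 := square_boundary_dist x s p q (proj1 Hs) Hp Hq' B).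
    unfold u. rewrite Cmod_div by auto.
    apply Rle_div_l; [lra|]. apply H2.
    eapply Rle_lt_trans; [apply Cmod_le_Re_Im|]. simpl.
    apply Rle_lt_trans with (s + s); [|lra].
    apply Rplus_le_compat; apply Rabs_le; lra. }
  assert (Z : Cmod (I - 2 * PI * Ci * g (RtoC x))%C = 0).
  { apply Rle_antisym; [|apply Cmod_ge_0]. apply le_epsilon. intros e He. rewrite Rplus_0_l.
    assert (0 < e / (16 * L)) by (apply Rdiv_lt_0_compat; lra).
    eapply Rle_trans; [apply (G (Rmin (d / 2) (e / (16 * L)))); split|].
    - apply Rmin_pos; lra.
    - eapply Rle_lt_trans; [apply Rmin_l | lra].
    - apply Rle_trans with (16 * L * (e / (16 * L))); [|right; field; lra].
      apply Rmult_le_compat_l; [lra | apply Rmin_r]. }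
  apply Cmod_eq_0 in Z.
  replace I with (I - 2 * PI * Ci * g (RtoC x) + 2 * PI * Ci * g (RtoC x))%C by ring.
  rewrite Z. ring.
Qed.

(** * Taylor expansion on the real axis *)

Section Power_series.

Variables (g : C -> C) (x0 r B : R).
Hypothesis Hr : 0 < r.
Hypothesis Hg : cdiff_on g (x0 - r) (x0 + r) (- r) r.
Hypothesis HB : forall p q, x0 - r <= p <= x0 + r -> - r <= q <= r -> Cmod (g (p, q)) <= B.

Let I (u : C -> C) := contour u (x0 - r) (x0 + r) (- r) r.

Definition Taylor_coef (n : nat) : C :=
  (/ (2 * PI * Ci) * I (fun z => g z / (z - RtoC x0) ^ S n))%C.

Lemma two_pi_i_neq_0 : (2 * PI * Ci)%C <> 0%C.
Proof.
  intros E. assert (H := f_equal snd E). simpl in H. generalize PI_RGT_0. lra.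
Qed.

Lemma two_pi_i_inv : Cmod (/ (2 * PI * Ci))%C <= 1.
Proof.
  rewrite Cmod_inv by apply two_pi_i_neq_0.
  replace (2 * PI * Ci)%C with (Ci * RtoC (2 * PI))%C by (rewrite RtoC_mult; ring).
  rewrite Cmod_Ci_R. generalize PI_RGT_0, PI2_1; intros. rewrite Rabs_pos_eq by lra.
  rewrite <- Rinv_1. apply Rinv_le_contravar; lra.
Qed.

(** The kernel of the n-th Taylor remainder at x. At x = x0 it becomes the integrand of the n-th
    coefficient, so one set of bounds serves both. *)
Let k (x : R) (n : nat) (z : C) : C := (g z / ((z - RtoC x0) ^ n * (z - RtoC x)))%C.

Lemma boundary_neq (x : R) p q : Rabs (x - x0) < r ->
  p = x0 - r \/ p = x0 + r \/ q = - r \/ q = r -> ((p, q) - RtoC x)%C <> 0%C.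
Proof.
  intros Hx H. apply Rabs_lt_between in Hx.
  apply RtoC_minus_neq_0. intros E. injection E as -> ->. lra.
Qed.

Lemma x0_near : Rabs (x0 - x0) < r.
Proof. unfold Rminus. rewrite Rplus_opp_r, Rabs_R0. exact Hr. Qed.

Lemma k_bcont x n : Rabs (x - x0) < r -> bcont (k x n) (x0 - r) (x0 + r) (- r) r.
Proof.
  intros Hx. apply bcont_cdiff; try lra. intros p q Hp Hq H.
  apply cdiff_div; [apply Hg; auto | |].
  - apply cdiff_mult; [apply cdiff_pow|]; apply cdiff_minus_R.
  - apply Cmult_neq_0; [apply Cpow_nz|]; apply boundary_neq; auto. apply x0_near.
Qed.

Lemma kernel_bound x n p q : Rabs (x - x0) <= r / 2 ->
  x0 - r <= p <= x0 + r -> - r <= q <= r ->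
  p = x0 - r \/ p = x0 + r \/ q = - r \/ q = r ->
  Cmod (k x n (p, q)) <= 2 * B / r ^ S n.
Proof.
  intros Hx Hp Hq H.
  assert (Hx' : Rabs (x - x0) < r) by lra.
  assert (D0 := square_boundary_dist x0 r p q Hr Hp Hq H).
  assert (D1 : r / 2 <= Cmod ((p, q) - RtoC x)%C).
  { assert (Cmod ((p, q) - RtoC x0)%C <= Cmod ((p, q) - RtoC x)%C + r / 2); [|lra].
    replace ((p, q) - RtoC x0)%C with ((p, q) - RtoC x + RtoC (x - x0))%C
      by (rewrite RtoC_minus; ring).
    eapply Rle_trans; [apply Cmod_triangle|]. rewrite Cmod_R. lra. }
  unfold k. rewrite Cmod_div.
  2:{ apply Cmult_neq_0; [apply Cpow_nz|]; apply boundary_neq; auto. apply x0_near. }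
  rewrite Cmod_mult, Cmod_pow.
  assert (Rn : 0 < r ^ n) by now apply pow_lt.
  assert (P : r ^ n * (r / 2) <= Cmod ((p, q) - RtoC x0)%C ^ n * Cmod ((p, q) - RtoC x)%C).
  { apply Rmult_le_compat; try lra. apply pow_incr. lra. }
  assert (P0 : 0 < r ^ n * (r / 2)) by (apply Rmult_lt_0_compat; lra).
  apply Rle_trans with (B / (r ^ n * (r / 2))).
  - unfold Rdiv. apply Rmult_le_compat.
    + apply Cmod_ge_0.
    + left; apply Rinv_0_lt_compat; lra.
    + now apply HB.
    + now apply Rinv_le_contravar.
  - right. simpl. field. lra.
Qed.

Lemma B_ge_0 : 0 <= B.
Proof. eapply Rle_trans; [apply Cmod_ge_0 | apply (HB x0 0); lra]. Qed.

Lemma k_x0 n z : k x0 n z = (g z / (z - RtoC x0) ^ S n)%C.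
Proof. unfold k. rewrite Cpow_S. f_equal. ring. Qed.

(** The contour bound 4 (2r + 2r) meets the kernel bound 2 B / r^(n+1), and 1/(2 pi) is rounded up
    to 1. *)
Lemma Taylor_coef_bound n : Cmod (Taylor_coef n) <= 32 * B / r ^ n.
Proof.
  unfold Taylor_coef, I. rewrite Cmod_mult.
  rewrite (contour_ext _ (k x0 n)); try lra.
  2:{ intros. now rewrite k_x0. }
  apply Rle_trans with (1 * (4 * ((x0 + r - (x0 - r)) + (r - - r)) * (2 * B / r ^ S n))).
  - apply Rmult_le_compat; try apply Cmod_ge_0; [apply two_pi_i_inv|].
    apply contour_bound; try lra; [apply k_bcont, x0_near|].
    intros p q Hp Hq H. apply kernel_bound; auto.
    unfold Rminus. rewrite Rplus_opp_r, Rabs_R0. lra.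
  - right. simpl. field. split; [apply pow_nonzero|]; lra.
Qed.

(** Iteration of 1/(z - x) = 1/(z - x0) + (x - x0)/((z - x0)(z - x)) under the integral; no
    interchange of sum and integral is needed. *)
Lemma Taylor_remainder x n : Rabs (x - x0) <= r / 2 ->
  I (k x 0) = (2 * PI * Ci * sum_n (fun m => Taylor_coef m * RtoC ((x - x0) ^ m)) n
    + RtoC ((x - x0) ^ S n) * I (k x (S n)))%C.
Proof.
  intros Hx.
  assert (Hx' : Rabs (x - x0) < r) by lra.
  assert (St : forall m, I (k x m) = (2 * PI * Ci * Taylor_coef m + RtoC (x - x0) * I (k x (S m)))%C).
  { intros m. unfold Taylor_coef, I.
    rewrite Cmult_assoc, Cinv_r, Cmult_1_l by apply two_pi_i_neq_0.
    rewrite (contour_ext (fun z => g z / (z - RtoC x0) ^ S m)%C (k x0 m)); try lra.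
    2:{ intros. now rewrite k_x0. }
    rewrite <- (contour_cmult (RtoC (x - x0)) (k x (S m))); try lra; [|now apply k_bcont].
    rewrite <- contour_plus; try lra.
    - apply contour_ext; try lra. intros p q Hp Hq H.
      rewrite k_x0. unfold k. rewrite RtoC_minus, !Cpow_S.
      assert (N1 := boundary_neq x p q Hx' H).
      assert (N2 := boundary_neq x0 p q x0_near H).
      assert (N3 := Cpow_nz _ m N2).
      set (w := ((p, q) - RtoC x0)%C) in *. set (w' := ((p, q) - RtoC x)%C) in *.
      replace (RtoC x - RtoC x0)%C with (w - w')%C by (unfold w, w'; ring).
      field. auto.
    - apply k_bcont, x0_near.
    - apply bcont_cdiff; try lra. intros p q Hp Hq H. apply cdiff_cmult.
      apply cdiff_div; [apply Hg; auto | |].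
      + apply cdiff_mult; [apply cdiff_pow|]; apply cdiff_minus_R.
      + apply Cmult_neq_0; [apply Cpow_nz|]; apply boundary_neq; auto. apply x0_near. }
  induction n as [|n IH].
  - rewrite sum_O, (St O). simpl. rewrite Rmult_1_r. ring.
  - rewrite IH, sum_Sn, (St (S n)).
    change (plus ?a ?b) with (Cplus a b).
    simpl pow. rewrite !RtoC_mult. ring.
Qed.

(** Half the radius makes the remainder at most a multiple of 2^(-n). Real and imaginary parts are
    kept apart so that the theory of real power series applies to each. *)
Lemma Taylor_series x : Rabs (x - x0) <= r / 2 ->
  is_pseries (fun n => Re (Taylor_coef n)) (x - x0) (Re (g (RtoC x))) /\
  is_pseries (fun n => Im (Taylor_coef n)) (x - x0) (Im (g (RtoC x))).
Proof.
  intros Hx.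
  assert (Hx' : Rabs (x - x0) < r) by lra.
  set (S0 := fun n => sum_n (fun m => Taylor_coef m * RtoC ((x - x0) ^ m))%C n).
  assert (E : forall n, Cmod (g (RtoC x) - S0 n)%C <= 32 * B * (/ 2) ^ n).
  { intros n.
    assert (F := Taylor_remainder x n Hx).
    assert (F' : I (k x 0) = (2 * PI * Ci * g (RtoC x))%C).
    { rewrite <- (Cauchy_formula g x0 x r); auto. unfold I. apply contour_ext; try lra.
      intros p q _ _ _. unfold k. change (((p, q) - RtoC x0) ^ 0)%C with (RtoC 1).
      rewrite Cmult_1_l. reflexivity. }
    fold (S0 n) in F. rewrite F' in F.
    replace (g (RtoC x) - S0 n)%C
      with (/ (2 * PI * Ci) * (RtoC ((x - x0) ^ S n) * I (k x (S n))))%C.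
    2:{ replace (RtoC ((x - x0) ^ S n) * I (k x (S n)))%C
          with (2 * PI * Ci * (g (RtoC x) - S0 n))%C.
        - rewrite Cmult_assoc, Cinv_l by apply two_pi_i_neq_0. ring.
        - transitivity (2 * PI * Ci * g (RtoC x) - 2 * PI * Ci * S0 n)%C; [ring|].
          rewrite F. ring. }
    rewrite !Cmod_mult, Cmod_R.
    apply Rle_trans with (1 * ((r / 2) ^ S n * (4 * ((x0 + r - (x0 - r)) + (r - - r)) * (2 * B / r ^ S (S n))))).
    - apply Rmult_le_compat; try apply Cmod_ge_0; [| apply two_pi_i_inv |].
      { apply Rmult_le_pos; [apply Rabs_pos | apply Cmod_ge_0]. }
      apply Rmult_le_compat; try apply Cmod_ge_0; [apply Rabs_pos | |].
      + rewrite <- RPow_abs. apply pow_incr. split; [apply Rabs_pos | auto].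
      + unfold I. apply contour_bound; try lra; [now apply k_bcont|].
        intros p q Hp Hq H. now apply kernel_bound.
    - assert (0 < r ^ n) by now apply pow_lt.
      assert (0 < 2 ^ n) by (apply pow_lt; lra).
      unfold Rdiv at 1. rewrite Rpow_mult_distr, !pow_inv. simpl.
      replace (1 * (r * r ^ n * (/ (2 * 2 ^ n)) *
        (4 * (x0 + r - (x0 - r) + (r - - r)) * (2 * B / (r * (r * r ^ n))))))
        with (16 * (B / 2 ^ n)) by (field; lra).
      replace (32 * B * / 2 ^ n) with (32 * (B / 2 ^ n)) by (unfold Rdiv; ring).
      assert (0 <= B / 2 ^ n); [|lra]. apply Rdiv_le_0_compat; [apply B_ge_0 | auto]. }
  assert (L : is_lim_seq (fun n => 32 * B * (/ 2) ^ n) 0).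
  { replace (Finite 0) with (Rbar_mult (32 * B) 0) by (simpl; f_equal; ring).
    apply is_lim_seq_scal_l, is_lim_seq_geom. rewrite Rabs_pos_eq; lra. }
  assert (Sq : forall p : C -> R, (forall z w, Rabs (p z - p w) <= Cmod (z - w)%C) ->
     is_lim_seq (fun n => p (S0 n)) (p (g (RtoC x)))).
  { intros p Hp. apply is_lim_seq_ext with (fun n => p (g (RtoC x)) + (p (S0 n) - p (g (RtoC x)))).
    { intros n; ring. }
    replace (Finite (p (g (RtoC x)))) with (Rbar_plus (p (g (RtoC x))) 0) by (simpl; f_equal; ring).
    apply is_lim_seq_plus'; [apply is_lim_seq_const|].
    apply is_lim_seq_abs_0. apply is_lim_seq_le_le with (fun _ => 0) (fun n => 32 * B * (/ 2) ^ n); auto.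
    - intros n. split; [apply Rabs_pos|]. rewrite Rabs_minus_sym.
      eapply Rle_trans; [apply Hp | apply E].
    - apply is_lim_seq_const. }
  assert (SR : forall n, Re (S0 n) = sum_n (fun m => Re (Taylor_coef m) * (x - x0) ^ m) n /\
                         Im (S0 n) = sum_n (fun m => Im (Taylor_coef m) * (x - x0) ^ m) n).
  { induction n as [|n IH].
    - unfold S0. rewrite !sum_O. unfold Re, Im; simpl. split; ring.
    - unfold S0 in *. rewrite !sum_Sn. destruct IH as [<- <-].
      unfold plus, Re, Im; simpl. split; ring. }
  split; apply is_pseries_R.
  - change (is_lim_seq (fun n => sum_n (fun m => Re (Taylor_coef m) * (x - x0) ^ m) n) (Re (g (RtoC x)))).
    apply (is_lim_seq_ext _ _ _ (fun n => proj1 (SR n))).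
    apply Sq. intros z w. exact (Re_le_Cmod (z - w)%C).
  - change (is_lim_seq (fun n => sum_n (fun m => Im (Taylor_coef m) * (x - x0) ^ m) n) (Im (g (RtoC x)))).
    apply (is_lim_seq_ext _ _ _ (fun n => proj2 (SR n))).
    apply Sq. intros z w. exact (Im_le_Cmod (z - w)%C).
Qed.

End Power_series.

(** * Derivative bounds for holomorphic functions on a strip *)

Lemma CV_radius_geometric (a : nat -> R) (K r : R) : 0 < r ->
  (forall n, Rabs (a n) <= K / r ^ n) -> Rbar_le (r / 2) (CV_radius a).
Proof.
  intros Hr H.
  destruct (Rbar_le_lt_dec (r / 2) (CV_radius a)) as [L|L]; [exact L|exfalso].
  apply (CV_disk_outside a (r / 2)); [rewrite Rabs_pos_eq; [exact L|lra]|].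
  apply is_lim_seq_abs_0.
  apply is_lim_seq_le_le with (fun _ => 0) (fun n => K * (/ 2) ^ n).
  - intros n. split; [apply Rabs_pos|]. rewrite Rabs_mult, (Rabs_pos_eq ((r / 2) ^ n)).
    2:{ apply pow_le; lra. }
    assert (P : 0 < r ^ n) by now apply pow_lt.
    apply Rle_trans with (K / r ^ n * (r / 2) ^ n).
    + apply Rmult_le_compat_r; [apply pow_le; lra | auto].
    + unfold Rdiv. rewrite Rpow_mult_distr. right. field. lra.
  - apply is_lim_seq_const.
  - replace (Finite 0) with (Rbar_mult K 0) by (simpl; f_equal; ring).
    apply is_lim_seq_scal_l, is_lim_seq_geom. rewrite Rabs_pos_eq; lra.
Qed.

(** At the centre of the series the n-th derivative is n! times the n-th coefficient, so a geometric
    bound on coefficients is a factorial bound on derivatives. *)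
Lemma PSeries_Derive_n (a : nat -> R) (f : R -> R) (K x0 r : R) : 0 < r ->
  (forall n, Rabs (a n) <= K / r ^ n) ->
  (forall x, Rabs (x - x0) <= r / 2 -> is_pseries a (x - x0) (f x)) ->
  forall n, ex_derive_n f n x0 /\ Rabs (Derive_n f n x0) <= K * INR (fact n) * (/ r) ^ n.
Proof.
  intros Hr Ha Hf n.
  assert (CV : Rbar_lt 0 (CV_radius a)).
  { eapply Rbar_lt_le_trans; [|apply (CV_radius_geometric a K r Hr Ha)]. simpl. lra. }
  assert (L : locally x0 (fun x => PSeries a (x + - x0) = f x)).
  { assert (P : 0 < r / 2) by lra. exists (mkposreal _ P). intros y Hy.
    apply is_pseries_unique, Hf. left. exact Hy. }
  split.
  - apply (ex_derive_n_ext_loc _ _ _ _ L), ex_derive_n_comp_trans, ex_derive_n_PSeries.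
    rewrite Rplus_opp_r, Rabs_R0. exact CV.
  - rewrite <- (Derive_n_ext_loc _ _ _ _ L), Derive_n_comp_trans, Rplus_opp_r,
      (Derive_n_coef _ _ CV), Rabs_mult, pow_inv, (Rabs_pos_eq (INR _)) by apply pos_INR.
    replace (K * INR (fact n) * / r ^ n) with (K / r ^ n * INR (fact n)) by (unfold Rdiv; ring).
    apply Rmult_le_compat_r; [apply pos_INR | auto].
Qed.

Definition DC (f : R -> C) (n : nat) (x : R) : C :=
  (Derive_n (fun t => Re (f t)) n x, Derive_n (fun t => Im (f t)) n x).

Lemma tower_DC (P : R -> Prop) (f : R -> C) :
  (forall n x, P x -> ex_derive_n (fun t => Re (f t)) n x /\ ex_derive_n (fun t => Im (f t)) n x) ->
  tower P (DC f).
Proof.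
  intros H n x p. destruct (H (S n) x p) as [A B]. split; apply Derive_correct; assumption.
Qed.

Lemma Cauchy_estimate (g : C -> C) (x0 r B : R) : 0 < r ->
  cdiff_on g (x0 - r) (x0 + r) (- r) r ->
  (forall p q, x0 - r <= p <= x0 + r -> - r <= q <= r -> Cmod (g (p, q)) <= B) ->
  forall n, ex_derive_n (fun t => Re (g (RtoC t))) n x0 /\ ex_derive_n (fun t => Im (g (RtoC t))) n x0 /\
    Cmod (DC (fun t => g (RtoC t)) n x0) <= 64 * B * INR (fact n) * (/ r) ^ n.
Proof.
  intros Hr Hg HB n.
  assert (CB := fun n => Taylor_coef_bound g x0 r B Hr Hg HB n).
  destruct (PSeries_Derive_n (fun n => Re (Taylor_coef g x0 r n))
    (fun t => Re (g (RtoC t))) (32 * B) x0 r Hr) with (n := n) as [A1 A2].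
  { intros m. eapply Rle_trans; [apply Re_le_Cmod | apply CB]. }
  { intros x Hx. apply (Taylor_series g x0 r B Hr Hg HB x Hx). }
  destruct (PSeries_Derive_n (fun n => Im (Taylor_coef g x0 r n))
    (fun t => Im (g (RtoC t))) (32 * B) x0 r Hr) with (n := n) as [B1 B2].
  { intros m. eapply Rle_trans; [apply Im_le_Cmod | apply CB]. }
  { intros x Hx. apply (Taylor_series g x0 r B Hr Hg HB x Hx). }
  repeat split; auto.
  eapply Rle_trans; [apply Cmod_le_Re_Im|]. unfold DC; simpl. lra.
Qed.

Lemma exp_le x y : x <= y -> exp x <= exp y.
Proof. intros [H | ->]; [left; now apply exp_increasing | right; reflexivity]. Qed.

(** Cauchy's estimate on the square of half side [r] about x. Moving by [r] multiplies the inner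
    exponential by exp (K r): this is the constant that reappears as [K1]. The rate 1/r does not
    depend on x. *)
Lemma strip_tower (g : C -> C) (delta r B K : R) : 0 < r < delta -> 0 <= K -> 0 <= B ->
  (forall z, strip delta z -> cdiff g z) ->
  (forall z, strip delta z -> Cmod (g z) <= B * exp (exp (K * Rabs (Re z)))) ->
  tower (fun _ => True) (DC (fun t => g (RtoC t))) /\
  forall n x, Cmod (DC (fun t => g (RtoC t)) n x)
    <= 64 * B * exp (exp (K * r) * exp (K * Rabs x)) * (/ r) ^ n * INR (fact n).
Proof.
  intros Hr HK HB0 Hg HB.
  assert (S : forall x p q, x - r <= p <= x + r -> - r <= q <= r -> strip delta (p, q)).
  { intros x p q Hp Hq. unfold strip; simpl. apply Rabs_lt_between; lra. }
  assert (E : forall x n, ex_derive_n (fun t => Re (g (RtoC t))) n x /\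
    ex_derive_n (fun t => Im (g (RtoC t))) n x /\
    Cmod (DC (fun t => g (RtoC t)) n x)
      <= 64 * (B * exp (exp (K * r) * exp (K * Rabs x))) * INR (fact n) * (/ r) ^ n).
  { intros x. apply (Cauchy_estimate g x r); [lra| |].
    - intros p q Hp Hq. apply Hg. now apply (S x).
    - intros p q Hp Hq. eapply Rle_trans; [apply HB; now apply (S x)|].
      apply Rmult_le_compat_l; [auto|]. apply exp_le. rewrite <- exp_plus. apply exp_le.
      simpl. rewrite <- Rmult_plus_distr_l. apply Rmult_le_compat_l; auto.
      assert (Rabs (p - x) <= r) by (apply Rabs_le; lra).
      replace p with (p - x + x) by ring. generalize (Rabs_triang (p - x) x). lra. }
  split.
  - apply tower_DC. intros n x _. destruct (E x n) as (A1 & A2 & _). auto.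
  - intros n x. destruct (E x n) as (_ & _ & A). lra.
Qed.

Lemma INR_S_le_pow2 n : INR n + 1 <= 2 ^ n.
Proof.
  induction n as [|n IH]; [simpl; lra|]. rewrite S_INR. simpl.
  generalize (pos_INR n). lra.
Qed.

Lemma rising_2 n : rising (1 + 1) n <= 2 ^ n * INR (fact n).
Proof.
  assert (E : 1 * rising (1 + 1) n = INR (fact (S n))) by (rewrite <- rising_S_l; apply rising_1).
  rewrite Rmult_1_l in E. rewrite E, fact_simpl, mult_INR, S_INR.
  apply Rmult_le_compat_r; [apply pos_INR | apply INR_S_le_pow2].
Qed.

(** * Weight sequences *)

Section Weights.

Variable M : nat -> R.
Hypothesis Mpos : forall n, 0 < M n.
Hypothesis Mreg : regular M.

Let m (n : nat) : R := M n / INR (fact n).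

Lemma weight_normalized_pos n : 0 < m n.
Proof. apply Rdiv_lt_0_compat; [apply Mpos | apply INR_fact_lt_0]. Qed.

Lemma weight_fact n : M n = INR (fact n) * m n.
Proof. unfold m. field. apply INR_fact_neq_0. Qed.

(** By the log-convexity (i) the ratios of consecutive [m] are nondecreasing, hence at least the
    first one, and going down from n to j loses at most a factor c per step. *)
Lemma weight_growth : exists c, 1 <= c /\ forall n j, (j <= n)%nat -> m j <= c ^ n * m n.
Proof.
  assert (P := weight_normalized_pos).
  assert (H : forall n, m n * m 1%nat <= m (S n) * m O).
  { induction n as [|n IH]; [right; ring|].
    destruct Mreg as [H _]. specialize (H n).
    replace (n + 1)%nat with (S n) in H by lia. replace (n + 2)%nat with (S (S n)) in H by lia.
    fold (m n) (m (S n)) (m (S (S n))) in H.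
    assert (P0 := P O). assert (P1 := P 1%nat). assert (Pn := P n).
    assert (PS := P (S n)). assert (PSS := P (S (S n))).
    apply (Rmult_le_reg_l (m (S n))); auto.
    apply Rle_trans with (m n * m (S (S n)) * m 1%nat).
    - replace (m (S n) * (m (S n) * m 1%nat)) with (m (S n) ^ 2 * m 1%nat) by ring.
      apply Rmult_le_compat_r; lra.
    - replace (m n * m (S (S n)) * m 1%nat) with (m (S (S n)) * (m n * m 1%nat)) by ring.
      replace (m (S n) * (m (S (S n)) * m O)) with (m (S (S n)) * (m (S n) * m O)) by ring.
      apply Rmult_le_compat_l; lra. }
  clearbody m. set (c := Rmax 1 (m O / m 1%nat)).
  assert (c1 : 1 <= c) by apply Rmax_l.
  assert (H' : forall n, m n <= c * m (S n)).
  { intros n. apply Rle_trans with (m O / m 1%nat * m (S n)).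
    - replace (m O / m 1%nat * m (S n)) with (m (S n) * m O / m 1%nat)
        by (field; apply Rgt_not_eq, Rlt_gt, P).
      apply Rle_div_r; [apply Rlt_gt, P | apply H].
    - apply Rmult_le_compat_r; [left; apply P | apply Rmax_r]. }
  exists c. split; auto.
  induction n as [|n IH]; intros j Hj.
  - replace j with O by lia. simpl; lra.
  - destruct (Nat.eq_dec j (S n)) as [->|N].
    + generalize (pow_R1_Rle c (S n) c1) (P (S n)). nra.
    + eapply Rle_trans; [apply IH; lia|]. simpl.
      rewrite (Rmult_comm c), Rmult_assoc. apply Rmult_le_compat_l; [apply pow_le; lra | apply H'].
Qed.

Lemma weight_fact_le : exists k c, 0 < k /\ 1 <= c /\ forall n, INR (fact n) <= k * c ^ n * M n.
Proof.
  destruct weight_growth as [c [c1 H]].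
  exists (/ m O), c. assert (P := weight_normalized_pos O).
  split; [now apply Rinv_0_lt_compat|]. split; auto. intros n.
  specialize (H n O (Nat.le_0_l n)). rewrite weight_fact.
  replace (/ m O * c ^ n * (INR (fact n) * m n)) with (INR (fact n) * ((c ^ n * m n) / m O))
    by (field; lra).
  rewrite <- (Rmult_1_r (INR (fact n))) at 1. apply Rmult_le_compat_l; [apply pos_INR|].
  apply Rle_div_r; lra.
Qed.

(** Condition (ii) in the form of stability under differentiation. *)
Lemma weight_succ : exists A, 1 <= A /\ forall n, M (S n) <= A ^ S n * M n.
Proof.
  destruct Mreg as (_ & [B HB] & _).
  (* The entry 2 B absorbs the factor n + 1 <= 2^n of condition (ii); the last entry settles n = 0,
     where (ii) says nothing. *)
  set (A := Rmax 1 (Rmax (2 * B) (M 1%nat / M O))).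
  assert (A1 : 1 <= A) by apply Rmax_l.
  assert (A2 : 2 * B <= A) by (eapply Rle_trans; [apply Rmax_l | apply Rmax_r]).
  assert (A3 : M 1%nat / M O <= A) by (eapply Rle_trans; [apply Rmax_r | apply Rmax_r]).
  exists A. split; auto. intros [|n].
  - simpl. rewrite Rmult_1_r. apply Rle_div_l; auto. apply Rlt_gt, Mpos.
  - set (k := S n) in *. assert (Hk : (1 <= k)%nat) by (unfold k; lia).
    specialize (HB k Hk). replace (k + 1)%nat with (S k) in HB by lia.
    assert (Pk := Mpos k). assert (PSk := Mpos (S k)).
    assert (Ik : 0 < INR k) by (apply lt_0_INR; lia).
    assert (IS : 0 < INR (S k)) by (apply lt_0_INR; lia).
    set (q := M (S k) / (INR (S k) * M k)) in *.
    assert (q0 : 0 < q) by (apply Rdiv_lt_0_compat; [auto | now apply Rmult_lt_0_compat]).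
    assert (R0 : 0 < Rpower q (1 / INR k)) by apply exp_pos.
    assert (Q : q <= B ^ k).
    { replace q with (Rpower q (1 / INR k) ^ k).
      - apply pow_incr. lra.
      - rewrite <- Rpower_pow by auto. rewrite Rpower_mult.
        replace (1 / INR k * INR k) with 1 by (field; lra). now apply Rpower_1. }
    replace (M (S k)) with (q * INR (S k) * M k) by (unfold q; field; lra).
    apply Rmult_le_compat_r; [lra|].
    apply Rle_trans with (B ^ k * 2 ^ k).
    + apply Rmult_le_compat; try lra. rewrite S_INR. apply INR_S_le_pow2.
    + rewrite <- Rpow_mult_distr. apply Rle_trans with (A ^ k).
      * apply pow_incr. lra.
      * apply Rle_pow; [auto | lia].
Qed.

(** Three spare orders are what the Chebyshev coefficients need: one power of k for the steepness of
    the step, two for summability. The exponents n+1, n+2, n+3 add up to at most 6 (n + 1). *)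
Lemma weight_add3 : exists A, 1 <= A /\ forall n, M (n + 3)%nat <= A ^ S n * M n.
Proof.
  destruct weight_succ as [A [A1 H]]. exists (A ^ 6). split; [now apply pow_R1_Rle|].
  intros n.
  assert (P : forall k, 0 < A ^ k) by (intros; apply pow_lt; lra).
  assert (H1 := H n). assert (H2 := H (S n)). assert (H3 := H (S (S n))).
  replace (n + 3)%nat with (S (S (S n))) by lia.
  apply Rle_trans with (A ^ S (S (S n)) * (A ^ S (S n) * (A ^ S n * M n))).
  - eapply Rle_trans; [exact H3|]. apply Rmult_le_compat_l; [left; apply P|].
    eapply Rle_trans; [exact H2|]. apply Rmult_le_compat_l; [left; apply P|]. exact H1.
  - rewrite <- pow_mult, <- !Rmult_assoc, <- !pow_add. apply Rmult_le_compat_r; [left; apply Mpos|].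
    apply Rle_pow; [auto | lia].
Qed.

(** For fixed n, [weight_growth] turns the bounds by M j with j <= n into a constant depending on n
    times j!, and Vandermonde applies with parameters 1 and 1. The price is the factor [c] in the
    rate, paid anew at every product. *)
Lemma prodT_weight : exists c, 0 < c /\ forall D E x kA kB s t n, 0 < s -> 0 < t ->
  (forall i, (i <= n)%nat -> Cmod (D i x) <= kA * s ^ i * INR (fact i)) ->
  (forall j, (j <= n)%nat -> Cmod (E j x) <= kB * t ^ j * M j) ->
  Cmod (prodT D E n x) <= kA * kB * (c * (s + t)) ^ n * M n.
Proof.
  destruct weight_growth as [c [c1 H]]. exists (2 * c). split; [lra|].
  intros D E x kA kB s t n Hs Ht HD HE.
  assert (kA0 : 0 <= kA).
  { specialize (HD O (Nat.le_0_l n)). simpl in HD. generalize (Cmod_ge_0 (D O x)). lra. }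
  assert (kB0 : 0 <= kB).
  { specialize (HE O (Nat.le_0_l n)). simpl in HE. rewrite Rmult_1_r in HE.
    apply (Rmult_le_reg_r (M O)); [apply Mpos|]. generalize (Cmod_ge_0 (E O x)). lra. }
  eapply Rle_trans.
  - apply (prodT_rising D E x 1 1 kA (kB * (c ^ n * m n)) (s + t)).
    + intros i Hi. eapply Rle_trans; [now apply HD|]. rewrite rising_1.
      apply Rmult_le_compat_r; [apply pos_INR|]. apply Rmult_le_compat_l; [auto|].
      apply pow_incr; lra.
    + intros j Hj. eapply Rle_trans; [now apply HE|]. rewrite rising_1, weight_fact.
      replace (kB * t ^ j * (INR (fact j) * m j)) with (kB * INR (fact j) * (m j * t ^ j)) by ring.
      replace (kB * (c ^ n * m n) * (s + t) ^ j * INR (fact j))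
        with (kB * INR (fact j) * ((c ^ n * m n) * (s + t) ^ j)) by ring.
      apply Rmult_le_compat_l; [apply Rmult_le_pos; [auto | apply pos_INR]|].
      apply Rmult_le_compat; [left; apply weight_normalized_pos | apply pow_le; lra | now apply H |].
      apply pow_incr; lra.
  - rewrite weight_fact.
    replace (2 * c * (s + t)) with (2 * (c * (s + t))) by ring.
    rewrite !Rpow_mult_distr.
    replace (kA * kB * (2 ^ n * (c ^ n * (s + t) ^ n)) * (INR (fact n) * m n))
      with (kA * (kB * (c ^ n * m n)) * (s + t) ^ n * (2 ^ n * INR (fact n))) by ring.
    apply Rmult_le_compat_l; [|apply rising_2].
    assert (0 <= c ^ n) by (apply pow_le; lra). assert (0 < m n) by apply weight_normalized_pos.
    clear H. clearbody m.
    assert (0 <= (s + t) ^ n) by (apply pow_le; lra).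
    repeat apply Rmult_le_pos; lra.
Qed.

(** * Bounds on towers *)

(** With w = [M] and [P] a compact interval this is the Carleman condition; with w = [nfact] and [P]
    a half-line it is analyticity uniform up to infinity. *)
Definition wbound (w : nat -> R) (P : R -> Prop) (D : nat -> R -> C) : Prop :=
  exists K rho, 0 < K /\ 0 < rho /\ forall n x, P x -> Cmod (D n x) <= K * rho ^ n * w n.

Definition nfact (n : nat) : R := INR (fact n).

Lemma wbound_sub (w : nat -> R) (P Q : R -> Prop) D :
  (forall x, Q x -> P x) -> wbound w P D -> wbound w Q D.
Proof. intros H (K & rho & HK & Hr & B). exists K, rho; repeat split; auto. Qed.

Lemma wbound_ext (w : nat -> R) (P : R -> Prop) D E :
  (forall n x, P x -> D n x = E n x) -> wbound w P D -> wbound w P E.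
Proof.
  intros H (K & rho & HK & Hr & B). exists K, rho; repeat split; auto.
  intros n x p. rewrite <- H by auto. auto.
Qed.

Lemma wbound_le (w : nat -> R) K rho K' rho' n : 0 <= w n -> 0 < K -> 0 < rho ->
  0 < K' -> 0 < rho' -> K * rho ^ n * w n <= (K + K') * (rho + rho') ^ n * w n.
Proof.
  intros. apply Rmult_le_compat_r; [auto|].
  apply Rmult_le_compat; try lra; [apply pow_le; lra | apply pow_incr; lra].
Qed.

Lemma wbound_or (w : nat -> R) (P Q : R -> Prop) D : (forall n, 0 <= w n) ->
  wbound w P D -> wbound w Q D -> wbound w (fun x => P x \/ Q x) D.
Proof.
  intros Hw (K & rho & HK & Hr & B) (K' & rho' & HK' & Hr' & B').
  exists (K + K'), (rho + rho'). repeat split; try lra.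
  intros n x [p|q].
  - eapply Rle_trans; [now apply B|]. now apply wbound_le.
  - eapply Rle_trans; [now apply B'|]. rewrite (Rplus_comm K), (Rplus_comm rho). now apply wbound_le.
Qed.

Lemma wbound_plusT (w : nat -> R) (P : R -> Prop) D E : (forall n, 0 <= w n) ->
  wbound w P D -> wbound w P E -> wbound w P (plusT D E).
Proof.
  intros Hw (K & rho & HK & Hr & B) (K' & rho' & HK' & Hr' & B').
  exists (K + K'), (rho + rho'). repeat split; try lra.
  intros n x p. unfold plusT. eapply Rle_trans; [apply Cmod_triangle|].
  specialize (B n x p). specialize (B' n x p).
  replace ((K + K') * (rho + rho') ^ n * w n)
    with (K * (rho + rho') ^ n * w n + K' * (rho + rho') ^ n * w n) by ring.
  apply Rplus_le_compat; (eapply Rle_trans; [eassumption|]);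
  (apply Rmult_le_compat_r; [auto|]); (apply Rmult_le_compat_l; [lra|]); apply pow_incr; lra.
Qed.

Lemma wbound_cmultT (w : nat -> R) (P : R -> Prop) c D :
  wbound w P D -> wbound w P (cmultT c D).
Proof.
  intros (K & rho & HK & Hr & B). exists ((Cmod c + 1) * K), rho.
  generalize (Cmod_ge_0 c); intros c0.
  repeat split; try lra; [apply Rmult_lt_0_compat; lra|].
  intros n x p. unfold cmultT. rewrite Cmod_mult, !Rmult_assoc.
  apply Rmult_le_compat; try apply Cmod_ge_0; [lra|]. rewrite <- Rmult_assoc. auto.
Qed.

Lemma wbound_minusT (w : nat -> R) (P : R -> Prop) D E : (forall n, 0 <= w n) ->
  wbound w P D -> wbound w P E -> wbound w P (minusT D E).
Proof.
  intros Hw HD HE. apply (wbound_ext w P (plusT D (cmultT (- (1))%C E))).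
  - intros n x _. unfold plusT, minusT, cmultT. ring.
  - apply wbound_plusT; auto. now apply wbound_cmultT.
Qed.

Lemma wbound_shiftT (w : nat -> R) (P : R -> Prop) s D :
  wbound w P D -> wbound w (fun x => P (x + s)) (shiftT s D).
Proof.
  intros (K & rho & HK & Hr & B). exists K, rho. repeat split; auto.
  intros n x p. now apply B.
Qed.

Lemma wbound_reflT (w : nat -> R) (P : R -> Prop) D :
  wbound w P D -> wbound w (fun x => P (- x)) (reflT D).
Proof.
  intros (K & rho & HK & Hr & B). exists K, rho. repeat split; auto.
  intros n x p. rewrite Cmod_reflT. now apply B.
Qed.

Lemma wbound_prodT (P : R -> Prop) D E :
  wbound nfact P D -> wbound M P E -> wbound M P (prodT D E).
Proof.
  destruct prodT_weight as [c [c0 H]].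
  intros (K & rho & HK & Hr & B) (K' & rho' & HK' & Hr' & B').
  exists (K * K'), (c * (rho + rho')). repeat split; try (apply Rmult_lt_0_compat; lra).
  intros n x p. apply H; auto.
Qed.

Lemma wbound_analytic (P : R -> Prop) D : wbound nfact P D -> wbound M P D.
Proof.
  destruct weight_fact_le as (k & c & k0 & c1 & H).
  intros (K & rho & HK & Hr & B).
  exists (K * k), (rho * c). repeat split; try (apply Rmult_lt_0_compat; lra).
  intros n x p. eapply Rle_trans; [now apply B|].
  rewrite Rpow_mult_distr.
  replace (K * k * (rho ^ n * c ^ n) * M n) with (K * rho ^ n * (k * c ^ n * M n)) by ring.
  apply Rmult_le_compat_l; [|apply H]. apply Rmult_le_pos; [lra | apply pow_le; lra].
Qed.

End Weights.

(** * Series of towers *)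

Lemma ex_series_Rabs_le (f a : nat -> R) :
  (forall k, Rabs (f k) <= a k) -> ex_series a -> ex_series f.
Proof. intros H Ha. exact (ex_series_le (V := R_CompleteNormedModule) f a H Ha). Qed.

Lemma Series_Rabs_le (f a : nat -> R) :
  (forall k, Rabs (f k) <= a k) -> ex_series a -> Rabs (Series f) <= Series a.
Proof.
  intros H Ha. eapply Rle_trans; [apply Series_Rabs|].
  - apply (ex_series_Rabs_le _ a); [intros k; rewrite Rabs_Rabsolu; auto | auto].
  - apply Series_le; [intros k; split; [apply Rabs_pos | auto] | auto].
Qed.

Lemma Taylor2_bound (f f1 f2 : R -> R) (x d c y : R) :
  (forall t, Rabs (t - x) < d -> is_derive f t (f1 t)) ->
  (forall t, Rabs (t - x) < d -> is_derive f1 t (f2 t)) ->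
  (forall t, Rabs (t - x) < d -> Rabs (f2 t) <= c) ->
  Rabs (y - x) < d -> Rabs (f y - f x - (y - x) * f1 x) <= (y - x) ^ 2 * c.
Proof.
  intros H1 H2 H3 Hy.
  assert (B : forall t z, Rabs (z - x) < d -> Rmin x z <= t <= Rmax x z -> Rabs (t - x) <= Rabs (z - x)).
  { intros t z Hz. unfold Rmin, Rmax, Rabs. destruct (Rle_dec x z), (Rcase_abs (t - x)), (Rcase_abs (z - x)); lra. }
  destruct (MVT_gen f x y f1) as [s [Hs Es]].
  { intros t Ht. apply H1. eapply Rle_lt_trans; [apply (B t y Hy); lra | auto]. }
  { intros t Ht. apply continuity_pt_filterlim. apply (ex_derive_continuous f). exists (f1 t).
    apply H1. eapply Rle_lt_trans; [apply (B t y Hy Ht) | auto]. }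
  assert (Hs' : Rabs (s - x) < d) by (eapply Rle_lt_trans; [apply (B s y Hy Hs) | auto]).
  destruct (MVT_gen f1 x s f2) as [r [Hr Er]].
  { intros t Ht. apply H2. eapply Rle_lt_trans; [apply (B t s Hs'); lra | auto]. }
  { intros t Ht. apply continuity_pt_filterlim. apply (ex_derive_continuous f1). exists (f2 t).
    apply H2. eapply Rle_lt_trans; [apply (B t s Hs' Ht) | auto]. }
  replace (f y - f x - (y - x) * f1 x) with (f2 r * ((s - x) * (y - x)))
    by (rewrite Es; replace (f1 s) with (f1 x + (f1 s - f1 x)) by ring; rewrite Er; ring).
  rewrite Rabs_mult, (Rmult_comm (_ ^ 2)).
  apply Rmult_le_compat; try apply Rabs_pos.
  - apply H3. eapply Rle_lt_trans; [apply (B r s Hs' Hr) | auto].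
  - rewrite Rabs_mult, <- (pow2_abs (y - x)). simpl. rewrite Rmult_1_r.
    apply Rmult_le_compat_r; [apply Rabs_pos | now apply B].
Qed.

(** Summable bounds on the second derivatives give a quadratic Taylor remainder for the whole series
    at once. They come for free, because in a tower every order is bounded. *)
Lemma is_derive_Series (f f1 f2 : nat -> R -> R) (x d : R) (a b c : nat -> R) : 0 < d ->
  (forall k t, Rabs (t - x) < d -> is_derive (f k) t (f1 k t)) ->
  (forall k t, Rabs (t - x) < d -> is_derive (f1 k) t (f2 k t)) ->
  (forall k t, Rabs (t - x) < d -> Rabs (f k t) <= a k) ->
  (forall k t, Rabs (t - x) < d -> Rabs (f1 k t) <= b k) ->
  (forall k t, Rabs (t - x) < d -> Rabs (f2 k t) <= c k) ->
  ex_series a -> ex_series b -> ex_series c ->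
  is_derive (fun t => Series (fun k => f k t)) x (Series (fun k => f1 k x)).
Proof.
  intros Hd H1 H2 Ba Bb Bc Ea Eb Ec.
  assert (Hx : Rabs (x - x) < d) by (unfold Rminus; rewrite Rplus_opp_r, Rabs_R0; auto).
  assert (U0 : 0 <= Series c).
  { eapply Rle_trans; [apply Rabs_pos|]. apply (Series_Rabs_le (fun k => f2 k x)); auto. }
  apply is_derive_Reals. intros eps He.
  assert (Hm : 0 < Rmin d (eps / (Series c + 1))).
  { apply Rmin_pos; [auto|]. apply Rdiv_lt_0_compat; lra. }
  exists (mkposreal _ Hm). intros h h0 Hh. simpl in Hh.
  assert (Hh1 : Rabs h < d) by (eapply Rlt_le_trans; [exact Hh | apply Rmin_l]).
  assert (Hh2 : Rabs h < eps / (Series c + 1)) by (eapply Rlt_le_trans; [exact Hh | apply Rmin_r]).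
  assert (Hxh : Rabs (x + h - x) < d) by (replace (x + h - x) with h by ring; auto).
  assert (E1 : ex_series (fun k => f k (x + h))) by (apply (ex_series_Rabs_le _ a); auto).
  assert (E2 : ex_series (fun k => f k x)) by (apply (ex_series_Rabs_le _ a); auto).
  assert (E3 : ex_series (fun k => f1 k x)) by (apply (ex_series_Rabs_le _ b); auto).
  assert (E4 : ex_series (fun k => h * f1 k x)) by (apply (ex_series_scal_l (V := R_NormedModule) h); auto).
  assert (E5 : ex_series (fun k => h ^ 2 * c k)) by (apply (ex_series_scal_l (V := R_NormedModule) (h ^ 2)); auto).
  assert (E6 : ex_series (fun k => f k (x + h) - f k x)) by (apply (ex_series_minus (V := R_NormedModule)); auto).
  assert (Q : Rabs (Series (fun k => f k (x + h)) - Series (fun k => f k x)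
      - h * Series (fun k => f1 k x)) <= h ^ 2 * Series c).
  { rewrite <- Series_scal_l, <- Series_minus, <- Series_minus by auto.
    rewrite <- Series_scal_l. apply Series_Rabs_le; [|auto].
    intros k. generalize (Taylor2_bound (f k) (f1 k) (f2 k) x d (c k) (x + h) (H1 k) (H2 k) (Bc k) Hxh).
    replace (x + h - x) with h by ring. auto. }
  assert (A0 : 0 < Rabs h) by now apply Rabs_pos_lt.
  replace ((Series (fun k => f k (x + h)) - Series (fun k => f k x)) / h - Series (fun k => f1 k x))
    with ((Series (fun k => f k (x + h)) - Series (fun k => f k x) - h * Series (fun k => f1 k x)) / h)
    by (field; auto).
  unfold Rdiv. rewrite Rabs_mult, Rabs_inv.
  apply Rle_lt_trans with (Rabs h * Series c).
  - apply Rle_div_l; [lra|]. eapply Rle_trans; [exact Q|]. rewrite <- pow2_abs. right; ring.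
  - apply Rle_lt_trans with (Rabs h * (Series c + 1)).
    + apply Rmult_le_compat_l; lra.
    + apply Rlt_div_r; lra.
Qed.

Definition CSum (v : nat -> C) : C := (Series (fun k => Re (v k)), Series (fun k => Im (v k))).

Lemma CSum_bound (v : nat -> C) (u : nat -> R) :
  (forall k, Cmod (v k) <= u k) -> ex_series u -> Cmod (CSum v) <= 2 * Series u.
Proof.
  intros H Hu. eapply Rle_trans; [apply Cmod_le_Re_Im|]. unfold CSum; simpl.
  assert (Rabs (Series (fun k => Re (v k))) <= Series u).
  { apply Series_Rabs_le; auto. intros k; eapply Rle_trans; [apply Re_le_Cmod | auto]. }
  assert (Rabs (Series (fun k => Im (v k))) <= Series u).
  { apply Series_Rabs_le; auto. intros k; eapply Rle_trans; [apply Im_le_Cmod | auto]. }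
  lra.
Qed.

Definition csummable (v : nat -> C) : Prop :=
  ex_series (fun k => Re (v k)) /\ ex_series (fun k => Im (v k)).

Lemma csummable_le (v : nat -> C) (u : nat -> R) :
  (forall k, Cmod (v k) <= u k) -> ex_series u -> csummable v.
Proof.
  intros H Hu; split; apply (ex_series_Rabs_le _ u); auto;
  intros k; (eapply Rle_trans; [|apply H]); [apply Re_le_Cmod | apply Im_le_Cmod].
Qed.

Lemma CSum_plus (v w : nat -> C) : csummable v -> csummable w ->
  CSum (fun k => v k + w k)%C = (CSum v + CSum w)%C.
Proof.
  intros [A B] [A' B']. unfold CSum, Cplus; simpl. f_equal; rewrite <- Series_plus by auto; reflexivity.
Qed.

Lemma csummable_cmult (c : C) (v : nat -> C) : csummable v -> csummable (fun k => c * v k)%C.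
Proof.
  intros [A B]. split.
  - apply (ex_series_minus (V := R_NormedModule) (fun k => Re c * Re (v k)) (fun k => Im c * Im (v k)));
    now apply (ex_series_scal_l (V := R_NormedModule)).
  - apply (ex_series_plus (V := R_NormedModule) (fun k => Re c * Im (v k)) (fun k => Im c * Re (v k)));
    now apply (ex_series_scal_l (V := R_NormedModule)).
Qed.

Lemma csummable_plus (v w : nat -> C) : csummable v -> csummable w ->
  csummable (fun k => v k + w k)%C.
Proof.
  intros [A B] [A' B']. split.
  - now apply (ex_series_plus (V := R_NormedModule) (fun k => Re (v k)) (fun k => Re (w k))).
  - now apply (ex_series_plus (V := R_NormedModule) (fun k => Im (v k)) (fun k => Im (w k))).
Qed.

Lemma CSum_cmult (c : C) (v : nat -> C) : csummable v -> CSum (fun k => c * v k)%C = (c * CSum v)%C.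
Proof.
  intros [A B]. unfold CSum, Cmult; simpl. f_equal.
  - rewrite <- !Series_scal_l, <- Series_minus; auto; now apply (ex_series_scal_l (V := R_NormedModule)).
  - rewrite <- !Series_scal_l, <- Series_plus; auto; now apply (ex_series_scal_l (V := R_NormedModule)).
Qed.

Lemma CSum_S (v : nat -> C) : csummable v -> CSum v = (v O + CSum (fun k => v (S k)))%C.
Proof.
  intros [A B]. unfold CSum, Cplus; simpl. f_equal.
  - exact (Series_incr_1 _ A).
  - exact (Series_incr_1 _ B).
Qed.

Lemma CSum_ext (v w : nat -> C) : (forall k, v k = w k) -> CSum v = CSum w.
Proof. intros H. unfold CSum. f_equal; apply Series_ext; intros; now rewrite H. Qed.

Definition CSumT (v : nat -> nat -> R -> C) (n : nat) (x : R) : C := CSum (fun k => v k n x).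

Lemma tower_CSumT (P : R -> Prop) (v : nat -> nat -> R -> C) (u : nat -> nat -> R) :
  (forall x, P x -> locally x P) -> (forall k, tower P (v k)) ->
  (forall k n x, P x -> Cmod (v k n x) <= u n k) -> (forall n, ex_series (u n)) ->
  tower P (CSumT v).
Proof.
  intros HP Hv Hu Eu n x p. destruct (HP x p) as [d Hd].
  assert (Hd' : forall t, Rabs (t - x) < d -> P t) by (intros t Ht; apply Hd; exact Ht).
  split.
  - apply (is_derive_Series (fun k t => Re (v k n t)) (fun k t => Re (v k (S n) t))
      (fun k t => Re (v k (S (S n)) t)) x d (u n) (u (S n)) (u (S (S n)))); auto; try apply cond_pos;
    intros k t Ht; try (apply Hv; auto);
    (eapply Rle_trans; [apply Re_le_Cmod | auto]).
  - apply (is_derive_Series (fun k t => Im (v k n t)) (fun k t => Im (v k (S n) t))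
      (fun k t => Im (v k (S (S n)) t)) x d (u n) (u (S n)) (u (S (S n)))); auto; try apply cond_pos;
    intros k t Ht; try (apply Hv; auto);
    (eapply Rle_trans; [apply Im_le_Cmod | auto]).
Qed.

(** * The shift operator equation *)

Section Shift_equation.

Variables (N : nat) (b : nat -> nat -> R -> C) (s : nat -> R) (g : nat -> R -> C).

(** The operator sending psi to the sum of b_j psi(x - s_j) over j < n0. As all shifts are at least
    [sigma], its values left of a + sigma only involve psi left of a. *)
Fixpoint Uop (n0 : nat) (psi : nat -> R -> C) : nat -> R -> C :=
  match n0 with
  | O => fun _ _ => 0%C
  | S j => plusT (Uop j psi) (prodT (b j) (shiftT (- s j) psi))
  end.

Variable sigma : R.
Hypothesis Hsigma : 0 < sigma.
Hypothesis Hs : forall j, (j < N)%nat -> sigma <= s j.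
Hypothesis Hb : forall j, (j < N)%nat -> tower (fun _ => True) (b j).
Hypothesis Hg : tower (fun _ => True) g.

Lemma tower_0 (P : R -> Prop) : tower P (fun _ _ => 0%C).
Proof. intros n x _. apply dC_const. Qed.

Lemma tower_Uop (a : R) psi n0 : (n0 <= N)%nat ->
  tower (fun x => x < a) psi -> tower (fun x => x < a + sigma) (Uop n0 psi).
Proof.
  intros Hn Hpsi. induction n0 as [|j IH]; simpl; [apply tower_0|].
  apply tower_plusT; [apply IH; lia|].
  apply tower_prodT.
  - apply (tower_sub (fun _ => True)); auto.
  - apply (tower_sub (fun x => x + - s j < a));
      [|exact (tower_shiftT (fun x => x < a) (- s j) psi Hpsi)].
    intros x Hx. generalize (Hs j Hn). lra.
Qed.

Lemma Uop_ext (psi psi' : nat -> R -> C) n0 n x : (n0 <= N)%nat ->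
  (forall m y, y <= x - sigma -> psi m y = psi' m y) -> Uop n0 psi n x = Uop n0 psi' n x.
Proof.
  intros Hn H. induction n0 as [|j IH]; simpl; [reflexivity|].
  unfold plusT. f_equal; [apply IH; lia|].
  apply prodT_ext; auto. intros m _. unfold shiftT. apply H. generalize (Hs j Hn). lra.
Qed.

Variables (omega beta : R -> R) (X G rho : R).
Hypothesis HG : 0 < G.
Hypothesis Hrho : 0 < rho.
Hypothesis Homega : forall x, 0 <= omega x <= 1.
Hypothesis Hbeta : forall j n x, (j < N)%nat -> x < - X ->
  Cmod (b j n x) <= beta x * rho ^ n * INR (fact n).
Hypothesis Hsmall : forall j x, (j < N)%nat -> x < - X ->
  INR N * (beta x * omega (x - s j)) <= omega x / 4.
Hypothesis HgG : forall n x, x < - X -> Cmod (g n x) <= G * omega x * rho ^ n * INR (fact n).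

Let V : nat -> nat -> R -> C := fix V m := match m with
  | O => g
  | S m' => cmultT (- (1))%C (Uop N (V m'))
  end.

(** Each application of [Uop] multiplies by coefficients with parameter 1, so the parameter grows by
    one and the rate stays [rho]. The factor 1/4 is [Hsmall]: the decay gained by shifting to the
    left outweighs the coefficients. *)
Lemma V_bound m n x : x < - X ->
  Cmod (V m n x) <= G * (/ 4) ^ m * omega x * rho ^ n * rising (INR m + 1) n.
Proof.
  revert n x. induction m as [|m IH]; intros n x Hx.
  - simpl. rewrite Rplus_0_l, rising_1. rewrite Rmult_1_r. now apply HgG.
  - change (V (S m)) with (cmultT (- (1))%C (Uop N (V m))). unfold cmultT.
    rewrite Cmod_mult, Cmod_opp, Cmod_1, Rmult_1_l.
    assert (R0 : 0 <= rising (INR m + 1 + 1) n) by (apply rising_ge_0; generalize (pos_INR m); lra).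
    assert (r0 : 0 <= rho ^ n) by (apply pow_le; lra).
    assert (q0 : 0 <= (/ 4) ^ m) by (apply pow_le; lra).
    set (k := G * (/ 4) ^ m * rho ^ n * rising (INR m + 1 + 1) n).
    assert (k0 : 0 <= k) by (unfold k; repeat apply Rmult_le_pos; lra).
    (* The induction [T] shares the factor 1/4 equally among the N terms, dividing by [INR N]; the
       empty sum is therefore treated apart. *)
    destruct (Nat.eq_dec N 0) as [EN|EN].
    { rewrite EN. change (Uop 0 (V m) n x) with (RtoC 0). rewrite Cmod_0, S_INR.
      assert (q1 : 0 <= (/ 4) ^ S m) by (apply pow_le; lra).
      specialize (Homega x). revert q1. generalize ((/ 4) ^ S m). intros y q1. repeat apply Rmult_le_pos; lra. }
    assert (IN : 0 < INR N) by (apply lt_0_INR; lia).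
    assert (T : forall n0, (n0 <= N)%nat ->
      Cmod (Uop n0 (V m) n x) <= INR n0 / INR N * (k * (omega x / 4))).
    { induction n0 as [|j IHj]; intros Hn.
      - simpl. rewrite Cmod_0. unfold Rdiv. rewrite !Rmult_0_l. lra.
      - simpl Uop. unfold plusT at 1. eapply Rle_trans; [apply Cmod_triangle|].
        rewrite S_INR. unfold Rdiv at 1. rewrite Rmult_plus_distr_r, Rmult_plus_distr_r, Rmult_1_l.
        apply Rplus_le_compat; [apply IHj; lia|].
        apply Rle_trans with (k * (beta x * omega (x - s j))).
        + eapply Rle_trans.
          * apply (prodT_rising _ _ x 1 (INR m + 1) (beta x) (G * (/ 4) ^ m * omega (x - s j)) rho).
            -- intros i _. rewrite rising_1. now apply Hbeta.
            -- intros i _. unfold shiftT. apply IH. generalize (Hs j Hn). lra.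
          * unfold k. right. replace (1 + (INR m + 1)) with (INR m + 1 + 1) by ring. ring.
        + specialize (Hsmall j x Hn Hx).
          replace (/ INR N * (k * (omega x / 4))) with (k * (/ INR N * (omega x / 4))) by ring.
          apply Rmult_le_compat_l; [auto|].
          apply (Rmult_le_reg_l (INR N)); [auto|].
          replace (INR N * (/ INR N * (omega x / 4))) with (omega x / 4) by (field; lra). auto. }
    eapply Rle_trans; [apply T; lia|].
    rewrite S_INR. unfold k. right. simpl. field. lra.
Qed.

Let u (n m : nat) : R := 2 * G * (4 * rho) ^ n * INR (fact n) * (/ 2) ^ m.

Lemma exp_half_le_2 : exp (/ 2) <= 2.
Proof.
  assert (H : exp (/ 2) * exp (/ 2) <= 4).
  { rewrite <- exp_plus. replace (/ 2 + / 2) with 1 by field. generalize exp_le_3; lra. }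
  generalize (exp_pos (/ 2)). nra.
Qed.

(** [rising_exp] with eps = 1/2 costs at most 2 * 2^m, which turns 4^(-m) into a convergent 2^(-m)
    at every order n; the rate becomes 4 rho because 2 exp(1/2) <= 4. *)
Lemma V_le n m x : x < - X -> Cmod (V m n x) <= u n m.
Proof.
  intros Hx. eapply Rle_trans; [now apply V_bound|].
  assert (R := rising_exp (INR m + 1) (/ 2) n).
  generalize (pos_INR m); intros Im.
  specialize (R ltac:(lra) ltac:(lra)).
  assert (e2 := exp_half_le_2). assert (e0 := exp_pos (/ 2)).
  assert (r0 : 0 <= rho ^ n) by (apply pow_le; lra).
  assert (q0 : 0 <= (/ 4) ^ m) by (apply pow_le; lra).
  assert (f0 : 0 <= INR (fact n)) by apply pos_INR.
  assert (E1 : (exp (/ 2) / / 2) ^ n <= 4 ^ n).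
  { apply pow_incr. unfold Rdiv. rewrite Rinv_inv. lra. }
  assert (E2 : exp (/ 2 * (INR m + 1)) <= 2 * 2 ^ m).
  { replace (/ 2 * (INR m + 1)) with (/ 2 + INR m * / 2) by ring.
    rewrite exp_plus, exp_mul_INR. apply Rmult_le_compat; try lra; [apply pow_le; lra|].
    apply pow_incr; lra. }
  assert (E0 : 0 <= (exp (/ 2) / / 2) ^ n).
  { apply pow_le. unfold Rdiv. rewrite Rinv_inv. lra. }
  assert (R' : rising (INR m + 1) n <= 4 ^ n * INR (fact n) * (2 * 2 ^ m)).
  { eapply Rle_trans; [exact R|]. apply Rmult_le_compat; try lra.
    - now apply Rmult_le_pos.
    - left; apply exp_pos.
    - now apply Rmult_le_compat_r. }
  apply Rle_trans with (G * (/ 4) ^ m * 1 * rho ^ n * (4 ^ n * INR (fact n) * (2 * 2 ^ m))).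
  - apply Rmult_le_compat; auto.
    + destruct (Homega x). repeat apply Rmult_le_pos; lra.
    + apply rising_ge_0; lra.
    + apply Rmult_le_compat_r; [auto|]. apply Rmult_le_compat_l; [apply Rmult_le_pos; lra | apply Homega].
  - right. unfold u. rewrite Rpow_mult_distr.
    replace (/ 2) with (/ 4 * 2) by field. rewrite Rpow_mult_distr. ring.
Qed.

Lemma ex_series_u n : ex_series (u n).
Proof.
  apply (ex_series_scal_l (V := R_NormedModule) (2 * G * (4 * rho) ^ n * INR (fact n)) (fun m => (/ 2) ^ m)).
  apply ex_series_geom. rewrite Rabs_pos_eq; lra.
Qed.

Lemma tower_V m : tower (fun x => x < - X) (V m).
Proof.
  induction m as [|m IH].
  - apply (tower_sub (fun _ => True)); auto.
  - change (V (S m)) with (cmultT (- (1))%C (Uop N (V m))). apply tower_cmultT.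
    apply (tower_sub (fun x => x < - X + sigma)); [intros; lra | now apply tower_Uop].
Qed.

(** Order 0 suffices here: the equation is only asked at order 0, and [tower_eq] propagates it to
    derivatives when needed. *)
Lemma Uop_CSum n0 x : (n0 <= N)%nat -> x < - X ->
  csummable (fun m => Uop n0 (V m) O x) /\
  CSum (fun m => Uop n0 (V m) O x) = Uop n0 (CSumT V) O x.
Proof.
  intros Hn Hx. induction n0 as [|j IH]; simpl.
  - assert (Z : forall k : nat, Cmod 0%C <= 0 * (/ 2) ^ k) by (intros; rewrite Cmod_0; lra).
    assert (E0 : ex_series (fun k => 0 * (/ 2) ^ k)).
    { apply (ex_series_scal_l (V := R_NormedModule) 0). apply ex_series_geom. rewrite Rabs_pos_eq; lra. }
    split; [now apply (csummable_le _ (fun k => 0 * (/ 2) ^ k))|].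
    apply Cmod_eq_0. apply Rle_antisym; [|apply Cmod_ge_0].
    eapply Rle_trans; [apply (CSum_bound _ (fun k => 0 * (/ 2) ^ k)); auto|].
    rewrite Series_scal_l. lra.
  - destruct IH as [I1 I2]; [lia|].
    assert (Sx : csummable (fun m => V m O (x + - s j))).
    { apply (csummable_le _ (u O)); [|apply ex_series_u].
      intros k. apply V_le. generalize (Hs j Hn). lra. }
    unfold plusT, shiftT. simpl. split.
    + apply csummable_plus; [exact I1 | now apply csummable_cmult].
    + rewrite CSum_plus, I2, CSum_cmult; auto. now apply csummable_cmult.
Qed.

Lemma Neumann : exists psi, tower (fun x => x < - X) psi /\
  wbound nfact (fun x => x < - X) psi /\
  forall x, x < - X -> psi O x = (g O x - Uop N psi O x)%C.
Proof.
  exists (CSumT V). split; [|split].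
  - apply (tower_CSumT _ V u).
    + intros x Hx. now apply locally_lt.
    + exact tower_V.
    + intros; now apply V_le.
    + exact ex_series_u.
  (* Of the 8, one factor 2 is in [u], one is the sum of the geometric series, and one comes from
     [CSum_bound]. *)
  - exists (8 * G), (4 * rho). repeat split; try lra. intros n x Hx.
    eapply Rle_trans; [apply (CSum_bound _ (u n)); [intros; now apply V_le | apply ex_series_u]|].
    unfold u. rewrite Series_scal_l, Series_geom by (rewrite Rabs_pos_eq; lra).
    right. unfold nfact. field.
  - intros x Hx. unfold CSumT at 1. rewrite CSum_S.
    2:{ apply (csummable_le _ (u O)); [intros; now apply V_le | apply ex_series_u]. }
    destruct (Uop_CSum N x (Nat.le_refl N) Hx) as [U1 U2].
    rewrite <- U2.
    change (V O O x) with (g O x).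
    rewrite (CSum_ext _ (fun m => - (1) * Uop N (V m) O x)%C) by reflexivity.
    rewrite CSum_cmult by auto. ring.
Qed.

End Shift_equation.

Section Extension.

Variables (M : nat -> R).
Hypothesis Mpos : forall n, 0 < M n.
Hypothesis Mreg : regular M.
Variables (N : nat) (b : nat -> nat -> R -> C) (s : nat -> R) (g : nat -> R -> C) (sigma : R).
Hypothesis Hsigma : 0 < sigma.
Hypothesis Hs : forall j, (j < N)%nat -> sigma <= s j.
Hypothesis Hb : forall j, (j < N)%nat -> tower (fun _ => True) (b j).
Hypothesis Hg : tower (fun _ => True) g.
Hypothesis Bb : forall j c d, (j < N)%nat -> wbound nfact (fun x => c <= x <= d) (b j).
Hypothesis Bg : forall c d, wbound M (fun x => c <= x <= d) g.

(** Each application worsens the constants, so only compact intervals are claimed; these need only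
    finitely many applications. *)
Lemma wbound_Uop (a : R) (psi : nat -> R -> C) n0 : (n0 <= N)%nat ->
  (forall c d, d < a -> wbound M (fun x => c <= x <= d) psi) ->
  forall c d, d < a + sigma -> wbound M (fun x => c <= x <= d) (Uop b s n0 psi).
Proof.
  intros Hn H c d Hd.
  assert (M0 : forall n, 0 <= M n) by (intros; left; auto).
  induction n0 as [|j IH]; simpl.
  - exists 1, 1. repeat split; try lra. intros n x _. rewrite Cmod_0, pow1. specialize (M0 n). lra.
  - apply wbound_plusT; auto; [apply IH; lia|].
    apply wbound_prodT; auto.
    apply (wbound_sub M (fun x => c - s j <= x + - s j <= d - s j)); [intros x Hx; lra|].
    apply (wbound_shiftT M (fun x => c - s j <= x <= d - s j)). apply H.
    generalize (Hs j Hn). lra.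
Qed.

Variables (a : R) (psi : nat -> R -> C).
Hypothesis Tpsi : tower (fun x => x < a) psi.
Hypothesis Bpsi : wbound M (fun x => x < a) psi.
Hypothesis Epsi : forall x, x < a -> psi O x = (g O x - Uop b s N psi O x)%C.

Let Psi : nat -> nat -> R -> C := fix Psi m := match m with
  | O => psi
  | S m' => minusT g (Uop b s N (Psi m'))
  end.

Let A (m : nat) : R := a + INR m * sigma.

Lemma Extension_point_S m : A (S m) = A m + sigma.
Proof. unfold A. rewrite S_INR. ring. Qed.

Lemma tower_Psi m : tower (fun x => x < A m) (Psi m).
Proof.
  induction m as [|m IH].
  - apply (tower_sub (fun x => x < a)); auto. intros x. unfold A. simpl. lra.
  - rewrite Extension_point_S. change (Psi (S m)) with (minusT g (Uop b s N (Psi m))).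
    apply tower_minusT.
    + apply (tower_sub (fun _ => True)); auto.
    + now apply (tower_Uop N b s sigma).
Qed.

Lemma bound_Psi m c d : d < A m -> wbound M (fun x => c <= x <= d) (Psi m).
Proof.
  revert c d. induction m as [|m IH]; intros c d Hd.
  - apply (wbound_sub M (fun x => x < a)); auto. intros x. unfold A in Hd. simpl in Hd. lra.
  - rewrite Extension_point_S in Hd. change (Psi (S m)) with (minusT g (Uop b s N (Psi m))).
    apply wbound_minusT; auto; [intros; left; auto|].
    now apply (wbound_Uop (A m)).
Qed.

(** The two parts feed each other: the equation on x < A m says that the next function agrees with
    this one there, first at order 0 and then at all orders; the agreement, seen through shifts of
    at least [sigma], gives the equation on x < A (m + 1). *)
Lemma Psi_step m : (forall x, x < A m -> Psi m O x = (g O x - Uop b s N (Psi m) O x)%C) /\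
  (forall n x, x < A m -> Psi (S m) n x = Psi m n x).
Proof.
  assert (ST : forall m, (forall x, x < A m -> Psi m O x = (g O x - Uop b s N (Psi m) O x)%C) ->
     forall n x, x < A m -> Psi (S m) n x = Psi m n x).
  { intros k Hk. apply tower_eq.
    - intros x Hx. now apply locally_lt.
    - apply (tower_sub (fun x => x < A (S k))); [intros x; rewrite Extension_point_S; lra | apply tower_Psi].
    - apply tower_Psi.
    - intros x Hx. rewrite (Hk x Hx). reflexivity. }
  induction m as [|m [IH1 IH2]].
  - assert (H0 : forall x, x < A 0 -> Psi 0 O x = (g O x - Uop b s N (Psi 0) O x)%C).
    { intros x Hx. apply Epsi. unfold A in Hx. simpl in Hx. lra. }
    split; [exact H0 | now apply ST].
  - assert (H0 : forall x, x < A (S m) -> Psi (S m) O x = (g O x - Uop b s N (Psi (S m)) O x)%C).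
    { intros x Hx. rewrite Extension_point_S in Hx.
      rewrite (Uop_ext N b s sigma Hs (Psi (S m)) (Psi m)); auto.
      intros k y Hy. apply IH2. lra. }
    split; [exact H0 | now apply ST].
Qed.

Lemma Psi_stable m k n x : x < A m -> Psi (m + k)%nat n x = Psi m n x.
Proof.
  intros Hx. induction k as [|k IH]; [now rewrite Nat.add_0_r|].
  rewrite Nat.add_succ_r, (proj2 (Psi_step (m + k))); auto.
  unfold A in *. rewrite plus_INR. assert (0 <= INR k * sigma) by (apply Rmult_le_pos; [apply pos_INR | lra]). lra.
Qed.

(** The index is given as data because [Phi] below is defined from it pointwise; by [Psi_stable] its
    value does not matter. *)
Lemma A_unbounded x : { m | x < A m }.
Proof.
  destruct (nfloor_ex (Rmax 0 ((x - a) / sigma))) as [m Hm]; [apply Rmax_l|].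
  exists (S m). unfold A. rewrite S_INR.
  assert (H : (x - a) / sigma < INR m + 1) by (apply Rle_lt_trans with (Rmax 0 ((x - a) / sigma)); [apply Rmax_r | lra]).
  apply Rlt_div_l in H; lra.
Qed.

Lemma Extension : exists Phi, tower (fun _ => True) Phi /\
  (forall c d, wbound M (fun x => c <= x <= d) Phi) /\
  forall x, Phi O x = (g O x - Uop b s N Phi O x)%C.
Proof.
  set (Phi := fun n x => Psi (proj1_sig (A_unbounded x)) n x).
  assert (E : forall m n x, x < A m -> Phi n x = Psi m n x).
  { intros m n x Hx. unfold Phi. destruct (A_unbounded x) as [k Hk]; simpl.
    destruct (Nat.le_ge_cases m k) as [L|L].
    - replace k with (m + (k - m))%nat by lia. now apply Psi_stable.
    - replace m with (k + (m - k))%nat by lia. symmetry. now apply Psi_stable. }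
  exists Phi. split; [|split].
  - intros n x _. destruct (A_unbounded x) as [m Hm].
    rewrite (E m) by auto. apply (dC_ext_loc (Psi m n)).
    + generalize (locally_lt (A m) x Hm). apply filter_imp. intros t Ht. symmetry. now apply E.
    + now apply tower_Psi.
  - intros c d. destruct (A_unbounded d) as [m Hm].
    apply (wbound_ext M _ (Psi m)); [|now apply bound_Psi].
    intros n x Hx. symmetry. apply E. lra.
  - intros x. destruct (A_unbounded x) as [m Hm].
    rewrite (E m) by auto. rewrite (proj1 (Psi_step m) x Hm).
    rewrite (Uop_ext N b s sigma Hs Phi (Psi m)); auto.
    intros k y Hy. apply E. lra.
Qed.

End Extension.

(** * Derivatives of exponentials *)

Section Exponential_tower.

Variables (P1 : nat -> R -> C) (y0 : R -> C).

(* The derivatives of [y0] when [y0' = P1 0 * y0] and [P1] is the tower of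
   [P1 0]; the order [n] derivative needs all the previous ones, hence the table. *)
Fixpoint expTab (n m : nat) : R -> C :=
  match n with
  | O => y0
  | S n' => if Nat.leb m n' then expTab n' m else prodT P1 (expTab n') n'
  end.

Definition expT (n : nat) : R -> C := expTab n n.

Lemma expTab_le n m : (m <= n)%nat -> expTab n m = expT m.
Proof.
  induction n as [|n IH]; intros H.
  - replace m with O by lia. reflexivity.
  - destruct (Nat.eq_dec m (S n)) as [->|D]; [reflexivity|].
    cbn [expTab]. rewrite (proj2 (Nat.leb_le m n)) by lia. apply IH. lia.
Qed.

Lemma expT_S n x : expT (S n) x = prodT P1 expT n x.
Proof.
  unfold expT at 1. cbn [expTab]. rewrite (proj2 (Nat.leb_gt (S n) n)) by lia.
  apply prodT_ext; auto. intros m Hm. now rewrite expTab_le.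
Qed.

Lemma tower_expT : tower (fun _ => True) P1 ->
  (forall x, dC y0 x (P1 O x * y0 x)%C) -> tower (fun _ => True) expT.
Proof.
  intros TP H n x _. induction n as [n IH] using (well_founded_induction Wf_nat.lt_wf).
  destruct n as [|n].
  - rewrite expT_S. apply H.
  - rewrite expT_S. apply (dC_ext (prodT P1 expT n)); [intros; now rewrite expT_S|].
    apply prodT_dC; intros m Hm; [now apply TP | apply IH; lia].
Qed.

(** The induction closes exactly: [P1] has parameter 1 and the lower orders have parameter V, so
    their product gives V (V + 1)_n = (V)_(n+1). *)
Lemma expT_bound V k Y x : 0 <= V ->
  (forall l, Cmod (P1 l x) <= V * k ^ S l * INR (fact l)) -> Cmod (y0 x) <= Y ->
  forall n, Cmod (expT n x) <= Y * k ^ n * rising V n.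
Proof.
  intros HV HP HY n. induction n as [n IH] using (well_founded_induction Wf_nat.lt_wf).
  destruct n as [|n].
  - change (expT O x) with (y0 x). simpl. lra.
  - rewrite expT_S. eapply Rle_trans.
    + apply (prodT_rising P1 expT x 1 V (V * k) Y k).
      * intros i _. rewrite rising_1. eapply Rle_trans; [apply HP|]. right. simpl; ring.
      * intros j Hj. apply IH. lia.
    + rewrite rising_S_l, (Rplus_comm 1 V). right. simpl. ring.
Qed.

End Exponential_tower.

(** * The functions exp (c cosh (k x)) *)

Definition coshk (k x : R) : R := (exp (k * x) + exp (- (k * x))) / 2.

(** The tower of the logarithmic derivative of exp(c cosh(k x)). Entry l is a derivative of c cosh(k
    x) of order l + 1, hence the exponents [S l]. *)
Definition coshT (c k : R) (l : nat) (x : R) : C :=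
  RtoC (c / 2 * (k ^ S l * exp (k * x) + (- k) ^ S l * exp (- (k * x)))).

Definition expcosh (c k : R) : nat -> R -> C :=
  expT (coshT c k) (fun x => RtoC (exp (c * coshk k x))).

Lemma tower_expcosh c k : tower (fun _ => True) (expcosh c k).
Proof.
  apply tower_expT.
  - intros n x _. apply dC_RtoC. auto_derive; auto. simpl. ring.
  - intros x. unfold coshT. rewrite <- RtoC_mult. apply dC_RtoC. unfold coshk. auto_derive; auto.
    simpl. unfold Rdiv. ring.
Qed.

Lemma coshk_pos k x : 0 < coshk k x.
Proof. unfold coshk. generalize (exp_pos (k * x)) (exp_pos (- (k * x))). lra. Qed.

Lemma expcosh_bound c k n x : 0 <= k ->
  Cmod (expcosh c k n x) <= exp (c * coshk k x) * k ^ n * rising (Rabs c * coshk k x) n.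
Proof.
  intros Hk. apply expT_bound.
  - apply Rmult_le_pos; [apply Rabs_pos | left; apply coshk_pos].
  - intros l. unfold coshT. rewrite Cmod_R, Rabs_mult.
    assert (E1 := exp_pos (k * x)). assert (E2 := exp_pos (- (k * x))).
    assert (K0 : 0 <= k ^ S l) by now apply pow_le.
    apply Rle_trans with (Rabs (c / 2) * (k ^ S l * (exp (k * x) + exp (- (k * x))))).
    + apply Rmult_le_compat_l; [apply Rabs_pos|].
      eapply Rle_trans; [apply Rabs_triang|].
      rewrite !Rabs_mult, <- !RPow_abs, Rabs_Ropp, (Rabs_pos_eq k), !(Rabs_pos_eq (exp _)); auto; lra.
    + unfold Rdiv at 1. rewrite Rabs_mult, (Rabs_pos_eq (/ 2)) by lra.
      assert (F : 1 <= INR (fact l)) by (apply (le_INR 1), lt_O_fact).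
      rewrite <- (Rmult_1_r (_ * (_ * _))). apply Rmult_le_compat; try lra.
      * apply Rmult_le_pos; [|apply Rmult_le_pos; [exact K0 | lra]].
        apply Rmult_le_pos; [apply Rabs_pos | lra].
      * unfold coshk. right. field.
  - rewrite Cmod_R, Rabs_pos_eq; [lra | left; apply exp_pos].
Qed.

(** * Smoothed step functions *)

Definition gauss_int (x : R) : R := RInt (fun u => exp (- (u * u))) 0 x.

Lemma continuous_gauss x : continuous (fun u => exp (- (u * u))) x.
Proof. apply (ex_derive_continuous (fun u => exp (- (u * u)))). auto_derive; auto. Qed.

Lemma is_derive_gauss_int x : is_derive gauss_int x (exp (- (x * x))).
Proof.
  apply (is_derive_RInt (V := R_NormedModule) (fun u => exp (- (u * u))) gauss_int 0 x).
  - apply filter_forall. intros y. apply (RInt_correct (V := R_CompleteNormedModule)).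
    apply (ex_RInt_continuous (V := R_CompleteNormedModule)). intros z _. apply continuous_gauss.
  - apply continuous_gauss.
Qed.

Lemma gauss_int_0 : gauss_int 0 = 0.
Proof. exact (RInt_point 0 _). Qed.

Lemma derive_le (f df : R -> R) (a b : R) : a <= b ->
  (forall x, a <= x <= b -> is_derive f x (df x)) ->
  (forall x, a <= x <= b -> 0 <= df x) -> f a <= f b.
Proof.
  intros Hab Hf Hd. destruct (MVT_gen f a b df) as [c [Hc E]].
  - intros x. rewrite Rmin_left, Rmax_right by auto. intros; apply Hf; lra.
  - intros x. rewrite Rmin_left, Rmax_right by auto. intros Hx.
    apply continuity_pt_filterlim. apply (ex_derive_continuous f). exists (df x). now apply Hf.
  - rewrite Rmin_left, Rmax_right in Hc by auto.
    assert (0 <= df c * (b - a)) by (apply Rmult_le_pos; [now apply Hd | lra]). lra.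
Qed.

Lemma gauss_int_incr x y : x <= y -> gauss_int x <= gauss_int y.
Proof.
  intros H. apply (derive_le gauss_int (fun t => exp (- (t * t)))); auto.
  - intros; apply is_derive_gauss_int.
  - intros; left; apply exp_pos.
Qed.

Lemma gauss_int_odd x : gauss_int (- x) = - gauss_int x.
Proof.
  assert (H : forall y, is_derive (fun t => gauss_int (- t) + gauss_int t) y 0).
  { intros y. evar_last.
    - apply @is_derive_plus; [|apply is_derive_gauss_int].
      apply (is_derive_comp gauss_int Ropp y); [apply is_derive_gauss_int|].
      apply @is_derive_opp, @is_derive_id.
    - unfold plus, scal, opp, one; simpl. unfold mult; simpl.
      replace (- (- y * - y)) with (- (y * y)) by ring. ring. }
  assert (E : forall a b, a <= b -> gauss_int (- a) + gauss_int a = gauss_int (- b) + gauss_int b).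
  { intros a b Hab. apply Rle_antisym.
    - apply (derive_le (fun t => gauss_int (- t) + gauss_int t) (fun _ => 0)); auto; intros; lra.
    - apply Ropp_le_cancel.
      apply (derive_le (fun t => - (gauss_int (- t) + gauss_int t)) (fun _ => 0)); auto; [|intros; lra].
      intros y _. evar_last; [apply @is_derive_opp, H|]. unfold opp; simpl; ring. }
  assert (Z : gauss_int (- x) + gauss_int x = gauss_int (- 0) + gauss_int 0).
  { destruct (Rle_dec x 0); [apply E; auto | symmetry; apply E; lra]. }
  rewrite Ropp_0, gauss_int_0 in Z. lra.
Qed.

(** The derivative of gauss_int t + exp(-t^2) is exp(-t^2)(1 - 2t), negative beyond 1/2; this is
    where the threshold comes from. *)
Lemma gauss_int_tail x y : / 2 <= x -> x <= y -> gauss_int y <= gauss_int x + exp (- (x * x)).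
Proof.
  intros Hx Hy. apply Rle_trans with (gauss_int y + exp (- (y * y))).
  { generalize (exp_pos (- (y * y))); lra. }
  apply Ropp_le_cancel.
  apply (derive_le (fun t => - (gauss_int t + exp (- (t * t)))) (fun t => exp (- (t * t)) * (2 * t - 1))); auto.
  - intros t _. evar_last.
    + apply @is_derive_opp, @is_derive_plus; [apply is_derive_gauss_int|].
      auto_derive; auto.
    + unfold opp, plus; simpl. ring.
  - intros t Ht. apply Rmult_le_pos; [left; apply exp_pos | lra].
Qed.

(** L is the limit sqrt(pi)/2, obtained as a supremum; only these three properties of it are
    needed. *)
Lemma gauss_int_limit : exists L, 0 < L /\ (forall x, gauss_int x <= L) /\
  forall x, / 2 <= x -> L <= gauss_int x + exp (- (x * x)).
Proof.
  assert (B : forall x y, / 2 <= x -> gauss_int y <= gauss_int x + exp (- (x * x))).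
  { intros x y Hx. destruct (Rle_dec x y); [now apply gauss_int_tail|].
    generalize (gauss_int_incr y x) (exp_pos (- (x * x))). lra. }
  destruct (completeness (fun z => exists x, z = gauss_int x)) as [L [L1 L2]].
  - exists (gauss_int 1 + exp (- (1 * 1))). intros z [x ->]. apply B. lra.
  - exists (gauss_int 0), 0. reflexivity.
  - exists L. assert (Hle : forall x, gauss_int x <= L) by (intros x; apply L1; now exists x).
    split; [|split]; auto.
    + apply Rlt_le_trans with (gauss_int 1); [|auto].
      assert (H : 0 + exp (- (1)) * 1 <= gauss_int 1); [|generalize (exp_pos (- (1))); lra].
      assert (G : - (exp (- (1)) * 0) + gauss_int 0 <= - (exp (- (1)) * 1) + gauss_int 1).
      { apply (derive_le (fun t => - (exp (- (1)) * t) + gauss_int t) (fun t => exp (- (t * t)) - exp (- (1)))); try lra.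
        - intros x _. evar_last.
          + apply @is_derive_plus; [|apply is_derive_gauss_int]. auto_derive; auto.
          + unfold plus; simpl. ring.
        - intros x Hx. assert (exp (- (1)) <= exp (- (x * x))); [|lra]. apply exp_le. nra. }
      rewrite gauss_int_0 in G. lra.
    + intros x Hx. apply L2. intros z [y ->]. now apply B.
Qed.

Definition gaussP (lam : R) (l : nat) (x : R) : C :=
  match l with
  | O => RtoC (- 2 * lam * x)
  | S O => RtoC (- 2 * lam)
  | _ => 0%C
  end.

Definition gaussT (lam : R) : nat -> R -> C :=
  expT (gaussP lam) (fun x => RtoC (exp (- (lam * (x * x))))).

Lemma tower_gaussT lam : tower (fun _ => True) (gaussT lam).
Proof.
  apply tower_expT.
  - intros [|[|n]] x _; simpl.
    + apply dC_RtoC. auto_derive; auto. ring.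
    + apply dC_const.
    + apply dC_const.
  - intros x. simpl. rewrite <- RtoC_mult. apply dC_RtoC. auto_derive; auto. ring.
Qed.

(** The parameter lam (1 + x^2) dominates both nonzero entries 2 lam |x| and 2 lam of the
    logarithmic derivative. *)
Lemma gaussT_bound lam n x : 0 <= lam ->
  Cmod (gaussT lam n x) <= exp (- (lam * (x * x))) * 2 ^ n * rising (lam * (1 + x * x)) n.
Proof.
  intros Hl. assert (V0 : 0 <= lam * (1 + x * x)) by (apply Rmult_le_pos; nra).
  apply expT_bound; auto.
  - intros [|[|l]]; unfold gaussP; simpl fact; simpl pow.
    + rewrite Cmod_R. rewrite !Rabs_mult, (Rabs_pos_eq lam), (Rabs_left (-2)) by lra.
      simpl. assert (Rabs x <= 1 + x * x) by (unfold Rabs; destruct (Rcase_abs x); nra).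
      assert (lam * Rabs x <= lam * (1 + x * x)) by (apply Rmult_le_compat_l; auto). lra.
    + rewrite Cmod_R, Rabs_mult, (Rabs_pos_eq lam), (Rabs_left (-2)) by lra. simpl.
      assert (0 <= lam * (x * x)) by (apply Rmult_le_pos; nra). lra.
    + rewrite Cmod_0. apply Rmult_le_pos; [|apply pos_INR].
      apply Rmult_le_pos; auto. repeat apply Rmult_le_pos; try lra. apply pow_le; lra.
  - rewrite Cmod_R, Rabs_pos_eq; [lra | left; apply exp_pos].
Qed.

Section Step.

Variable L : R.
Hypothesis L0 : 0 < L.
Hypothesis L1 : forall x, gauss_int x <= L.
Hypothesis L2 : forall x, / 2 <= x -> L <= gauss_int x + exp (- (x * x)).

(** A smoothed Heaviside function, rising from 0 to 1 in a layer of width about lam^(-1/2) around 0.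
    Its derivative is a Gaussian, so the higher orders are read off [gaussT]. *)
Definition stepT (lam : R) (n : nat) (x : R) : C :=
  match n with
  | O => RtoC ((L + gauss_int (sqrt lam * x)) / (2 * L))
  | S n' => (RtoC (sqrt lam / (2 * L)) * gaussT lam n' x)%C
  end.

Definition costepT (lam : R) (n : nat) (x : R) : C :=
  match n with
  | O => RtoC ((L - gauss_int (sqrt lam * x)) / (2 * L))
  | S n' => (- (RtoC (sqrt lam / (2 * L)) * gaussT lam n' x))%C
  end.

Lemma is_derive_gauss_int_scal lam x : 0 <= lam ->
  is_derive (fun t => gauss_int (sqrt lam * t)) x (sqrt lam * exp (- (lam * (x * x)))).
Proof.
  intros Hl. evar_last.
  - apply (is_derive_comp gauss_int (fun t => sqrt lam * t) x); [apply is_derive_gauss_int|].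
    auto_derive; auto.
  - unfold scal; simpl. unfold mult; simpl.
    replace (sqrt lam * x * (sqrt lam * x)) with (sqrt lam * sqrt lam * (x * x)) by ring.
    rewrite sqrt_sqrt by auto. ring.
Qed.

Lemma tower_stepT lam : 0 <= lam -> tower (fun _ => True) (stepT lam).
Proof.
  intros Hl [|n] x _.
  - simpl. change (gaussT lam O x) with (RtoC (exp (- (lam * (x * x))))).
    rewrite <- RtoC_mult. apply dC_RtoC.
    evar_last.
    + apply (is_derive_ext (fun t => / (2 * L) * (L + gauss_int (sqrt lam * t)))).
      { intros t. unfold Rdiv. simpl. ring. }
      apply is_derive_scal, (is_derive_plus (V := R_NormedModule) (fun _ => L));
        [apply (is_derive_const (V := R_NormedModule)) | now apply is_derive_gauss_int_scal].
    + unfold plus, zero; simpl. field. lra.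
  - apply dC_cmult. now apply tower_gaussT.
Qed.

Lemma step_costep lam n x : costepT lam n x = ((if n then 1 else 0) - stepT lam n x)%C.
Proof.
  destruct n as [|n]; simpl; [|ring].
  rewrite <- RtoC_minus. f_equal. field. lra.
Qed.

Lemma tower_costepT lam : 0 <= lam -> tower (fun _ => True) (costepT lam).
Proof.
  intros Hl n x _.
  apply (dC_ext (fun t => (if n then 1 else 0) - stepT lam n t)%C).
  { intros; now rewrite step_costep. }
  rewrite step_costep.
  apply (dC_minus (fun _ => if n then 1 else 0)%C (stepT lam n)); [|now apply tower_stepT].
  apply dC_const.
Qed.

Definition stepK : R := 1 + / (2 * L).

Lemma stepK_pos : 0 < stepK.
Proof. unfold stepK. assert (0 < / (2 * L)) by (apply Rinv_0_lt_compat; lra). lra. Qed.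

Lemma step_tail_bound lam n x : 1 <= lam ->
  Cmod (RtoC (sqrt lam / (2 * L)) * gaussT lam n x)%C
  <= stepK * lam * exp (- (lam * (x * x))) * 2 ^ S n * rising (lam * (1 + x * x)) (S n).
Proof.
  intros Hl. rewrite Cmod_mult, Cmod_R.
  assert (V1 : 1 <= lam * (1 + x * x)) by nra.
  assert (I0 : 0 < / (2 * L)) by (apply Rinv_0_lt_compat; lra).
  assert (S1 : sqrt lam <= lam).
  { rewrite <- (sqrt_sqrt lam) at 2 by lra. generalize (sqrt_le_1 1 lam). rewrite sqrt_1. nra. }
  assert (S0 := sqrt_pos lam).
  rewrite Rabs_pos_eq.
  2:{ apply Rdiv_le_0_compat; lra. }
  assert (G := gaussT_bound lam n x). specialize (G ltac:(lra)).
  assert (E := exp_pos (- (lam * (x * x)))).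
  assert (P := pow_lt 2 n Rlt_0_2).
  assert (R0 : 0 <= rising (lam * (1 + x * x)) n) by (apply rising_ge_0; lra).
  assert (RS : rising (lam * (1 + x * x)) n <= rising (lam * (1 + x * x)) (S n)).
  { simpl. rewrite <- (Rmult_1_r (rising _ n)) at 1. apply Rmult_le_compat_l; auto.
    generalize (pos_INR n); lra. }
  apply Rle_trans with (stepK * lam * (exp (- (lam * (x * x))) * 2 ^ n * rising (lam * (1 + x * x)) n)).
  - apply Rmult_le_compat; auto; [apply Rdiv_le_0_compat; lra | apply Cmod_ge_0 |].
    unfold Rdiv, stepK. rewrite Rmult_comm. apply Rmult_le_compat; lra.
  - assert (K0 : 0 < stepK) by (unfold stepK; lra).
    replace (stepK * lam * exp (- (lam * (x * x))) * 2 ^ S n * rising (lam * (1 + x * x)) (S n))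
      with (stepK * lam * (exp (- (lam * (x * x))) * (2 ^ S n) * rising (lam * (1 + x * x)) (S n))) by ring.
    apply Rmult_le_compat_l; [apply Rmult_le_pos; lra|].
    apply Rmult_le_compat; auto.
    + apply Rmult_le_pos; lra.
    + apply Rmult_le_compat_l; [lra|]. simpl. lra.
Qed.

Lemma gauss_int_abs x : Rabs (gauss_int x) <= L.
Proof.
  apply Rabs_le. split; [|apply L1]. generalize (L1 (- x)). rewrite gauss_int_odd. lra.
Qed.

Lemma ratio_bound a : 0 <= a <= 2 * L -> Cmod (RtoC (a / (2 * L))) <= 1.
Proof.
  intros H. rewrite Cmod_R, Rabs_pos_eq by (apply Rdiv_le_0_compat; lra).
  apply Rle_div_l; lra.
Qed.

Lemma step_order0 lam (a E : R) : 1 <= lam -> 0 <= E -> a <= E -> 0 <= a ->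
  Cmod (RtoC (a / (2 * L))) <= stepK * lam * E.
Proof.
  intros Hl HE Ha Ha0. assert (I0 : 0 < / (2 * L)) by (apply Rinv_0_lt_compat; lra).
  rewrite Cmod_R, Rabs_pos_eq by (apply Rdiv_le_0_compat; lra).
  unfold Rdiv. rewrite Rmult_comm. apply Rmult_le_compat; try lra.
  unfold stepK. nra.
Qed.

(** Left of the layer the step function itself, not only its derivatives, carries the Gaussian
    factor: by oddness of [gauss_int] and the tail bound [L2]. *)
Lemma step_left lam n x : 1 <= lam -> x <= - / 2 ->
  Cmod (stepT lam n x)
  <= stepK * lam * exp (- (lam * (x * x))) * 2 ^ n * rising (lam * (1 + x * x)) n.
Proof.
  intros Hl Hx. destruct n as [|n]; [|now apply step_tail_bound].
  simpl. rewrite !Rmult_1_r.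
  assert (S1 : 1 <= sqrt lam) by (rewrite <- sqrt_1; apply sqrt_le_1; lra).
  apply step_order0; auto; [left; apply exp_pos | |].
  - replace (sqrt lam * x) with (- (sqrt lam * - x)) by ring. rewrite gauss_int_odd.
    assert (H := L2 (sqrt lam * - x)).
    replace (sqrt lam * - x * (sqrt lam * - x)) with (sqrt lam * sqrt lam * (x * x)) in H by ring.
    rewrite sqrt_sqrt in H by lra. specialize (H ltac:(nra)). lra.
  - generalize (gauss_int_abs (sqrt lam * x)). intros H. apply Rabs_le_between in H. lra.
Qed.

Lemma costep_right lam n x : 1 <= lam -> / 2 <= x ->
  Cmod (costepT lam n x)
  <= stepK * lam * exp (- (lam * (x * x))) * 2 ^ n * rising (lam * (1 + x * x)) n.
Proof.
  intros Hl Hx. destruct n as [|n].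
  2:{ simpl. rewrite Cmod_opp. now apply step_tail_bound. }
  simpl. rewrite !Rmult_1_r.
  assert (S1 : 1 <= sqrt lam) by (rewrite <- sqrt_1; apply sqrt_le_1; lra).
  apply step_order0; auto; [left; apply exp_pos | |].
  - assert (H := L2 (sqrt lam * x)).
    replace (sqrt lam * x * (sqrt lam * x)) with (sqrt lam * sqrt lam * (x * x)) in H by ring.
    rewrite sqrt_sqrt in H by lra. specialize (H ltac:(nra)). lra.
  - generalize (gauss_int_abs (sqrt lam * x)). intros H. apply Rabs_le_between in H. lra.
Qed.

Lemma step_global lam n x : 1 <= lam ->
  Cmod (stepT lam n x) <= stepK * lam * 2 ^ n * rising (lam * (1 + x * x)) n /\
  Cmod (costepT lam n x) <= stepK * lam * 2 ^ n * rising (lam * (1 + x * x)) n.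
Proof.
  intros Hl.
  assert (I0 : 0 < / (2 * L)) by (apply Rinv_0_lt_compat; lra).
  destruct n as [|n].
  - simpl. rewrite !Rmult_1_r.
    assert (1 <= stepK * lam) by (unfold stepK; nra).
    generalize (gauss_int_abs (sqrt lam * x)). intros H'. apply Rabs_le_between in H'.
    split; (eapply Rle_trans; [apply ratio_bound; lra | lra]).
  - assert (H : Cmod (RtoC (sqrt lam / (2 * L)) * gaussT lam n x)%C
      <= stepK * lam * 2 ^ S n * rising (lam * (1 + x * x)) (S n)).
    { eapply Rle_trans; [now apply step_tail_bound|].
      apply Rmult_le_compat_r; [apply rising_ge_0; nra|].
      apply Rmult_le_compat_r; [apply pow_le; lra|].
      rewrite <- (Rmult_1_r (stepK * lam)) at 2. apply Rmult_le_compat_l; [unfold stepK; nra|].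
      rewrite <- exp_0. apply exp_le. nra. }
    split; [exact H|]. simpl costepT. rewrite Cmod_opp. exact H.
Qed.

End Step.

(** * Chebyshev polynomials *)

(* [chT k n] is the [n]-th derivative of the Chebyshev polynomial [T_k]. *)
Fixpoint chT (k n : nat) (x : R) : R :=
  match k with
  | O => match n with O => 1 | _ => 0 end
  | S k' => match k' with
    | O => match n with O => x | S O => 1 | _ => 0 end
    | S k'' => 2 * x * chT k' n x + 2 * INR n * chT k' (pred n) x - chT k'' n x
    end
  end.

(** The three-term recurrence differentiated n times. At n = 0 the factor [INR n] kills the term
    with [pred n]. *)
Lemma chT_SS k n x :
  chT (S (S k)) n x = 2 * x * chT (S k) n x + 2 * INR n * chT (S k) (pred n) x - chT k n x.
Proof. reflexivity. Qed.

Lemma nat_ind2 (P : nat -> Prop) : P O -> P 1%nat -> (forall n, P n -> P (S n) -> P (S (S n))) ->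
  forall n, P n.
Proof.
  intros H0 H1 H n. assert (P n /\ P (S n)); [|tauto].
  induction n as [|n [A B]]; auto.
Qed.

Lemma is_derive_chT k n x : is_derive (chT k n) x (chT k (S n) x).
Proof.
  revert n x. induction k as [| |k IH1 IH2] using nat_ind2; intros n x.
  - destruct n; apply (is_derive_const (V := R_NormedModule)).
  - destruct n as [|[|n]]; simpl.
    + apply (is_derive_id (K := R_AbsRing)).
    + apply (is_derive_const (V := R_NormedModule)).
    + apply (is_derive_const (V := R_NormedModule)).
  - apply (is_derive_ext (fun t => 2 * t * chT (S k) n t + 2 * INR n * chT (S k) (pred n) t - chT k n t)).
    { intros t. now rewrite chT_SS. }
    evar_last.
    + apply (is_derive_minus (V := R_NormedModule)); [|apply IH1].
      apply (is_derive_plus (V := R_NormedModule)).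
      * apply is_derive_Rmult; [|apply IH2]. apply is_derive_scal, (is_derive_id (K := R_AbsRing)).
      * apply is_derive_scal. apply IH2.
    + rewrite chT_SS. unfold minus, plus, opp, one; simpl pred. simpl.
      destruct n as [|n]; [simpl; ring|]. simpl pred. rewrite !S_INR.
      change (match n with O => 1 | S _ => INR n + 1 end) with (INR (S n)). rewrite S_INR. ring.
Qed.

Lemma chT_cos k t : chT k 0 (cos t) = cos (INR k * t).
Proof.
  induction k as [| |k IH1 IH2] using nat_ind2.
  - simpl. now rewrite Rmult_0_l, cos_0.
  - simpl. now rewrite Rmult_1_l.
  - rewrite chT_SS, IH1, IH2, !S_INR.
    replace ((INR k + 1 + 1) * t) with ((INR k + 1) * t + t) by ring.
    replace (INR k * t) with ((INR k + 1) * t - t) by ring.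
    rewrite cos_plus, cos_minus. change (INR 0) with 0. ring.
Qed.

Lemma chT_sin k t : sin t * chT k 1 (cos t) = INR k * sin (INR k * t).
Proof.
  assert (A : is_derive (fun u => chT k 0 (cos u)) t (- sin t * chT k 1 (cos t))).
  { apply (is_derive_comp (chT k 0) cos); [apply is_derive_chT | apply is_derive_cos]. }
  assert (B : is_derive (fun u => chT k 0 (cos u)) t (- INR k * sin (INR k * t))).
  { apply (is_derive_ext (fun u => cos (INR k * u))); [intros; now rewrite chT_cos|].
    auto_derive; auto. ring. }
  apply is_derive_unique in A, B. rewrite A in B. lra.
Qed.

(** Differentiating sin t T_k'(cos t) = k sin(k t) once more gives the Chebyshev equation without a
    division by sin t, so the endpoints are included. *)
Lemma chT_ode0 k x : -1 <= x <= 1 ->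
  (1 - x * x) * chT k 2 x - x * chT k 1 x + INR k * INR k * chT k 0 x = 0.
Proof.
  intros Hx. set (t := acos x). assert (E : cos t = x) by (apply cos_acos; lra).
  assert (A : is_derive (fun u => sin u * chT k 1 (cos u)) t
     (cos t * chT k 1 (cos t) + sin t * (- sin t * chT k 2 (cos t)))).
  { apply (is_derive_Rmult sin (fun u => chT k 1 (cos u))); [apply is_derive_sin|].
    apply (is_derive_comp (chT k 1) cos); [apply is_derive_chT | apply is_derive_cos]. }
  assert (B : is_derive (fun u => sin u * chT k 1 (cos u)) t (INR k * (INR k * cos (INR k * t)))).
  { apply (is_derive_ext (fun u => INR k * sin (INR k * u))); [intros; now rewrite chT_sin|].
    auto_derive; auto. ring. }
  apply is_derive_unique in A, B. rewrite A, <- chT_cos in B.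
  generalize (sin2_cos2 t). unfold Rsqr. rewrite E in *. intros S2.
  replace (1 - x * x) with (sin t * sin t) by lra. lra.
Qed.

Lemma chT_ode k n x : -1 < x < 1 ->
  (1 - x * x) * chT k (S (S n)) x - (2 * INR n + 1) * x * chT k (S n) x
  + (INR k * INR k - INR n * INR n) * chT k n x = 0.
Proof.
  revert x. induction n as [|n IH]; intros x Hx.
  - simpl INR. generalize (chT_ode0 k x). lra.
  - set (E := fun y => (1 - y * y) * chT k (S (S n)) y - (2 * INR n + 1) * y * chT k (S n) y
      + (INR k * INR k - INR n * INR n) * chT k n y) in *.
    assert (A : is_derive E x ((- 2 * x) * chT k (S (S n)) x + (1 - x * x) * chT k (S (S (S n))) x
      - ((2 * INR n + 1) * chT k (S n) x + (2 * INR n + 1) * x * chT k (S (S n)) x)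
      + (INR k * INR k - INR n * INR n) * chT k (S n) x)).
    { apply (is_derive_plus (V := R_NormedModule)).
      - apply (is_derive_minus (V := R_NormedModule)).
        + apply (is_derive_Rmult (fun y => 1 - y * y) (chT k (S (S n)))); [|apply is_derive_chT]. auto_derive; auto. ring.
        + apply (is_derive_Rmult (fun y => (2 * INR n + 1) * y) (chT k (S n))); [|apply is_derive_chT]. auto_derive; auto. ring.
      - apply is_derive_scal, is_derive_chT. }
    assert (B : is_derive E x 0).
    { apply (is_derive_ext_loc (fun _ => 0)); [|apply (is_derive_const (V := R_NormedModule))].
      generalize (filter_and _ _ (locally_gt (-1) x (proj1 Hx)) (locally_lt 1 x (proj2 Hx))).
      apply filter_imp. intros t Ht. symmetry. now apply IH. }
    apply is_derive_unique in A, B. rewrite A in B. rewrite S_INR.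
    rewrite <- B. ring.
Qed.

(** The differential equation expresses order n + 2 by the two orders below, and 1 - x^2 >= 3/4 may
    be divided out. This gives growth k^n; at the endpoints, where 1 - x^2 vanishes, the true size
    is k^(2n). *)
Lemma chT_mid k n x : Rabs x <= / 2 -> Rabs (chT k n x) <= 3 ^ n * rising (INR k + 1) n.
Proof.
  intros Hx. assert (Hx' := Hx). apply Rabs_le_between in Hx'.
  assert (k0 := pos_INR k).
  induction n as [| |n IH1 IH2] using nat_ind2.
  - rewrite <- (cos_acos x) by lra. rewrite chT_cos. simpl. apply Rabs_le.
    generalize (COS_bound (INR k * acos x)). lra.
  - assert (H := chT_sin k (acos x)). rewrite cos_acos in H by lra.
    assert (S2 := sin2_cos2 (acos x)). unfold Rsqr in S2. rewrite cos_acos in S2 by lra.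
    assert (S3 : / 2 <= Rabs (sin (acos x))).
    { assert (3 / 4 <= Rabs (sin (acos x)) * Rabs (sin (acos x))).
      { rewrite <- Rabs_mult. rewrite Rabs_pos_eq; nra. }
      generalize (Rabs_pos (sin (acos x))). nra. }
    assert (H2 : Rabs (sin (acos x)) * Rabs (chT k 1 x) <= INR k * 1).
    { rewrite <- Rabs_mult, H, Rabs_mult, (Rabs_pos_eq (INR k)) by auto.
      apply Rmult_le_compat_l; auto. apply Rabs_le. generalize (SIN_bound (INR k * acos x)). lra. }
    simpl. generalize (Rabs_pos (chT k 1 x)). nra.
  - assert (O := chT_ode k n x). specialize (O ltac:(lra)).
    assert (n0 := pos_INR n).
    set (D0 := Rabs (chT k n x)) in *. set (D1 := Rabs (chT k (S n) x)) in *.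
    set (D2 := Rabs (chT k (S (S n)) x)).
    assert (R0 : 0 <= rising (INR k + 1) n) by (apply rising_ge_0; lra).
    assert (P0 : 0 < 3 ^ n) by (apply pow_lt; lra).
    assert (H : (1 - x * x) * D2 <= (2 * INR n + 1) * / 2 * D1 + (INR k * INR k + INR n * INR n) * D0).
    { unfold D2. rewrite <- (Rabs_pos_eq (1 - x * x)) by nra. rewrite <- Rabs_mult.
      replace ((1 - x * x) * chT k (S (S n)) x) with ((2 * INR n + 1) * x * chT k (S n) x +
        (- ((INR k * INR k - INR n * INR n) * chT k n x))) by lra.
      eapply Rle_trans; [apply Rabs_triang|]. rewrite Rabs_Ropp, !Rabs_mult.
      apply Rplus_le_compat.
      - apply Rmult_le_compat_r; [apply Rabs_pos|].
        rewrite (Rabs_pos_eq (2 * INR n + 1)) by lra. apply Rmult_le_compat_l; lra.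
      - apply Rmult_le_compat_r; [apply Rabs_pos|]. apply Rabs_le. nra. }
    simpl rising in IH2 |- *. change (match n with O => 1 | S _ => INR n + 1 end) with (INR (S n)).
    rewrite S_INR. simpl pow in IH2 |- *.
    set (r := rising (INR k + 1) n) in *. set (p := 3 ^ n) in *.
    assert (A1 : (2 * INR n + 1) * / 2 * D1 <= (INR k + 1 + (INR n + 1)) * (3 * (p * r) * (INR k + 1 + INR n))).
    { apply Rmult_le_compat; try apply Rabs_pos; lra. }
    assert (A2 : (INR k * INR k + INR n * INR n) * D0 <= (INR k + 1 + (INR n + 1)) * (INR k + 1 + INR n) * (p * r)).
    { apply Rmult_le_compat; auto; try nra. apply Rabs_pos. }
    assert (D20 : 0 <= D2) by apply Rabs_pos.
    assert (Q : 3 / 4 * D2 <= (1 - x * x) * D2) by (apply Rmult_le_compat_r; nra).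
    assert (W : 0 <= (INR k + 1 + (INR n + 1)) * (INR k + 1 + INR n) * (p * r)).
    { repeat apply Rmult_le_pos; lra. }
    (* The two terms amount to 3 W + W with W the common product; dividing by 3/4 leaves 16/3, below
       the 9 = 3^2 allowed. *)
    replace (3 * (3 * p) * (r * (INR k + 1 + INR n) * (INR k + 1 + (INR n + 1))))
      with (9 * ((INR k + 1 + (INR n + 1)) * (INR k + 1 + INR n) * (p * r))) by ring.
    replace ((INR k + 1 + (INR n + 1)) * (3 * (p * r) * (INR k + 1 + INR n)))
      with (3 * ((INR k + 1 + (INR n + 1)) * (INR k + 1 + INR n) * (p * r))) in A1 by ring.
    lra.
Qed.

Lemma rising_diff a n : rising (a + 1) (S n) = rising a (S n) + INR (S n) * rising (a + 1) n.
Proof. rewrite (rising_S_l a n), S_INR. simpl. ring. Qed.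

(** Induction along the recurrence with q = 1 + 2|x|: the terms at order n close by (q - 1) q + 1 <=
    q^2, and the term 2n T^(n-1) is exactly the increment of the rising factorial in
    [rising_diff]. *)
Lemma chT_global k n x : Rabs (chT k n x) <= 2 ^ n * rising (INR k + 1) n * (1 + 2 * Rabs x) ^ k.
Proof.
  assert (q1 : 1 <= 1 + 2 * Rabs x) by (generalize (Rabs_pos x); lra).
  set (q := 1 + 2 * Rabs x) in *.
  assert (P : forall m, 0 < 2 ^ m) by (intros; apply pow_lt; lra).
  assert (RP : forall j m, 0 <= rising (INR j + 1) m).
  { intros. apply rising_ge_0. generalize (pos_INR j); lra. }
  revert n. induction k as [| |k IH1 IH2] using nat_ind2; intros n.
  - destruct n as [|n]; simpl chT; simpl (q ^ 0).
    + simpl. rewrite Rabs_R1. lra.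
    + rewrite Rabs_R0. generalize (P (S n)) (RP O (S n)). intros. rewrite Rmult_1_r.
      apply Rmult_le_pos; lra.
  - destruct n as [|[|n]]; simpl chT; rewrite pow_1.
    + simpl. unfold q. generalize (Rabs_pos x); lra.
    + simpl. rewrite Rabs_R1. nra.
    + rewrite Rabs_R0.
      apply Rmult_le_pos; [apply Rmult_le_pos; [left; apply P | apply RP] | lra].
  - assert (Qk : 0 < q ^ k) by (apply pow_lt; lra).
    rewrite chT_SS.
    assert (H : Rabs (2 * x * chT (S k) n x + 2 * INR n * chT (S k) (pred n) x - chT k n x)
      <= (q - 1) * Rabs (chT (S k) n x) + 2 * INR n * Rabs (chT (S k) (pred n) x) + Rabs (chT k n x)).
    { unfold Rminus at 1. eapply Rle_trans; [apply Rabs_triang|]. rewrite Rabs_Ropp.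
      apply Rplus_le_compat_r. eapply Rle_trans; [apply Rabs_triang|].
      rewrite !Rabs_mult, (Rabs_pos_eq 2), (Rabs_pos_eq (INR n)) by (try apply pos_INR; lra).
      unfold q. lra. }
    eapply Rle_trans; [exact H|]. clear H.
    assert (n0 := pos_INR n).
    assert (A1 : (q - 1) * Rabs (chT (S k) n x) <= (q - 1) * (2 ^ n * rising (INR (S k) + 1) n * (q * q ^ k))).
    { apply Rmult_le_compat_l; [lra | apply IH2]. }
    assert (A3 : Rabs (chT k n x) <= 2 ^ n * rising (INR (S k) + 1) n * q ^ k).
    { eapply Rle_trans; [apply IH1|]. apply Rmult_le_compat_r; [lra|].
      apply Rmult_le_compat_l; [left; apply P|]. apply rising_le. rewrite S_INR.
      generalize (pos_INR k); lra. }
    assert (A4 : (q - 1) * (q * q ^ k) + q ^ k <= q * (q * q ^ k)) by nra.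
    assert (X : 0 <= 2 ^ n * rising (INR (S k) + 1) n) by (apply Rmult_le_pos; [left; apply P | apply RP]).
    destruct n as [|n].
    + simpl INR in *. simpl pred. change (q ^ S (S k)) with (q * (q * q ^ k)).
      simpl rising in *. simpl pow in *.
      rewrite Rmult_0_r, Rmult_0_l. rewrite !Rmult_1_l in *. lra.
    + simpl pred.
      assert (A2 : 2 * INR (S n) * Rabs (chT (S k) n x)
        <= 2 ^ S n * (INR (S n) * rising (INR (S k) + 1 + 1) n) * (q * (q * q ^ k))).
      { assert (B := IH2 n). change (q ^ S k) with (q * q ^ k) in B.
        assert (B2 : rising (INR (S k) + 1) n <= rising (INR (S k) + 1 + 1) n).
        { apply rising_le. generalize (pos_INR (S k)); lra. }
        replace (2 ^ S n * (INR (S n) * rising (INR (S k) + 1 + 1) n) * (q * (q * q ^ k)))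
          with (2 * INR (S n) * (2 ^ n * rising (INR (S k) + 1 + 1) n * (q * (q * q ^ k)))) by (simpl pow; ring).
        apply Rmult_le_compat_l; [lra|]. eapply Rle_trans; [exact B|].
        assert (0 <= q * q ^ k) by nra.
        apply Rmult_le_compat; try nra.
        - apply Rmult_le_pos; [left; apply P | apply RP].
        - apply Rmult_le_compat_l; [left; apply P | auto]. }
      rewrite (S_INR (S k)). rewrite (rising_diff (INR (S k) + 1) n).
      change (q ^ S (S k)) with (q * (q * q ^ k)).
      assert (A5 : 2 ^ S n * rising (INR (S k) + 1) (S n) * ((q - 1) * (q * q ^ k) + q ^ k)
        <= 2 ^ S n * rising (INR (S k) + 1) (S n) * (q * (q * q ^ k))).
      { now apply Rmult_le_compat_l. }
      set (p := 2 ^ S n) in *. set (r := rising (INR (S k) + 1) (S n)) in *.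
      set (r' := INR (S n) * rising (INR (S k) + 1 + 1) n) in *.
      replace (p * (r + r') * (q * (q * q ^ k))) with (p * r * (q * (q * q ^ k)) + p * r' * (q * (q * q ^ k))) by ring.
      replace (p * r * ((q - 1) * (q * q ^ k) + q ^ k)) with ((q - 1) * (p * r * (q * q ^ k)) + p * r * q ^ k) in A5 by ring.
      lra.
Qed.

(** * Chebyshev coefficients *)

Definition cont (h : R -> R) : Prop := forall t, continuous h t.

Lemma cont_ex_RInt h a b : cont h -> ex_RInt h a b.
Proof. intros H. apply (ex_RInt_continuous (V := R_CompleteNormedModule)). auto. Qed.

Lemma cont_derive (f df : R -> R) : (forall t : R, is_derive f t (df t)) -> cont f.
Proof. intros H t. apply (ex_derive_continuous f). exists (df t). apply H. Qed.

Lemma cont_mult f g : cont f -> cont g -> cont (fun t => f t * g t).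
Proof. intros A B t. apply (continuous_mult (K := R_AbsRing)); auto. Qed.

Lemma cont_plus f g : cont f -> cont g -> cont (fun t => f t + g t).
Proof. intros A B t. apply (continuous_plus (V := R_NormedModule)); auto. Qed.

Lemma cont_minus f g : cont f -> cont g -> cont (fun t => f t - g t).
Proof. intros A B t. apply (continuous_minus (V := R_NormedModule)); auto. Qed.

Lemma cont_const c : cont (fun _ => c).
Proof. intros t. apply continuous_const. Qed.

Lemma cont_comp f g : cont f -> cont g -> cont (fun t => f (g t)).
Proof. intros A B t. apply (continuous_comp g f); auto. Qed.

Lemma cont_cos : cont cos.
Proof. exact (cont_derive _ _ is_derive_cos). Qed.

Lemma cont_cosk a : cont (fun t => cos (a * t)).
Proof. apply (cont_derive _ (fun t => - a * sin (a * t))). intros t. auto_derive; auto. ring. Qed.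

Definition Ipi (h : R -> R) : R := RInt h 0 PI.

Lemma Ipi_plus f g : cont f -> cont g -> Ipi (fun t => f t + g t) = Ipi f + Ipi g.
Proof. intros A B. exact (RInt_plus f g 0 PI (cont_ex_RInt f 0 PI A) (cont_ex_RInt g 0 PI B)). Qed.

Lemma Ipi_minus f g : cont f -> cont g -> Ipi (fun t => f t - g t) = Ipi f - Ipi g.
Proof. intros A B. exact (RInt_minus f g 0 PI (cont_ex_RInt f 0 PI A) (cont_ex_RInt g 0 PI B)). Qed.

Lemma Ipi_scal c f : cont f -> Ipi (fun t => c * f t) = c * Ipi f.
Proof. intros A. exact (RInt_scal f 0 PI c (cont_ex_RInt f 0 PI A)). Qed.

Lemma Ipi_ext f g : (forall t, f t = g t) -> Ipi f = Ipi g.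
Proof. intros H. apply RInt_ext. auto. Qed.

Lemma Ipi_derive (f df : R -> R) : (forall t : R, is_derive f t (df t)) -> cont df -> Ipi df = f PI - f 0.
Proof.
  intros H C. apply is_RInt_unique. apply (is_RInt_derive f df); auto.
Qed.

Lemma Ipi_bound f K : cont f -> (forall t, Rabs (f t) <= K) -> Rabs (Ipi f) <= PI * K.
Proof.
  intros A H. replace (PI * K) with ((PI - 0) * K) by ring.
  apply abs_RInt_le_const; auto; [generalize PI_RGT_0; lra | now apply cont_ex_RInt].
Qed.

Lemma sin_INR_PI k : sin (INR k * PI) = 0.
Proof. apply sin_eq_0_1. exists (Z.of_nat k). now rewrite INR_IZR_INZ. Qed.

Definition cheb_coef (f : R -> R) (k : nat) : R := 2 / PI * Ipi (fun t => f (cos t) * cos (INR k * t)).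

Lemma cont_integrand f k : cont f -> cont (fun t => f (cos t) * cos (INR k * t)).
Proof. intros H. apply cont_mult; [apply (cont_comp f cos H cont_cos) | apply cont_cosk]. Qed.

Ltac solve_cont := repeat match goal with
  | |- cont (fun _ => ?c) => apply (cont_const c)
  | |- cont (fun t => @?f t - @?g t) => apply (cont_minus f g)
  | |- cont (fun t => @?f t + @?g t) => apply (cont_plus f g)
  | |- cont (fun t => @?f t * @?g t) => apply (cont_mult f g)
  | |- cont (fun t => cos (?a * t)) => apply (cont_cosk a)
  | |- cont (fun t => ?f (cos t)) => apply (cont_comp f cos); [|exact cont_cos]
  | |- _ => assumption
  end.

(** Integration by parts after x = cos t. The boundary terms contain sin((k+1) t) and vanish at 0
    and pi, and sin t sin((k+1) t) splits into the neighbouring cosines. *)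
Lemma cheb_coef_derive (f f1 : R -> R) (k : nat) : (forall x : R, is_derive f x (f1 x)) -> cont f1 ->
  2 * INR (S k) * cheb_coef f (S k) = cheb_coef f1 k - cheb_coef f1 (S (S k)).
Proof.
  intros Hf C1. assert (C0 := cont_derive f f1 Hf).
  assert (Z : Ipi (fun t => INR (S k) * (f (cos t) * cos (INR (S k) * t)) -
     / 2 * (f1 (cos t) * cos (INR k * t) - f1 (cos t) * cos (INR (S (S k)) * t))) = 0).
  { rewrite (Ipi_derive (fun t => f (cos t) * sin (INR (S k) * t))).
    - rewrite sin_INR_PI, (Rmult_0_r (INR (S k))), sin_0. ring.
    - intros t. evar_last.
      + apply (is_derive_Rmult (fun u => f (cos u)) (fun u => sin (INR (S k) * u))).
        * apply (is_derive_comp f cos t); [apply Hf | apply is_derive_cos].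
        * auto_derive; auto.
      + unfold scal; simpl; unfold mult; simpl.
        change (match k with O => 1 | S _ => INR k + 1 end) with (INR (S k)).
        replace (INR k * t) with (INR (S k) * t - t) by (rewrite S_INR; ring).
        replace ((INR (S k) + 1) * t) with (INR (S k) * t + t) by ring.
        rewrite cos_plus, cos_minus. field.
    - solve_cont. }
  rewrite Ipi_minus, !Ipi_scal, Ipi_minus in Z by solve_cont.
  unfold cheb_coef. generalize PI_RGT_0; intros.
  set (a := Ipi (fun t => f (cos t) * cos (INR (S k) * t))) in *.
  replace (2 * INR (S k) * (2 / PI * a)) with (2 * (2 / PI) * (INR (S k) * a)) by ring.
  replace (INR (S k) * a) with
    (/ 2 * (Ipi (fun t => f1 (cos t) * cos (INR k * t)) - Ipi (fun t => f1 (cos t) * cos (INR (S (S k)) * t)))) by lra.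
  field. lra.
Qed.

Lemma cheb_coef_bound f S k : cont f -> (forall x, -1 <= x <= 1 -> Rabs (f x) <= S) ->
  Rabs (cheb_coef f k) <= 2 * S.
Proof.
  intros C H. unfold cheb_coef. assert (P := PI_RGT_0).
  rewrite Rabs_mult, (Rabs_pos_eq (2 / PI)) by (apply Rdiv_le_0_compat; lra).
  replace (2 * S) with (2 / PI * (PI * S)) by (field; lra).
  apply Rmult_le_compat_l; [apply Rdiv_le_0_compat; lra|].
  apply Ipi_bound; [now apply cont_integrand|]. intros t.
  rewrite Rabs_mult, <- (Rmult_1_r S).
  apply Rmult_le_compat; try apply Rabs_pos; [apply H, COS_bound|].
  apply Rabs_le. generalize (COS_bound (INR k * t)). lra.
Qed.

(** Each use of [cheb_coef_derive] trades a derivative for a factor of the index and moves the index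
    by one; in n uses it never falls below k - n, which explains the base of the power. *)
Lemma cheb_coef_decay (F : nat -> R -> R) (B : nat -> R) :
  (forall n x, is_derive (F n) x (F (S n) x)) ->
  (forall n x, -1 <= x <= 1 -> Rabs (F n x) <= B n) ->
  forall n k, (n <= k)%nat -> Rabs (cheb_coef (F O) k) * INR (k - n) ^ n <= 2 * B n.
Proof.
  intros HF HB.
  assert (C : forall m, cont (F m)) by (intros m; exact (cont_derive _ _ (HF m))).
  assert (G : forall n m k, (n <= k)%nat -> Rabs (cheb_coef (F m) k) * INR (k - n) ^ n <= 2 * B (m + n)%nat).
  { induction n as [|n IH]; intros m k Hk.
    - rewrite Nat.add_0_r. simpl. rewrite Rmult_1_r.
      apply cheb_coef_bound; [apply C | apply HB].
    - destruct k as [|k]; [lia|].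
      assert (E := cheb_coef_derive (F m) (F (S m)) k (HF m) (C (S m))).
      assert (I1 := IH (S m) k ltac:(lia)). assert (I2 := IH (S m) (S (S k)) ltac:(lia)).
      replace (S m + n)%nat with (m + S n)%nat in * by lia.
      replace (S k - S n)%nat with (k - n)%nat by lia.
      assert (q0 := pos_INR (k - n)).
      assert (q1 : INR (k - n) <= INR (S k)) by (apply le_INR; lia).
      assert (s0 : 0 < INR (S k)) by (apply lt_0_INR; lia).
      assert (P : INR (k - n) ^ n <= INR (S (S k) - n) ^ n).
      { apply pow_incr. split; auto. apply le_INR; lia. }
      assert (P0 : 0 <= INR (k - n) ^ n) by now apply pow_le.
      assert (I2' : Rabs (cheb_coef (F (S m)) (S (S k))) * INR (k - n) ^ n <= 2 * B (m + S n)%nat).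
      { eapply Rle_trans; [|exact I2]. apply Rmult_le_compat_l; [apply Rabs_pos | auto]. }
      assert (A : 2 * INR (S k) * Rabs (cheb_coef (F m) (S k)) * INR (k - n) ^ n <= 4 * B (m + S n)%nat).
      { rewrite <- (Rabs_pos_eq (2 * INR (S k))) by lra. rewrite <- Rabs_mult, E.
        apply Rle_trans with ((Rabs (cheb_coef (F (S m)) k) + Rabs (cheb_coef (F (S m)) (S (S k)))) * INR (k - n) ^ n).
        - apply Rmult_le_compat_r; auto. unfold Rminus. eapply Rle_trans; [apply Rabs_triang|].
          rewrite Rabs_Ropp. lra.
        - lra. }
      simpl pow.
      assert (W : 0 <= Rabs (cheb_coef (F m) (S k)) * INR (k - n) ^ n).
      { apply Rmult_le_pos; [apply Rabs_pos | auto]. }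
      assert (INR (k - n) * (Rabs (cheb_coef (F m) (S k)) * INR (k - n) ^ n)
        <= INR (S k) * (Rabs (cheb_coef (F m) (S k)) * INR (k - n) ^ n)) by now apply Rmult_le_compat_r.
      lra. }
  intros n k Hk. apply (G n O k Hk).
Qed.

Lemma Ipi_cos_diff a b : sin (a * PI) = 0 -> sin (b * PI) = 0 -> a <> 0 -> b <> 0 ->
  Ipi (fun t => / 2 * cos (a * t) + / 2 * cos (b * t)) = 0.
Proof.
  intros Ha Hb A B.
  rewrite (Ipi_derive (fun t => / 2 * (sin (a * t) / a) + / 2 * (sin (b * t) / b))).
  - rewrite Ha, Hb, !Rmult_0_r, sin_0. field. auto.
  - intros t. auto_derive; auto. field. auto.
  - apply cont_plus; apply cont_mult; try apply cont_const; apply cont_cosk.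
Qed.

Lemma cos_orthogonal j k : j <> k -> Ipi (fun t => cos (INR j * t) * cos (INR k * t)) = 0.
Proof.
  intros H.
  rewrite (Ipi_ext _ (fun t => / 2 * cos ((INR j - INR k) * t) + / 2 * cos ((INR j + INR k) * t))).
  - apply Ipi_cos_diff.
    + rewrite Rmult_minus_distr_r, sin_minus, !sin_INR_PI. ring.
    + rewrite Rmult_plus_distr_r, sin_plus, !sin_INR_PI. ring.
    + intros E. apply H, INR_eq. lra.
    + rewrite <- plus_INR. intros E. apply (not_0_INR (j + k)); [lia | exact E].
  - intros t. rewrite Rmult_minus_distr_r, Rmult_plus_distr_r, cos_minus, cos_plus. field.
Qed.

Lemma cos_square k : (0 < k)%nat -> Ipi (fun t => cos (INR k * t) * cos (INR k * t)) = PI / 2.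
Proof.
  intros H.
  assert (k0 : 0 < INR k) by now apply lt_0_INR.
  rewrite (Ipi_derive (fun t => t / 2 + sin (2 * INR k * t) / (4 * INR k))).
  - replace (2 * INR k * PI) with (INR (2 * k) * PI) by (rewrite mult_INR; reflexivity).
    rewrite sin_INR_PI, Rmult_0_r, sin_0. field. lra.
  - intros t. auto_derive; auto. replace (2 * INR k * t) with (2 * (INR k * t)) by ring.
    rewrite cos_2a_cos. field. lra.
  - apply cont_mult; apply cont_cosk.
Qed.

(* Bessel's inequality, as the monotonicity of the squared distance to the
   partial sums. *)
Lemma cheb_coef_lim (Q : R -> R) : cont Q -> is_lim_seq (cheb_coef Q) 0.
Proof.
  intros C. assert (P := PI_RGT_0).
  (* The constant term is never subtracted: its square integrates to pi instead of pi/2, and a limit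
     does not see it. *)
  set (G := fix G n := match n with
    | O => fun t => Q (cos t)
    | S n' => fun t => G n' t - cheb_coef Q (S n') * cos (INR (S n') * t) end).
  assert (CG : forall n, cont (G n)).
  { induction n as [|n IH]; [apply (cont_comp Q cos C cont_cos)|].
    apply cont_minus; auto. apply cont_mult; [apply cont_const | apply cont_cosk]. }
  assert (O : forall n j, (n < j)%nat -> Ipi (fun t => G n t * cos (INR j * t)) = PI / 2 * cheb_coef Q j).
  { induction n as [|n IH]; intros j Hj.
    - unfold cheb_coef. simpl G. field. lra.
    - rewrite (Ipi_ext _ (fun t => G n t * cos (INR j * t)
        - cheb_coef Q (S n) * (cos (INR (S n) * t) * cos (INR j * t)))).
      2:{ intros t. cbn [G]. ring. }
      rewrite Ipi_minus, Ipi_scal, cos_orthogonal, IH; try lia; try ring;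
        solve_cont; try exact (CG n). }
  set (D := fun n => Ipi (fun t => G n t * G n t)).
  assert (DS : forall n, D (S n) = D n - PI / 2 * (cheb_coef Q (S n) * cheb_coef Q (S n))).
  { intros n. unfold D.
    set (c := cheb_coef Q (S n)).
    rewrite (Ipi_ext _ (fun t => G n t * G n t - (2 * c * (G n t * cos (INR (S n) * t))
       - (c * c) * (cos (INR (S n) * t) * cos (INR (S n) * t))))).
    2:{ intros t. cbn [G]. fold c. ring. }
    rewrite !Ipi_minus, !Ipi_scal, cos_square, O; try lia;
      solve_cont; try exact (CG n).
    fold c. field. }
  assert (D0 : forall n, 0 <= D n).
  { intros n. unfold D, Ipi. apply RInt_ge_0; [lra | apply cont_ex_RInt, cont_mult; apply CG |].
    intros t _. apply Rle_0_sqr. }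
  assert (L : ex_finite_lim_seq D).
  { apply (ex_finite_lim_seq_decr D 0); auto. intros n. rewrite DS.
    assert (0 <= PI / 2 * (cheb_coef Q (S n) * cheb_coef Q (S n))) by (apply Rmult_le_pos; [lra | apply Rle_0_sqr]).
    lra. }
  destruct L as [l Hl].
  assert (L2 : is_lim_seq (fun n => D n - D (S n)) 0).
  { replace (Finite 0) with (Finite (l - l)) by (f_equal; ring).
    apply is_lim_seq_minus'; [exact Hl | now apply (is_lim_seq_incr_1 D)]. }
  apply (is_lim_seq_incr_1 (cheb_coef Q)).
  apply is_lim_seq_Reals. intros eps He.
  apply is_lim_seq_Reals in L2.
  destruct (L2 (PI / 2 * (eps * eps))) as [N HN].
  { apply Rmult_lt_0_compat; [lra | now apply Rmult_lt_0_compat]. }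
  exists N. intros n Hn. specialize (HN n Hn). unfold R_dist in *.
  rewrite DS, Rminus_0_r in HN. rewrite Rminus_0_r.
  replace (D n - (D n - PI / 2 * (cheb_coef Q (S n) * cheb_coef Q (S n))))
    with (PI / 2 * (cheb_coef Q (S n) * cheb_coef Q (S n))) in HN by ring.
  rewrite Rabs_mult, (Rabs_pos_eq (PI / 2)), Rabs_mult in HN by lra.
  apply Rmult_lt_reg_l in HN; [|lra].
  generalize (Rabs_pos (cheb_coef Q (S n))). intros. nra.
Qed.

(** The difference quotient, completed at x0 by the derivative. Continuity is all that the decay of
    its coefficients in [cheb_coef_lim] requires. *)
Lemma continuous_quotient (f f1 : R -> R) (x0 : R) : (forall x, is_derive f x (f1 x)) ->
  exists Q, cont Q /\ forall x, f x - f x0 = (x - x0) * Q x.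
Proof.
  intros Hf.
  set (Q := fun x => if Req_EM_T x x0 then f1 x0 else (f x - f x0) / (x - x0)).
  exists Q. split.
  - intros x. destruct (Req_EM_T x x0) as [->|N].
    + apply continuity_pt_filterlim.
      assert (H := Hf x0). apply is_derive_Reals in H.
      intros eps He. destruct (H eps He) as [d Hd].
      exists d. split; [apply cond_pos|]. intros y [_ Hy]. simpl in *. unfold R_dist in *.
      unfold Q at 2. destruct (Req_EM_T x0 x0) as [_|E]; [|congruence].
      unfold Q. destruct (Req_EM_T y x0) as [->|E].
      * unfold Rminus. rewrite Rplus_opp_r, Rabs_R0. exact He.
      * specialize (Hd (y - x0)). replace (x0 + (y - x0)) with y in Hd by ring.
        apply Hd; auto. lra.
    + apply (continuous_ext_loc _ (fun y => (f y - f x0) / (y - x0))).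
      * assert (P : 0 < Rabs (x - x0)) by (apply Rabs_pos_lt; lra).
        exists (mkposreal _ P). intros y Hy. unfold Q.
        destruct (Req_EM_T y x0) as [->|E]; [|reflexivity].
        exfalso. change (Rabs (x0 - x) < Rabs (x - x0)) in Hy. rewrite Rabs_minus_sym in Hy. lra.
      * apply (ex_derive_continuous (fun y => (f y - f x0) / (y - x0))).
        auto_derive. split; [exists (f1 x); apply Hf | split; [|auto]; lra].
  - intros x. unfold Q. destruct (Req_EM_T x x0) as [->|E]; [ring | field; lra].
Qed.

Definition cheb_coef' (f : R -> R) (k : nat) : R :=
  match k with O => cheb_coef f 0 / 2 | _ => cheb_coef f k end.

Lemma cheb_const c k : cheb_coef (fun _ => c) k = match k with O => 2 * c | _ => 0 end.
Proof.
  unfold cheb_coef. assert (P := PI_RGT_0). rewrite Ipi_scal by apply cont_cosk.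
  destruct k as [|k].
  - rewrite (Ipi_ext _ (fun _ => 1)).
    + rewrite (Ipi_derive (fun t => t) (fun _ => 1)); [field; lra | | apply cont_const].
      intros t. apply (is_derive_id (K := R_AbsRing)).
    + intros t. simpl. now rewrite Rmult_0_l, cos_0.
  - rewrite (Ipi_ext _ (fun t => cos (INR 0 * t) * cos (INR (S k) * t))).
    + rewrite cos_orthogonal by lia. ring.
    + intros t. simpl (INR 0). rewrite Rmult_0_l, cos_0. ring.
Qed.

(* With [f - f x0 = (x - x0) Q], the partial sums telescope by the
   Christoffel-Darboux identity. *)
Lemma cheb_expansion (f f1 : R -> R) (x : R) : (forall t, is_derive f t (f1 t)) ->
  -1 <= x <= 1 -> is_series (fun k => cheb_coef' f k * chT k 0 x) (f x).
Proof.
  intros Hf Hx. assert (P := PI_RGT_0).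
  assert (C := cont_derive f f1 Hf).
  destruct (continuous_quotient f f1 x Hf) as [Q [CQ EQ]].
  set (q := cheb_coef Q). set (T := fun k => chT k 0 x).
  assert (A : forall a b, cont a -> cont b -> forall c k, (forall y, f y = c + a y - b y) ->
     cheb_coef f k = cheb_coef (fun _ => c) k + cheb_coef a k - cheb_coef b k).
  { intros a b Ca Cb c k E. unfold cheb_coef.
    rewrite (Ipi_ext (fun t => f (cos t) * cos (INR k * t)) (fun t => c * cos (INR k * t)
       + a (cos t) * cos (INR k * t) - b (cos t) * cos (INR k * t))).
    - rewrite Ipi_minus, Ipi_plus; try ring;
      solve_cont.
    - intros t. rewrite E. ring. }
  assert (E0 : cheb_coef' f 0 = f x + / 2 * (q 1%nat - x * q O)).
  { unfold cheb_coef'. rewrite (A (fun y => y * Q y) (fun y => x * Q y)) with (c := f x).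
    - rewrite cheb_const. unfold q, cheb_coef.
      rewrite (Ipi_ext (fun t => cos t * Q (cos t) * cos (INR 0 * t)) (fun t => Q (cos t) * cos (INR 1 * t))).
      2:{ intros t. simpl. rewrite Rmult_0_l, cos_0, Rmult_1_l. ring. }
      rewrite (Ipi_ext (fun t => x * Q (cos t) * cos (INR 0 * t)) (fun t => x * (Q (cos t) * cos (INR 0 * t)))) by (intros; ring).
      rewrite Ipi_scal by now apply cont_integrand. field. lra.
    - apply cont_mult; auto. intros t; apply continuous_id.
    - apply cont_mult; auto. apply cont_const.
    - intros y. generalize (EQ y). lra. }
  assert (ES : forall k, cheb_coef' f (S k) = / 2 * (q (S (S k)) + q k) - x * q (S k)).
  { intros k. unfold cheb_coef'. rewrite (A (fun y => y * Q y) (fun y => x * Q y)) with (c := f x).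
    - rewrite cheb_const. unfold q, cheb_coef.
      rewrite (Ipi_ext (fun t => cos t * Q (cos t) * cos (INR (S k) * t))
        (fun t => / 2 * (Q (cos t) * cos (INR (S (S k)) * t) + Q (cos t) * cos (INR k * t)))).
      2:{ intros t. replace (INR k * t) with (INR (S k) * t - t) by (rewrite S_INR; ring).
          rewrite (S_INR (S k)).
          replace ((INR (S k) + 1) * t) with (INR (S k) * t + t) by ring.
          rewrite cos_plus, cos_minus. field. }
      rewrite (Ipi_ext (fun t => x * Q (cos t) * cos (INR (S k) * t)) (fun t => x * (Q (cos t) * cos (INR (S k) * t)))) by (intros; ring).
      rewrite !Ipi_scal, Ipi_plus; try (now apply cont_integrand);
        [field; lra | apply cont_plus; now apply cont_integrand].
    - apply cont_mult; auto. intros t; apply continuous_id.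
    - apply cont_mult; auto. apply cont_const.
    - intros y. generalize (EQ y). lra. }
  (* The remainder after telescoping: |T k| <= 1 on [-1,1] and the coefficients [q] tend to 0. The
     half weight at k = 0 makes the telescoping start correctly. *)
  assert (TS : forall n, sum_n (fun k => cheb_coef' f k * T k) n
     = f x + / 2 * (T n * q (S n) - T (S n) * q n)).
  { induction n as [|n IH].
    - rewrite sum_O, E0. unfold T. simpl. ring.
    - rewrite sum_Sn, IH, ES. unfold plus; simpl plus.
      assert (TR : T (S (S n)) = 2 * x * T (S n) - T n) by (unfold T; rewrite chT_SS; simpl; ring).
      rewrite TR. simpl. field. }
  assert (TB : forall k, Rabs (T k) <= 1).
  { intros k. unfold T. rewrite <- (cos_acos x) by lra. rewrite chT_cos. apply Rabs_le.
    generalize (COS_bound (INR k * acos x)). lra. }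
  assert (LQ : is_lim_seq q 0) by now apply cheb_coef_lim.
  assert (LZ : forall u : nat -> R, is_lim_seq u 0 -> forall v : nat -> R, (forall k, Rabs (v k) <= 1) ->
     is_lim_seq (fun n => v n * u n) 0).
  { intros u Hu v Hv. apply is_lim_seq_abs_0.
    apply is_lim_seq_le_le with (fun _ => 0) (fun n => Rabs (u n)).
    - intros n. split; [apply Rabs_pos|]. rewrite Rabs_mult.
      rewrite <- (Rmult_1_l (Rabs (u n))) at 2. apply Rmult_le_compat_r; [apply Rabs_pos | auto].
    - apply is_lim_seq_const.
    - now apply is_lim_seq_abs_0 in Hu. }
  change (is_lim_seq (sum_n (fun k => cheb_coef' f k * T k)) (f x)).
  apply is_lim_seq_ext with (fun n => f x + / 2 * (T n * q (S n) - T (S n) * q n)); [intros n; now rewrite TS|].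
  replace (Finite (f x)) with (Finite (f x + / 2 * (0 - 0))) by (f_equal; field).
  apply is_lim_seq_plus'; [apply is_lim_seq_const|].
  apply (is_lim_seq_scal_l _ (/ 2) (0 - 0)).
  apply is_lim_seq_minus'.
  - apply (LZ (fun n => q (S n))); auto. now apply (is_lim_seq_incr_1 q).
  - apply (LZ q LQ (fun n => T (S n))); auto.
Qed.

(** * Splitting a Carleman function *)

Definition inv_sq (k : nat) : R := / (INR k + 1) ^ 2.

Lemma inv_sq_pos k : 0 < inv_sq k.
Proof. apply Rinv_0_lt_compat, pow_lt. generalize (pos_INR k). lra. Qed.

Lemma ex_series_inv_sq : ex_series inv_sq.
Proof.
  apply (ex_series_Rabs_le _ (fun k => 2 * (/ (INR k + 1) - / (INR k + 2)))).
  - intros k. rewrite Rabs_pos_eq by (left; apply inv_sq_pos). unfold inv_sq.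
    generalize (pos_INR k); intros.
    replace (2 * (/ (INR k + 1) - / (INR k + 2))) with (/ ((INR k + 1) * ((INR k + 2) / 2))) by (field; lra).
    apply Rinv_le_contravar; [apply Rmult_lt_0_compat; lra|]. simpl. rewrite Rmult_1_r.
    apply Rmult_le_compat_l; lra.
  - apply (ex_series_scal_l (V := R_NormedModule) 2 (fun k => / (INR k + 1) - / (INR k + 2))).
    exists 1.
    assert (E : forall n, sum_n (fun k => / (INR k + 1) - / (INR k + 2)) n = 1 - / (INR n + 2)).
    { induction n as [|n IH].
      - rewrite sum_O. simpl. field.
      - rewrite sum_Sn, IH, S_INR. unfold plus; simpl. generalize (pos_INR n); intros. field. lra. }
    change (is_lim_seq (sum_n (fun k => / (INR k + 1) - / (INR k + 2))) 1).
    apply is_lim_seq_ext with (fun n => 1 - / (INR n + 2)); [intros; now rewrite E|].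
    replace (Finite 1) with (Finite (1 - 0)) by (f_equal; ring).
    apply is_lim_seq_minus'; [apply is_lim_seq_const|].
    apply (is_lim_seq_inv (fun n => INR n + 2) p_infty); [|discriminate].
    apply (is_lim_seq_plus _ _ p_infty 2); [apply is_lim_seq_INR | apply is_lim_seq_const | reflexivity].
Qed.

Lemma pow_sum_le a b n : 0 <= a -> 0 <= b -> (a + b) ^ n <= 2 ^ n * (a ^ n + b ^ n).
Proof.
  intros Ha Hb.
  assert (P : forall c d, 0 <= c <= d -> (c + d) ^ n <= 2 ^ n * (c ^ n + d ^ n)).
  { intros c d H. apply Rle_trans with (2 ^ n * d ^ n).
    - rewrite <- Rpow_mult_distr. apply pow_incr. lra.
    - apply Rmult_le_compat_l; [apply pow_le; lra|]. generalize (pow_le c n); lra. }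
  destruct (Rle_dec a b); [apply P; lra|].
  rewrite (Rplus_comm a), (Rplus_comm (a ^ n)). apply P; lra.
Qed.

Lemma INR_pow_le_fact n : INR n ^ n <= INR (fact n) * 3 ^ n.
Proof.
  eapply Rle_trans; [apply pow_le_fact_exp, pos_INR|].
  apply Rmult_le_compat_l; [apply pos_INR|].
  replace (INR n) with (INR n * 1) by ring. rewrite exp_mul_INR. apply pow_incr.
  split; [left; apply exp_pos | apply exp_le_3].
Qed.

Lemma rising_mid_le V n : 0 <= V -> rising V n <= 2 ^ n * (V ^ n + INR (fact n) * 3 ^ n).
Proof.
  intros H. eapply Rle_trans; [now apply rising_pow|].
  eapply Rle_trans; [apply pow_sum_le; [auto | apply pos_INR]|].
  apply Rmult_le_compat_l; [apply pow_le; lra|].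
  apply Rplus_le_compat_l, INR_pow_le_fact.
Qed.

Section Decomposition.

Variable M : nat -> R.
Hypothesis Mpos : forall n, 0 < M n.
Hypothesis Mreg : regular M.
Variable F : nat -> R -> C.
Hypothesis TF : tower (fun _ => True) F.
Hypothesis BF : forall c d, wbound M (fun x => c <= x <= d) F.

Definition ccoef (k : nat) : C :=
  (cheb_coef' (fun t => Re (F O t)) k, cheb_coef' (fun t => Im (F O t)) k).

Lemma Re_tower n x : is_derive (fun t => Re (F n t)) x (Re (F (S n) x)).
Proof. apply TF. exact Logic.I. Qed.

Lemma Im_tower n x : is_derive (fun t => Im (F n t)) x (Im (F (S n) x)).
Proof. apply TF. exact Logic.I. Qed.

Lemma cheb_coef'_le f k : Rabs (cheb_coef' f k) <= Rabs (cheb_coef f k).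
Proof.
  destruct k as [|k]; simpl; [|lra].
  unfold Rdiv. rewrite Rabs_mult, (Rabs_pos_eq (/ 2)) by lra. generalize (Rabs_pos (cheb_coef f 0)). lra.
Qed.

(** The raw decay has (k - n)^n, useless for k near or below n. There the trivial bound on the
    coefficient is enough, because k^n is then of factorial size and n! is dominated by M n. *)
Lemma ccoef_decay : exists K A, 0 < K /\ 0 < A /\
  forall k n, Cmod (ccoef k) * (INR k + 1) ^ S n <= K * A ^ n * M n * inv_sq k.
Proof.
  destruct (BF (-1) 1) as (K0 & rho & HK0 & Hr & B).
  set (S0 := fun n => K0 * rho ^ n * M n).
  assert (S0p : forall n, 0 < S0 n).
  { intros n. unfold S0. apply Rmult_lt_0_compat; [|apply Mpos]. apply Rmult_lt_0_compat; [auto | now apply pow_lt]. }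
  assert (D : forall n k, (n <= k)%nat -> Cmod (ccoef k) * INR (k - n) ^ n <= 4 * S0 n).
  { intros n k Hk.
    assert (q0 : 0 <= INR (k - n) ^ n) by (apply pow_le, pos_INR).
    assert (D1 := cheb_coef_decay (fun n t => Re (F n t)) S0 Re_tower
      (fun n x Hx => Rle_trans _ _ _ (Re_le_Cmod _) (B n x Hx)) n k Hk).
    assert (D2 := cheb_coef_decay (fun n t => Im (F n t)) S0 Im_tower
      (fun n x Hx => Rle_trans _ _ _ (Im_le_Cmod _) (B n x Hx)) n k Hk).
    assert (E1 := Rmult_le_compat_r _ _ _ q0 (cheb_coef'_le (fun t => Re (F O t)) k)).
    assert (E2 := Rmult_le_compat_r _ _ _ q0 (cheb_coef'_le (fun t => Im (F O t)) k)).
    assert (E3 := Rmult_le_compat_r _ _ _ q0 (Cmod_le_Re_Im (ccoef k))).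
    unfold ccoef in E3 at 2 3. simpl in E3. lra. }
  destruct (weight_fact_le M Mpos Mreg) as (k0 & c & Hk0 & Hc & Hf).
  assert (G : exists K A, 0 < K /\ 0 < A /\ forall k n, Cmod (ccoef k) * (INR k + 1) ^ n <= K * A ^ n * M n).
  { exists (12 * S0 O * k0 + 4 * K0), (12 * c + 2 * rho). repeat split.
    - specialize (S0p O). assert (0 < S0 O * k0) by now apply Rmult_lt_0_compat. lra.
    - lra.
    - intros k n.
      assert (kk := pos_INR k). assert (nn := pos_INR n).
      assert (c0 := Cmod_ge_0 (ccoef k)).
      assert (Mn := Mpos n).
      assert (P1 : 0 <= (12 * c) ^ n) by (apply pow_le; lra).
      assert (P2 : 0 <= (2 * rho) ^ n) by (apply pow_le; lra).
      assert (P3 : (12 * c) ^ n <= (12 * c + 2 * rho) ^ n) by (apply pow_incr; lra).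
      assert (P4 : (2 * rho) ^ n <= (12 * c + 2 * rho) ^ n) by (apply pow_incr; lra).
      assert (S0k : 0 < S0 O * k0) by now apply Rmult_lt_0_compat.
      apply Rle_trans with ((12 * S0 O * k0) * ((12 * c) ^ n * M n) + 4 * K0 * ((2 * rho) ^ n * M n)).
      (* If k + 1 <= 4 (n + 1), then (k+1)^n <= 3 * 12^n n!; otherwise k - n is at least half of k +
         1 and [D] applies. *)
      + destruct (Nat.le_gt_cases (S k) (4 * S n)) as [L|L].
        * assert (H1 : INR k + 1 <= 4 * (INR n + 1)).
          { rewrite <- !S_INR. replace 4 with (INR 4) by (simpl; ring). rewrite <- mult_INR. now apply le_INR. }
          assert (H2 : (INR k + 1) ^ n <= 4 ^ n * (3 * (INR (fact n) * 3 ^ n))).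
          { apply Rle_trans with ((4 * (INR n + 1)) ^ n); [apply pow_incr; lra|].
            rewrite Rpow_mult_distr. apply Rmult_le_compat_l; [apply pow_le; lra|].
            eapply Rle_trans; [apply pow_le_fact_exp; lra|].
            replace (INR n + 1) with (INR n * 1 + 1) by ring. rewrite exp_plus, exp_mul_INR.
            replace (3 * (INR (fact n) * 3 ^ n)) with (INR (fact n) * (3 ^ n * 3)) by ring.
            apply Rmult_le_compat_l; [apply pos_INR|].
            generalize exp_le_3 (exp_pos 1); intros.
            apply Rmult_le_compat; try lra; [apply pow_le; lra | apply pow_incr; lra]. }
          assert (H3 : Cmod (ccoef k) <= 4 * S0 O).
          { generalize (D O k (Nat.le_0_l k)). simpl. lra. }
          assert (Q : 0 <= 4 * K0 * ((2 * rho) ^ n * M n)).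
          { apply Rmult_le_pos; [lra|]. apply Rmult_le_pos; lra. }
          assert (4 ^ n * (3 * (INR (fact n) * 3 ^ n)) <= 3 * k0 * ((12 * c) ^ n * M n)).
          { replace (12 * c) with (4 * 3 * c) by ring. rewrite !Rpow_mult_distr.
            replace (4 ^ n * (3 * (INR (fact n) * 3 ^ n))) with (3 * (4 ^ n * 3 ^ n) * INR (fact n)) by ring.
            replace (3 * k0 * (4 ^ n * 3 ^ n * c ^ n * M n)) with (3 * (4 ^ n * 3 ^ n) * (k0 * c ^ n * M n)) by ring.
            apply Rmult_le_compat_l; [|apply Hf].
            repeat apply Rmult_le_pos; try lra; apply pow_le; lra. }
          assert (Cmod (ccoef k) * (INR k + 1) ^ n <= 4 * S0 O * (3 * k0 * ((12 * c) ^ n * M n))).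
          { apply Rmult_le_compat; auto; [apply pow_le; lra | lra]. }
          lra.
        * assert (H1 : (INR k + 1) <= 2 * INR (k - n)).
          { rewrite <- S_INR. replace 2 with (INR 2) by reflexivity. rewrite <- mult_INR. apply le_INR. lia. }
          assert (H2 : (INR k + 1) ^ n <= 2 ^ n * INR (k - n) ^ n).
          { rewrite <- Rpow_mult_distr. apply pow_incr. lra. }
          assert (Q : 0 <= (12 * S0 O * k0) * ((12 * c) ^ n * M n)).
          { apply Rmult_le_pos; [lra|]. apply Rmult_le_pos; lra. }
          assert (D1 := D n k ltac:(lia)).
          assert (T : 0 < 2 ^ n) by (apply pow_lt; lra).
          assert (Cmod (ccoef k) * (INR k + 1) ^ n <= 2 ^ n * (4 * S0 n)).
          { apply Rle_trans with (Cmod (ccoef k) * (2 ^ n * INR (k - n) ^ n)).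
            - now apply Rmult_le_compat_l.
            - replace (Cmod (ccoef k) * (2 ^ n * INR (k - n) ^ n)) with (2 ^ n * (Cmod (ccoef k) * INR (k - n) ^ n)) by ring.
              apply Rmult_le_compat_l; lra. }
          replace (4 * K0 * ((2 * rho) ^ n * M n)) with (2 ^ n * (4 * S0 n))
            by (unfold S0; rewrite Rpow_mult_distr; ring).
          lra.
      + set (T := (12 * c + 2 * rho) ^ n) in *.
        replace ((12 * S0 O * k0 + 4 * K0) * T * M n)
          with ((12 * S0 O * k0) * (T * M n) + 4 * K0 * (T * M n)) by ring.
        apply Rplus_le_compat; (apply Rmult_le_compat_l; [lra|]); apply Rmult_le_compat_r; lra. }
  destruct G as (K & A & HK & HA & G).
  (* [G] is used at order n + 3: one extra power of k + 1 stays on the left to pay for [lam k], the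
     other two become [inv_sq k]. *)
  destruct (weight_add3 M Mpos Mreg) as (A3 & HA3 & H3).
  exists (K * A ^ 3 * A3), (A * A3).
  assert (0 < A ^ 3) by now apply pow_lt.
  repeat split; try (repeat apply Rmult_lt_0_compat; lra).
  intros k n. assert (kk := pos_INR k). unfold inv_sq.
  assert (P : 0 < (INR k + 1) ^ 2) by (apply pow_lt; lra).
  apply (Rmult_le_reg_r ((INR k + 1) ^ 2)); auto.
  rewrite (Rmult_assoc _ (/ _)), Rinv_l, Rmult_1_r by lra.
  rewrite Rmult_assoc, <- pow_add.
  replace (S n + 2)%nat with (n + 3)%nat by lia.
  eapply Rle_trans; [apply G|]. rewrite pow_add, Rpow_mult_distr.
  replace (K * A ^ 3 * A3 * (A ^ n * A3 ^ n) * M n) with (K * (A ^ n * A ^ 3) * (A3 ^ S n * M n)) by (simpl; ring).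
  apply Rmult_le_compat_l; [|apply H3].
  apply Rmult_le_pos; [lra|]. apply Rmult_le_pos; [apply pow_le; lra | lra].
Qed.

Variable L : R.
Hypothesis L0 : 0 < L.
Hypothesis L1 : forall x, gauss_int x <= L.
Hypothesis L2 : forall x, / 2 <= x -> L <= gauss_int x + exp (- (x * x)).

(** Proportional to k so that derivatives of the step stay comparable with those of T_k; the factor
    8 lets half of the Gaussian absorb (1 + 2|x|)^k when |x| >= 1/2. *)
Let lam (k : nat) : R := 8 * (INR k + 1).

Lemma lam_ge_1 k : 1 <= lam k.
Proof. unfold lam. generalize (pos_INR k). lra. Qed.

Definition chTC (k n : nat) (x : R) : C := RtoC (chT k n x).

Lemma tower_chTC k P : tower P (chTC k).
Proof. intros n x _. apply dC_RtoC, is_derive_chT. Qed.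

Definition term (E : R -> nat -> R -> C) (k : nat) : nat -> R -> C :=
  cmultT (ccoef k) (prodT (chTC k) (E (lam k))).

(** The parameters add up to (k + 1) + 2 lam k = 17 (k + 1), as 1 + x^2 <= 2; the rate is the 3 of
    [chT_mid]. *)
Lemma term_mid (E : R -> nat -> R -> C) k n x : Rabs x <= / 2 ->
  (forall l m y, 1 <= l -> Cmod (E l m y) <= stepK L * l * 2 ^ m * rising (l * (1 + y * y)) m) ->
  Cmod (term E k n x) <= Cmod (ccoef k) * (stepK L * lam k * 3 ^ n * rising (17 * (INR k + 1)) n).
Proof.
  intros Hx HE. unfold term, cmultT. rewrite Cmod_mult.
  apply Rmult_le_compat_l; [apply Cmod_ge_0|].
  assert (Hl := lam_ge_1 k). assert (kk := pos_INR k).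
  assert (K0 : 0 < stepK L) by exact (stepK_pos L L0).
  assert (X2 : x * x <= 1).
  { apply Rabs_le_between in Hx. nra. }
  eapply Rle_trans.
  - apply (prodT_rising _ _ x (INR k + 1) (2 * lam k) 1 (stepK L * lam k) 3).
    + intros i _. unfold chTC. rewrite Cmod_R, Rmult_1_l. now apply chT_mid.
    + intros j _. eapply Rle_trans; [now apply HE|].
      apply Rmult_le_compat.
      * apply Rmult_le_pos; [apply Rmult_le_pos; lra | apply pow_le; lra].
      * apply rising_ge_0. nra.
      * apply Rmult_le_compat_l; [apply Rmult_le_pos; lra | apply pow_incr; lra].
      * apply rising_le. nra.
  - right. unfold lam. replace (INR k + 1 + 2 * (8 * (INR k + 1))) with (17 * (INR k + 1)) by ring. ring.
Qed.

(** The Gaussian exponent lam x^2 is spent as follows: one half on (1 + 2|x|)^k, by |x| <= 2 x^2,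
    and one quarter on reducing (V)_n to n!. The bound left is uniform in x. *)
Lemma term_far (E : R -> nat -> R -> C) k n x : / 2 <= Rabs x ->
  (forall l m, 1 <= l -> Cmod (E l m x)
     <= stepK L * l * exp (- (l * (x * x))) * 2 ^ m * rising (l * (1 + x * x)) m) ->
  Cmod (term E k n x) <= Cmod (ccoef k) * (stepK L * lam k * 96 ^ n * INR (fact n)).
Proof.
  intros Hx HE. unfold term, cmultT. rewrite Cmod_mult.
  apply Rmult_le_compat_l; [apply Cmod_ge_0|].
  assert (Hl := lam_ge_1 k). assert (kk := pos_INR k).
  assert (K0 : 0 < stepK L) by exact (stepK_pos L L0).
  assert (X : x * x = Rabs x * Rabs x) by (rewrite <- Rabs_mult, Rabs_pos_eq; nra).
  set (y := Rabs x) in *.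
  assert (Y : / 4 <= x * x) by (rewrite X; nra).
  assert (lx : 0 <= lam k * (x * x)) by (apply Rmult_le_pos; lra).
  set (V := INR k + 1 + lam k * (1 + x * x)).
  assert (V0 : 0 <= V <= 6 * (lam k * (x * x))).
  { unfold V. split; [nra|].
    assert (lam k * / 4 <= lam k * (x * x)) by (apply Rmult_le_compat_l; lra). unfold lam in *. lra. }
  assert (Q : (1 + 2 * y) ^ k <= exp (lam k * (x * x) / 2)).
  { apply Rle_trans with (exp (2 * y) ^ k).
    - apply pow_incr. split; [lra|]. apply exp_ineq1_le.
    - rewrite <- exp_mul_INR. apply exp_le. unfold lam. rewrite X.
      assert (INR k * y <= INR k * (2 * (y * y))) by (apply Rmult_le_compat_l; nra).
      assert (0 <= y * y) by nra. lra. }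
  eapply Rle_trans.
  - apply (prodT_rising _ _ x (INR k + 1) (lam k * (1 + x * x)) ((1 + 2 * y) ^ k)
      (stepK L * lam k * exp (- (lam k * (x * x)))) 2).
    + intros i _. unfold chTC. rewrite Cmod_R. eapply Rle_trans; [apply chT_global|].
      fold y. right. ring.
    + intros j _. now apply HE.
  - fold V.
    (* As V <= 6 lam x^2, the choice 1/24 costs exp(lam x^2 / 4). The rate is 24 exp(1/24) <= 48,
       and 96 = 2 * 48. *)
    assert (R := rising_exp V (/ 24) n (proj1 V0) ltac:(lra)).
    assert (E24 : exp (/ 24) <= 2).
    { apply Rle_trans with (exp (/ 2)); [apply exp_le; lra | apply exp_half_le_2]. }
    assert (R2 : rising V n <= 48 ^ n * INR (fact n) * exp (lam k * (x * x) / 4)).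
    { eapply Rle_trans; [exact R|]. assert (0 < exp (/ 24)) by apply exp_pos.
      apply Rmult_le_compat.
      - apply Rmult_le_pos; [|apply pos_INR]. apply pow_le. apply Rdiv_le_0_compat; lra.
      - left; apply exp_pos.
      - apply Rmult_le_compat_r; [apply pos_INR|]. apply pow_incr. split; [apply Rdiv_le_0_compat; lra | lra].
      - apply exp_le. lra. }
    assert (P2 : 0 < 2 ^ n) by (apply pow_lt; lra).
    assert (e0 := exp_pos (- (lam k * (x * x)))).
    assert (c0 : 0 < stepK L * lam k) by (apply Rmult_lt_0_compat; lra).
    assert (F0 : 0 <= 48 ^ n * INR (fact n)) by (apply Rmult_le_pos; [apply pow_le; lra | apply pos_INR]).
    apply Rle_trans with (stepK L * lam k * 2 ^ n * (48 ^ n * INR (fact n)) *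
      (exp (lam k * (x * x) / 2) * exp (- (lam k * (x * x))) * exp (lam k * (x * x) / 4))).
    + replace (stepK L * lam k * 2 ^ n * (48 ^ n * INR (fact n)) *
        (exp (lam k * (x * x) / 2) * exp (- (lam k * (x * x))) * exp (lam k * (x * x) / 4)))
        with (exp (lam k * (x * x) / 2) * (stepK L * lam k * exp (- (lam k * (x * x)))) * 2 ^ n *
          (48 ^ n * INR (fact n) * exp (lam k * (x * x) / 4))) by ring.
      apply Rmult_le_compat; auto.
      * apply Rmult_le_pos; [apply Rmult_le_pos|]; [apply pow_le; lra | nra | lra].
      * apply rising_ge_0, V0.
      * apply Rmult_le_compat_r; [lra|]. apply Rmult_le_compat_r; [nra | exact Q].
    + rewrite <- !exp_plus.
      replace 96 with (2 * 48) by ring. rewrite (Rpow_mult_distr 2 48).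
      replace (stepK L * lam k * (2 ^ n * 48 ^ n) * INR (fact n))
        with (stepK L * lam k * 2 ^ n * (48 ^ n * INR (fact n)) * 1) by ring.
      apply Rmult_le_compat_l.
      * apply Rmult_le_pos; auto. apply Rmult_le_pos; lra.
      * rewrite <- exp_0. apply exp_le. lra.
Qed.

Lemma term_bounds : exists K A, 0 < K /\ 0 < A /\ forall E k n x,
  (Rabs x <= / 2 ->
   (forall l m y, 1 <= l -> Cmod (E l m y) <= stepK L * l * 2 ^ m * rising (l * (1 + y * y)) m) ->
   Cmod (term E k n x) <= K * A ^ n * M n * inv_sq k) /\
  (/ 2 <= Rabs x ->
   (forall l m, 1 <= l -> Cmod (E l m x)
     <= stepK L * l * exp (- (l * (x * x))) * 2 ^ m * rising (l * (1 + x * x)) m) ->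
   Cmod (term E k n x) <= K * A ^ n * INR (fact n) * inv_sq k).
Proof.
  destruct ccoef_decay as (K & A & HK & HA & G).
  destruct (weight_fact_le M Mpos Mreg) as (k0 & c & Hk0 & Hc & Hf).
  assert (K0 : 0 < stepK L) by exact (stepK_pos L L0).
  assert (M0 := Mpos O).
  set (H := 8 * stepK L * K).
  assert (H0 : 0 < H) by (unfold H; repeat apply Rmult_lt_0_compat; lra).
  set (W := H + H * M O * k0 + H * M O).
  assert (HM : 0 < H * M O) by now apply Rmult_lt_0_compat.
  assert (HMk : 0 < H * M O * k0) by now apply Rmult_lt_0_compat.
  (* 102 = 3 * 2 * 17 and 18 = 3 * 2 * 3 are the rates of the two summands of [rising_mid_le]
     inserted in [term_mid]; 96 is the rate of [term_far]. *)
  exists W, (102 * A + 18 * c + 96). split; [unfold W; lra|]. split; [lra|].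
  intros E k n x. assert (kk := pos_INR k).
  assert (G0 : Cmod (ccoef k) * (stepK L * lam k) <= H * M O * inv_sq k).
  { specialize (G k O). simpl in G. unfold lam, H.
    replace (Cmod (ccoef k) * (stepK L * (8 * (INR k + 1)))) with (8 * stepK L * (Cmod (ccoef k) * ((INR k + 1) * 1))) by ring.
    replace (8 * stepK L * K * M O * inv_sq k) with (8 * stepK L * (K * 1 * M O * inv_sq k)) by ring.
    apply Rmult_le_compat_l; lra. }
  assert (Gn : Cmod (ccoef k) * (stepK L * lam k) * (INR k + 1) ^ n <= H * A ^ n * M n * inv_sq k).
  { specialize (G k n). simpl in G. unfold lam, H.
    replace (Cmod (ccoef k) * (stepK L * (8 * (INR k + 1))) * (INR k + 1) ^ n)
      with (8 * stepK L * (Cmod (ccoef k) * ((INR k + 1) * (INR k + 1) ^ n))) by ring.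
    replace (8 * stepK L * K * A ^ n * M n * inv_sq k) with (8 * stepK L * (K * A ^ n * M n * inv_sq k)) by ring.
    apply Rmult_le_compat_l; lra. }
  assert (I := inv_sq_pos k). assert (Mn := Mpos n). assert (Fn := pos_INR (fact n)).
  set (T := 102 * A + 18 * c + 96).
  assert (T1 : (102 * A) ^ n <= T ^ n) by (apply pow_incr; unfold T; lra).
  assert (T2 : (18 * c) ^ n <= T ^ n) by (apply pow_incr; unfold T; lra).
  assert (T3 : 96 ^ n <= T ^ n) by (apply pow_incr; unfold T; lra).
  assert (Z1 : 0 <= (102 * A) ^ n) by (apply pow_le; lra).
  assert (Z2 : 0 <= (18 * c) ^ n) by (apply pow_le; lra).
  assert (Z3 : 0 <= 96 ^ n) by (apply pow_le; lra).
  split.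
  - intros Hx HE. eapply Rle_trans; [now apply term_mid|].
    apply Rle_trans with (Cmod (ccoef k) * (stepK L * lam k * 3 ^ n *
       (2 ^ n * ((17 * (INR k + 1)) ^ n + INR (fact n) * 3 ^ n)))).
    { apply Rmult_le_compat_l; [apply Cmod_ge_0|]. apply Rmult_le_compat_l.
      - apply Rmult_le_pos; [apply Rmult_le_pos; [lra | generalize (lam_ge_1 k); lra] | apply pow_le; lra].
      - apply rising_mid_le. lra. }
    replace (Cmod (ccoef k) * (stepK L * lam k * 3 ^ n * (2 ^ n * ((17 * (INR k + 1)) ^ n + INR (fact n) * 3 ^ n))))
      with (102 ^ n * (Cmod (ccoef k) * (stepK L * lam k) * (INR k + 1) ^ n)
            + 18 ^ n * INR (fact n) * (Cmod (ccoef k) * (stepK L * lam k))).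
    2:{ replace 102 with (3 * 2 * 17) by ring. replace 18 with (3 * 2 * 3) by ring. rewrite !Rpow_mult_distr. ring. }
    apply Rle_trans with (102 ^ n * (H * A ^ n * M n * inv_sq k) + 18 ^ n * (k0 * c ^ n * M n) * (H * M O * inv_sq k)).
    + apply Rplus_le_compat.
      * apply Rmult_le_compat_l; [apply pow_le; lra | exact Gn].
      * apply Rmult_le_compat; auto.
        -- apply Rmult_le_pos; [apply pow_le; lra | auto].
        -- apply Rmult_le_pos; [apply Cmod_ge_0|]. apply Rmult_le_pos; [lra | generalize (lam_ge_1 k); lra].
        -- apply Rmult_le_compat_l; [apply pow_le; lra | apply Hf].
    + replace (102 ^ n * (H * A ^ n * M n * inv_sq k) + 18 ^ n * (k0 * c ^ n * M n) * (H * M O * inv_sq k))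
        with ((H * (102 * A) ^ n + H * M O * k0 * (18 * c) ^ n) * (M n * inv_sq k))
        by (rewrite !Rpow_mult_distr; ring).
      replace (W * T ^ n * M n * inv_sq k) with (W * T ^ n * (M n * inv_sq k)) by ring.
      apply Rmult_le_compat_r; [apply Rmult_le_pos; lra|].
      unfold W. rewrite !Rmult_plus_distr_r.
      assert (H * (102 * A) ^ n <= H * T ^ n) by (apply Rmult_le_compat_l; lra).
      assert (H * M O * k0 * (18 * c) ^ n <= H * M O * k0 * T ^ n) by (apply Rmult_le_compat_l; lra).
      assert (0 <= H * M O * T ^ n) by (apply Rmult_le_pos; lra). lra.
  - intros Hx HE. eapply Rle_trans; [now apply term_far|].
    replace (Cmod (ccoef k) * (stepK L * lam k * 96 ^ n * INR (fact n)))
      with (96 ^ n * INR (fact n) * (Cmod (ccoef k) * (stepK L * lam k))) by ring.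
    apply Rle_trans with (96 ^ n * INR (fact n) * (H * M O * inv_sq k)).
    + apply Rmult_le_compat_l; [apply Rmult_le_pos; lra | exact G0].
    + replace (96 ^ n * INR (fact n) * (H * M O * inv_sq k)) with (H * M O * 96 ^ n * (INR (fact n) * inv_sq k)) by ring.
      replace (W * T ^ n * INR (fact n) * inv_sq k) with (W * T ^ n * (INR (fact n) * inv_sq k)) by ring.
      apply Rmult_le_compat_r; [apply Rmult_le_pos; lra|].
      apply Rmult_le_compat; try lra. unfold W. lra.
Qed.

Lemma term_split k x : (term (stepT L) k O x + term (costepT L) k O x)%C = (ccoef k * chTC k O x)%C.
Proof.
  unfold term, cmultT. cbn [prodT]. rewrite (step_costep L L0). ring.
Qed.

Lemma ccoef_expansion x : -1 <= x <= 1 -> CSum (fun k => ccoef k * chTC k O x)%C = F O x.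
Proof.
  intros Hx. unfold CSum.
  assert (E1 := cheb_expansion (fun t => Re (F O t)) (fun t => Re (F 1%nat t)) x (Re_tower O) Hx).
  assert (E2 := cheb_expansion (fun t => Im (F O t)) (fun t => Im (F 1%nat t)) x (Im_tower O) Hx).
  rewrite (Series_ext _ (fun k => cheb_coef' (fun t => Re (F O t)) k * chT k 0 x)).
  2:{ intros k. unfold ccoef, chTC, Re, Im. simpl. ring. }
  rewrite (Series_ext (fun k => Im _) (fun k => cheb_coef' (fun t => Im (F O t)) k * chT k 0 x)).
  2:{ intros k. unfold ccoef, chTC, Re, Im. simpl. ring. }
  rewrite (is_series_unique _ _ E1), (is_series_unique _ _ E2). now destruct (F O x).
Qed.

Definition half_sum_spec (P Far : R -> Prop) (S : nat -> R -> C) : Prop :=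
  tower P S /\ wbound nfact Far S /\ wbound M P S.

(** [P] is the open half-line on which the sum lies in the class, [Far] its part beyond the middle
    interval, where the Gaussian makes the sum analytic. Stated once for [stepT] and its mirror
    image [costepT]. *)
Lemma half_sum (E : R -> nat -> R -> C) (P Far : R -> Prop) :
  (forall x, P x -> locally x P) ->
  (forall x, P x -> Rabs x <= / 2 \/ Far x) ->
  (forall x, Far x -> / 2 <= Rabs x) ->
  (forall l, 0 <= l -> tower (fun _ => True) (E l)) ->
  (forall l m y, 1 <= l -> Cmod (E l m y) <= stepK L * l * 2 ^ m * rising (l * (1 + y * y)) m) ->
  (forall l m x, Far x -> 1 <= l -> Cmod (E l m x)
     <= stepK L * l * exp (- (l * (x * x))) * 2 ^ m * rising (l * (1 + x * x)) m) ->
  half_sum_spec P Far (CSumT (term E)) /\ forall x, P x -> csummable (fun k => term E k O x).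
Proof.
  intros OP HP HFar TE GE FE.
  destruct term_bounds as (K & A & HK & HA & B).
  destruct (weight_fact_le M Mpos Mreg) as (k0 & c & Hk0 & Hc & Hf).
  assert (Sp : 0 <= Series inv_sq).
  { eapply Rle_trans; [apply Rabs_pos|]. apply (Series_Rabs_le inv_sq); [|apply ex_series_inv_sq].
    intros k. rewrite Rabs_pos_eq; [lra | left; apply inv_sq_pos]. }
  assert (BF' : forall n x, Far x -> forall k, Cmod (term E k n x) <= K * A ^ n * INR (fact n) * inv_sq k).
  { intros n x Hx k. apply (proj2 (B E k n x)); auto. }
  set (T := A * c + A).
  set (K1 := K * k0 + K).
  assert (BP : forall n x, P x -> forall k, Cmod (term E k n x) <= K1 * T ^ n * M n * inv_sq k).
  { intros n x Hx k.
    assert (I := inv_sq_pos k). assert (Mn := Mpos n). assert (Fn := pos_INR (fact n)).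
    assert (0 < K * k0) by now apply Rmult_lt_0_compat.
    assert (0 < A * c) by (apply Rmult_lt_0_compat; lra).
    assert (T1 : A ^ n <= T ^ n) by (apply pow_incr; unfold T; lra).
    assert (T2 : (A * c) ^ n <= T ^ n) by (apply pow_incr; unfold T; lra).
    assert (0 <= A ^ n) by (apply pow_le; lra).
    assert (0 <= (A * c) ^ n) by (apply pow_le; lra).
    destruct (HP x Hx) as [C|C].
    - eapply Rle_trans; [apply (proj1 (B E k n x)); auto|].
      apply Rmult_le_compat_r; [lra|]. apply Rmult_le_compat_r; [lra|].
      apply Rmult_le_compat; unfold K1; lra.
    - eapply Rle_trans; [now apply (BF' n x)|].
      apply Rmult_le_compat_r; [lra|].
      apply Rle_trans with (K * A ^ n * (k0 * c ^ n * M n)).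
      + apply Rmult_le_compat_l; [apply Rmult_le_pos; lra | apply Hf].
      + replace (K * A ^ n * (k0 * c ^ n * M n)) with (K * k0 * (A * c) ^ n * M n)
          by (rewrite Rpow_mult_distr; ring).
        apply Rmult_le_compat_r; [lra|]. apply Rmult_le_compat; unfold K1; lra. }
  assert (ES : forall a, ex_series (fun k => a * inv_sq k)).
  { intros a. apply (ex_series_scal_l (V := R_NormedModule) a), ex_series_inv_sq. }
  split; [split; [|split]|].
  - apply (tower_CSumT P (term E) (fun n k => K1 * T ^ n * M n * inv_sq k)); auto.
    intros k. apply tower_cmultT, tower_prodT; [apply tower_chTC|].
    apply (tower_sub (fun _ => True)); [auto|]. apply TE. generalize (lam_ge_1 k). lra.
  - exists (2 * K * (Series inv_sq + 1)), A.
    assert (0 < 2 * K * (Series inv_sq + 1)) by (apply Rmult_lt_0_compat; lra).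
    repeat split; auto.
    intros n x Hx. unfold CSumT, nfact.
    eapply Rle_trans; [apply (CSum_bound _ (fun k => K * A ^ n * INR (fact n) * inv_sq k)); auto|].
    rewrite Series_scal_l.
    replace (2 * K * (Series inv_sq + 1) * A ^ n * INR (fact n))
      with (2 * (K * A ^ n * INR (fact n) * (Series inv_sq + 1))) by ring.
    apply Rmult_le_compat_l; [lra|]. apply Rmult_le_compat_l; [|lra].
    apply Rmult_le_pos; [apply Rmult_le_pos; [lra | apply pow_le; lra] | apply pos_INR].
  - assert (0 < K1) by (unfold K1; assert (0 < K * k0) by (now apply Rmult_lt_0_compat); lra).
    assert (0 < T) by (unfold T; assert (0 < A * c) by (apply Rmult_lt_0_compat; lra); lra).
    exists (2 * K1 * (Series inv_sq + 1)), T.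
    assert (0 < 2 * K1 * (Series inv_sq + 1)) by (apply Rmult_lt_0_compat; lra).
    repeat split; auto.
    intros n x Hx. unfold CSumT.
    eapply Rle_trans; [apply (CSum_bound _ (fun k => K1 * T ^ n * M n * inv_sq k)); auto|].
    rewrite Series_scal_l.
    replace (2 * K1 * (Series inv_sq + 1) * T ^ n * M n)
      with (2 * (K1 * T ^ n * M n * (Series inv_sq + 1))) by ring.
    apply Rmult_le_compat_l; [lra|]. apply Rmult_le_compat_l; [|lra].
    apply Rmult_le_pos; [apply Rmult_le_pos; [lra | apply pow_le; lra] | left; apply Mpos].
  - intros x Hx. apply (csummable_le _ (fun k => K1 * T ^ O * M O * inv_sq k)); auto.
Qed.

(** The left sum exists for x < 1/2 and the right sum for x > -1/2, each failing to converge a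
    priori on the other side. On the overlap they add up to F, so F minus the right sum continues
    the left one to the whole line. *)
Lemma decomposition_aux : exists P N, tower (fun _ => True) P /\ tower (fun _ => True) N /\
  (forall x, F O x = P O x + N O x)%C /\
  wbound nfact (fun x => x <= - / 2) P /\ wbound nfact (fun x => / 2 <= x) N /\
  (forall c d, wbound M (fun x => c <= x <= d) P) /\
  (forall c d, wbound M (fun x => c <= x <= d) N).
Proof.
  assert (M0 : forall n, 0 <= M n) by (intros; left; auto).
  set (Lf := CSumT (term (stepT L))). set (Rt := CSumT (term (costepT L))).
  assert (HL : half_sum_spec (fun x => x < / 2) (fun x => x <= - / 2) Lf /\
     forall x, x < / 2 -> csummable (fun k => term (stepT L) k O x)).
  { apply (half_sum (stepT L)).
    - intros x. apply locally_lt.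
    - intros x Hx. destruct (Rle_dec x (- / 2)); [right; auto | left; apply Rabs_le; lra].
    - intros x Hx. rewrite Rabs_left1; lra.
    - intros l Hl. now apply tower_stepT.
    - intros l m y Hl. now apply step_global.
    - intros l m x Hx Hl. now apply step_left. }
  assert (HR : half_sum_spec (fun x => - / 2 < x) (fun x => / 2 <= x) Rt /\
     forall x, - / 2 < x -> csummable (fun k => term (costepT L) k O x)).
  { apply (half_sum (costepT L)).
    - intros x. apply locally_gt.
    - intros x Hx. destruct (Rle_dec (/ 2) x); [right; auto | left; apply Rabs_le; lra].
    - intros x Hx. rewrite Rabs_right; lra.
    - intros l Hl. now apply tower_costepT.
    - intros l m y Hl. now apply step_global.
    - intros l m x Hx Hl. now apply costep_right. }
  destruct HL as [(TL & AL & WL) SL]. destruct HR as [(TR & AR & WR) SR].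
  assert (TFR : tower (fun x => - / 2 < x) (minusT F Rt)).
  { apply tower_minusT; auto. apply (tower_sub (fun _ => True)); auto. }
  (* Only order 0 uses the Chebyshev expansion; the derivatives follow by [tower_eq]. *)
  assert (EQ : forall n x, - / 2 < x < / 2 -> Lf n x = minusT F Rt n x).
  { apply tower_eq.
    - intros x [H1 H2]. generalize (filter_and _ _ (locally_gt _ _ H1) (locally_lt _ _ H2)).
      apply filter_imp. auto.
    - apply (tower_sub (fun x => x < / 2)); auto. intros; lra.
    - apply (tower_sub (fun x => - / 2 < x)); auto. intros; lra.
    - intros x Hx. unfold minusT. rewrite <- (ccoef_expansion x) by lra.
      rewrite (CSum_ext (fun k => ccoef k * chTC k O x)%C
        (fun k => term (stepT L) k O x + term (costepT L) k O x)%C).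
      2:{ intros k. now rewrite term_split. }
      rewrite CSum_plus; [|apply SL; lra | apply SR; lra].
      unfold Lf, Rt, CSumT. ring. }
  set (P := fun n x => if Rlt_dec x 0 then Lf n x else minusT F Rt n x).
  assert (PL : forall n x, x < / 2 -> P n x = Lf n x).
  { intros n x Hx. unfold P. destruct (Rlt_dec x 0); [reflexivity|]. symmetry. apply EQ. lra. }
  assert (PR : forall n x, - / 2 < x -> P n x = minusT F Rt n x).
  { intros n x Hx. unfold P. destruct (Rlt_dec x 0); [|reflexivity]. apply EQ. lra. }
  assert (TP : tower (fun _ => True) P).
  { intros n x _. destruct (Rlt_dec x (/ 2)) as [Hx|Hx].
    - rewrite PL by auto. apply (dC_ext_loc (Lf n)); [|now apply TL].
      generalize (locally_lt _ _ Hx). apply filter_imp. intros; now rewrite PL.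
    - assert (Hx' : - / 2 < x) by lra.
      rewrite PR by auto. apply (dC_ext_loc (minusT F Rt n)); [|now apply TFR].
      generalize (locally_gt _ _ Hx'). apply filter_imp. intros; now rewrite PR. }
  assert (WP : forall c d, wbound M (fun x => c <= x <= d) P).
  { intros c d.
    apply (wbound_sub M (fun x => x < / 2 \/ (- / 2 < x /\ c <= x <= d))).
    { intros x Hx. destruct (Rlt_dec x (/ 2)); [left; auto | right; lra]. }
    apply wbound_or; auto.
    - apply (wbound_ext M _ Lf); auto. intros; now rewrite PL.
    - apply (wbound_ext M _ (minusT F Rt)); [intros; rewrite PR; tauto|].
      apply wbound_minusT; auto.
      + apply (wbound_sub M (fun x => c <= x <= d)); auto. tauto.
      + apply (wbound_sub M (fun x => - / 2 < x)); auto. tauto. }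
  exists P, (minusT F P).
  split; [exact TP|]. split; [now apply tower_minusT|]. split; [|split; [|split; [|split]]]; auto.
  - intros x. unfold minusT. ring.
  - apply (wbound_ext nfact _ Lf); auto. intros n x Hx. rewrite PL; [reflexivity | lra].
  - apply (wbound_ext nfact _ Rt); auto. intros n x Hx. unfold minusT at 1.
    rewrite PR by lra. unfold minusT. ring.
  - intros c d. apply wbound_minusT; auto.
Qed.

End Decomposition.

Theorem decomposition (M : nat -> R) (F : nat -> R -> C) : (forall n, 0 < M n) -> regular M ->
  tower (fun _ => True) F -> (forall c d, wbound M (fun x => c <= x <= d) F) ->
  exists P N, tower (fun _ => True) P /\ tower (fun _ => True) N /\
  (forall x, F O x = P O x + N O x)%C /\
  wbound nfact (fun x => x <= - / 2) P /\ wbound nfact (fun x => / 2 <= x) N /\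
  (forall c d, wbound M (fun x => c <= x <= d) P) /\
  (forall c d, wbound M (fun x => c <= x <= d) N).
Proof.
  intros HM HR TF BF. destruct gauss_int_limit as (L & L0 & L1 & L2).
  now apply (decomposition_aux M HM HR F TF BF L L0 L1 L2).
Qed.

(** * Solution of the equation *)

Lemma exp_ge_arg x : x <= exp x.
Proof. generalize (exp_ineq1_le x). lra. Qed.

Lemma prodT_fact D E x kA kB s t n : 0 < s -> 0 < t ->
  (forall i, Cmod (D i x) <= kA * s ^ i * INR (fact i)) ->
  (forall i, Cmod (E i x) <= kB * t ^ i * INR (fact i)) ->
  Cmod (prodT D E n x) <= kA * kB * (2 * (s + t)) ^ n * INR (fact n).
Proof.
  intros Hs Ht HD HE.
  assert (kA0 : 0 <= kA).
  { specialize (HD O). simpl in HD. generalize (Cmod_ge_0 (D O x)). lra. }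
  assert (kB0 : 0 <= kB).
  { specialize (HE O). simpl in HE. generalize (Cmod_ge_0 (E O x)). lra. }
  eapply Rle_trans.
  - apply (prodT_rising D E x 1 1 kA kB (s + t)); intros i _; rewrite rising_1.
    + eapply Rle_trans; [apply HD|]. apply Rmult_le_compat_r; [apply pos_INR|].
      apply Rmult_le_compat_l; [auto|]. apply pow_incr; lra.
    + eapply Rle_trans; [apply HE|]. apply Rmult_le_compat_r; [apply pos_INR|].
      apply Rmult_le_compat_l; [auto|]. apply pow_incr; lra.
  - rewrite Rpow_mult_distr.
    replace (kA * kB * (2 ^ n * (s + t) ^ n) * INR (fact n)) with
      (kA * kB * (s + t) ^ n * (2 ^ n * INR (fact n))) by ring.
    apply Rmult_le_compat_l; [|apply rising_2].
    apply Rmult_le_pos; [now apply Rmult_le_pos | apply pow_le; lra].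
Qed.

(** * Right-hand sides decaying at minus infinity *)

Section Forward.

Variables (M : nat -> R) (N : nat) (b : nat -> nat -> R -> C) (c : nat -> R -> C)
  (s : nat -> R) (sigma B K1 K rho kappa : R).
Hypothesis Mpos : forall n, 0 < M n.
Hypothesis Mreg : regular M.
Hypothesis Hsigma : 0 < sigma.
Hypothesis Hs : forall j, (j < N)%nat -> sigma <= s j.
Hypothesis HB : 0 < B.
Hypothesis HK1 : 0 < K1.
Hypothesis HK : 0 < K.
Hypothesis Hrho : 0 < rho.
Hypothesis Tb : forall j, (j < N)%nat -> tower (fun _ => True) (b j).
Hypothesis Tc : tower (fun _ => True) c.
Hypothesis Bb : forall j n x, (j < N)%nat ->
  Cmod (b j n x) <= B * exp (K1 * exp (K * Rabs x)) * rho ^ n * INR (fact n).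
Hypothesis Bc : forall n x, Cmod (c n x) <= B * exp (K1 * exp (K * Rabs x)) * rho ^ n * INR (fact n).
Hypothesis Hkappa1 : K + 1 <= kappa.
Hypothesis Hkappa2 : 2 <= kappa * sigma.

Lemma local_bound D :
  (forall n x, Cmod (D n x) <= B * exp (K1 * exp (K * Rabs x)) * rho ^ n * INR (fact n)) ->
  forall u v, wbound nfact (fun x => u <= x <= v) D.
Proof.
  intros H u v. exists (B * exp (K1 * exp (K * (Rabs u + Rabs v)))), rho.
  split; [|split]; auto.
  - apply Rmult_lt_0_compat; [auto | apply exp_pos].
  - intros n x Hx. eapply Rle_trans; [apply H|]. unfold nfact.
    apply Rmult_le_compat_r; [apply pos_INR|]. apply Rmult_le_compat_r; [apply pow_le; lra|].
    apply Rmult_le_compat_l; [lra|]. apply exp_le. apply Rmult_le_compat_l; [lra|].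
    apply exp_le. apply Rmult_le_compat_l; [lra|].
    unfold Rabs. destruct (Rcase_abs x), (Rcase_abs u), (Rcase_abs v); lra.
Qed.

Variable chi : nat -> R -> C.
Hypothesis Tchi : tower (fun _ => True) chi.
Hypothesis Bchi : forall u v, wbound M (fun x => u <= x <= v) chi.
Variables (G r : R).
Hypothesis HG : 0 < G.
Hypothesis Hr : 0 < r.
Hypothesis Fchi : forall n x, x <= - / 2 ->
  Cmod (chi n x) <= G * exp (- 2 * exp (kappa * Rabs x)) * r ^ n * INR (fact n).

(** Beyond X the single exponential exp|x| already exceeds [K1] and 4 N B; the 1 puts x < -X inside
    the region x <= -1/2 of [Fchi]. *)
Let X : R := K1 + 4 * (INR N * B) + 1.

Lemma far_growth x : x < - X -> K1 * exp (K * Rabs x) <= exp (kappa * Rabs x) /\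
  4 * (INR N * B) <= exp (kappa * Rabs x).
Proof.
  intros Hx.
  assert (N0 : 0 <= INR N * B) by (apply Rmult_le_pos; [apply pos_INR | lra]).
  assert (Ax : X <= Rabs x) by (unfold X in *; rewrite Rabs_left; lra).
  assert (A0 : 0 <= Rabs x) by apply Rabs_pos.
  assert (E0 := exp_ge_arg (Rabs x)).
  split.
  - apply Rle_trans with (exp (Rabs x) * exp (K * Rabs x)).
    + apply Rmult_le_compat_r; [left; apply exp_pos|]. unfold X in *. lra.
    + rewrite <- exp_plus. apply exp_le. nra.
  - apply Rle_trans with (exp (Rabs x)); [unfold X in *; lra|]. apply exp_le. nra.
Qed.

Lemma forward : exists Phi, tower (fun _ => True) Phi /\
  (forall u v, wbound M (fun x => u <= x <= v) Phi) /\
  forall x, Phi O x = (c O x * chi O x - Uop b s N Phi O x)%C.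
Proof.
  set (g := prodT c chi).
  assert (Tg : tower (fun _ => True) g) by now apply tower_prodT.
  assert (Bg : forall u v, wbound M (fun x => u <= x <= v) g).
  { intros u v. apply wbound_prodT; auto. now apply local_bound. }
  (* Of the two units of decay in [Fchi], one pays for the growth of [c]; the other remains as
     [omega]. *)
  set (omega := fun x => exp (- exp (kappa * Rabs x))).
  set (beta := fun x => B * exp (K1 * exp (K * Rabs x))).
  set (R0 := 2 * (rho + r) + rho).
  assert (HR0 : 0 < R0) by (unfold R0; lra).
  destruct (Neumann N b s g sigma Hsigma Hs Tb Tg omega beta X (B * G) R0) as (psi & T1 & T2 & T3); auto.
  - now apply Rmult_lt_0_compat.
  - intros x. unfold omega. split; [left; apply exp_pos|]. rewrite <- exp_0. apply exp_le.
    generalize (exp_pos (kappa * Rabs x)). lra.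
  - intros j n x Hj Hx. eapply Rle_trans; [now apply Bb|]. unfold beta.
    apply Rmult_le_compat_r; [apply pos_INR|]. apply Rmult_le_compat_l.
    + apply Rmult_le_pos; [lra | left; apply exp_pos].
    + apply pow_incr. unfold R0. lra.
  - intros j x Hj Hx. destruct (far_growth x Hx) as [F1 F2].
    assert (Hsj := Hs j Hj).
    assert (N0 : 0 <= INR N * B) by (apply Rmult_le_pos; [apply pos_INR | lra]).
    assert (x0 : x < 0) by (unfold X in Hx; lra).
    set (y := exp (kappa * Rabs x)) in *.
    assert (Y0 : 0 < y) by apply exp_pos.
    (* A shift by at least [sigma] multiplies the inner exponential by exp(kappa sigma) >= 3. One
       exp(-y) cancels the coefficient, one is [omega x], and the third supplies the factor 1/4. *)
    assert (W : omega (x - s j) <= exp (- 3 * y)).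
    { unfold omega. apply exp_le.
      assert (3 * y <= exp (kappa * Rabs (x - s j))); [|lra].
      rewrite (Rabs_left (x - s j)) by lra.
      apply Rle_trans with (exp (kappa * sigma) * y).
      - apply Rmult_le_compat_r; [lra|]. generalize (exp_ineq1_le (kappa * sigma)). lra.
      - unfold y. rewrite <- exp_plus. apply exp_le. rewrite (Rabs_left x) by lra.
        rewrite <- Rmult_plus_distr_l. apply Rmult_le_compat_l; lra. }
    assert (Q : INR N * B * exp (- y) <= / 4).
    { rewrite exp_Ropp. apply Rle_div_l; [apply Rlt_gt, exp_pos|].
      generalize (exp_ge_arg y). lra. }
    unfold beta.
    apply Rle_trans with (INR N * (B * exp y * exp (- 3 * y))).
    + apply Rmult_le_compat_l; [apply pos_INR|]. apply Rmult_le_compat; auto.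
      * apply Rmult_le_pos; [lra | left; apply exp_pos].
      * left; apply exp_pos.
      * apply Rmult_le_compat_l; [lra|]. now apply exp_le.
    + replace (INR N * (B * exp y * exp (- 3 * y))) with (INR N * B * exp (- y) * omega x).
      * unfold Rdiv. rewrite Rmult_comm. apply Rmult_le_compat_l; [left; apply exp_pos | exact Q].
      * unfold omega. fold y.
        replace (exp (- 3 * y)) with (exp (- y) * exp (- y) * exp (- y)).
        -- rewrite exp_Ropp. field. apply Rgt_not_eq, exp_pos.
        -- rewrite <- !exp_plus. f_equal. ring.
  - intros n x Hx. destruct (far_growth x Hx) as [F1 F2].
    assert (N0 : 0 <= INR N * B) by (apply Rmult_le_pos; [apply pos_INR | lra]).
    eapply Rle_trans.
    + apply (prodT_fact c chi x (B * exp (K1 * exp (K * Rabs x)))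
        (G * exp (- 2 * exp (kappa * Rabs x))) rho r); auto.
      intros i. apply Fchi. unfold X in Hx. lra.
    + apply Rmult_le_compat_r; [apply pos_INR|].
      apply Rmult_le_compat.
      * apply Rmult_le_pos; apply Rmult_le_pos; try lra; left; apply exp_pos.
      * apply pow_le; lra.
      * replace (B * exp (K1 * exp (K * Rabs x)) * (G * exp (- 2 * exp (kappa * Rabs x))))
          with (B * G * (exp (K1 * exp (K * Rabs x)) * exp (- 2 * exp (kappa * Rabs x)))) by ring.
        apply Rmult_le_compat_l; [apply Rmult_le_pos; lra|].
        rewrite <- exp_plus. apply exp_le. lra.
      * apply pow_incr. unfold R0. lra.
  - destruct (Extension M Mpos Mreg N b s g sigma Hsigma Hs Tb Tg) with (a := - X) (psi := psi)
      as (Phi & P1 & P2 & P3); auto.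
    + intros j u v Hj. apply local_bound. intros; now apply Bb.
    + apply wbound_analytic; auto.
    + exists Phi. split; [exact P1|]. split; [exact P2 | exact P3].
Qed.

End Forward.

(** * Splitting with double exponential decay *)

Lemma coshk_bounds k x : 0 <= k -> exp (k * Rabs x) / 2 <= coshk k x <= exp (k * Rabs x).
Proof.
  intros Hk. unfold coshk.
  assert (E1 := exp_pos (k * x)). assert (E2 := exp_pos (- (k * x))).
  assert (0 <= k * Rabs x) by (apply Rmult_le_pos; [auto | apply Rabs_pos]).
  assert (exp (k * x) <= exp (k * Rabs x)).
  { apply exp_le, Rmult_le_compat_l; [auto | apply RRle_abs]. }
  assert (exp (- (k * x)) <= exp (k * Rabs x)).
  { apply exp_le. replace (- (k * x)) with (k * - x) by ring.
    apply Rmult_le_compat_l; auto. rewrite <- Rabs_Ropp. apply RRle_abs. }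
  split; [|lra].
  unfold Rabs. destruct (Rcase_abs x); [replace (k * - x) with (- (k * x)) by ring|]; lra.
Qed.

(** The choice eps = 1/10 in [rising_exp] spoils the exponent by only a tenth; 20 bounds 10
    exp(1/10). *)
Lemma expcosh_fact cc k n x : 0 < k ->
  Cmod (expcosh cc k n x) <= exp (cc * coshk k x + Rabs cc * coshk k x / 10) * (20 * k) ^ n * INR (fact n).
Proof.
  intros Hk. eapply Rle_trans; [apply expcosh_bound; lra|].
  assert (c0 := coshk_pos k x).
  assert (V0 : 0 <= Rabs cc * coshk k x) by (apply Rmult_le_pos; [apply Rabs_pos | lra]).
  assert (R := rising_exp (Rabs cc * coshk k x) (/ 10) n V0 ltac:(lra)).
  assert (e2 : exp (/ 10) <= 2).
  { apply Rle_trans with (exp (/ 2)); [apply exp_le; lra | apply exp_half_le_2]. }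
  assert (e0 := exp_pos (/ 10)).
  assert (k0 : 0 <= k ^ n) by (apply pow_le; lra).
  apply Rle_trans with (exp (cc * coshk k x) * k ^ n * (20 ^ n * INR (fact n) * exp (/ 10 * (Rabs cc * coshk k x)))).
  - apply Rmult_le_compat_l; [apply Rmult_le_pos; [left; apply exp_pos | auto]|].
    eapply Rle_trans; [exact R|]. apply Rmult_le_compat_r; [left; apply exp_pos|].
    apply Rmult_le_compat_r; [apply pos_INR|]. apply pow_incr.
    split; [apply Rdiv_le_0_compat; lra | lra].
  - right. rewrite exp_plus, Rpow_mult_distr.
    replace (Rabs cc * coshk k x / 10) with (/ 10 * (Rabs cc * coshk k x)) by field. ring.
Qed.

(** The halves of exp(5 cosh) chi have n! bounds uniform up to infinity, so multiplying back by
    exp(-5 cosh) leaves its full decay. The 5 is chosen since, after the loss of a tenth, 4.5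
    cosh(kappa x) >= 2.25 exp(kappa |x|), above the required 2. *)
Lemma two_sided_split (M : nat -> R) (chi : nat -> R -> C) (kappa : R) :
  (forall n, 0 < M n) -> regular M -> 0 < kappa ->
  tower (fun _ => True) chi -> (forall u v, wbound M (fun x => u <= x <= v) chi) ->
  exists P N, tower (fun _ => True) P /\ tower (fun _ => True) N /\
  (forall x, chi O x = P O x + N O x)%C /\
  (forall u v, wbound M (fun x => u <= x <= v) P) /\
  (forall u v, wbound M (fun x => u <= x <= v) N) /\
  exists G r, 0 < G /\ 0 < r /\
  (forall n x, x <= - / 2 -> Cmod (P n x) <= G * exp (- 2 * exp (kappa * Rabs x)) * r ^ n * INR (fact n)) /\
  (forall n x, / 2 <= x -> Cmod (N n x) <= G * exp (- 2 * exp (kappa * Rabs x)) * r ^ n * INR (fact n)).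
Proof.
  intros Mpos Mreg Hk Tchi Bchi.
  set (W := expcosh (- 5) kappa). set (W' := expcosh 5 kappa).
  assert (WB : forall n x, Cmod (W n x) <= exp (- 2 * exp (kappa * Rabs x)) * (20 * kappa) ^ n * INR (fact n)).
  { intros n x. eapply Rle_trans; [now apply expcosh_fact|].
    apply Rmult_le_compat_r; [apply pos_INR|]. apply Rmult_le_compat_r; [apply pow_le; lra|].
    apply exp_le. rewrite Rabs_left by lra.
    generalize (coshk_bounds kappa x ltac:(lra)) (exp_pos (kappa * Rabs x)). lra. }
  assert (WW : forall u v, wbound nfact (fun x => u <= x <= v) W).
  { intros u v. exists 1, (20 * kappa). repeat split; try lra. intros n x _.
    eapply Rle_trans; [apply WB|]. unfold nfact.
    apply Rmult_le_compat_r; [apply pos_INR|]. apply Rmult_le_compat_r; [apply pow_le; lra|].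
    rewrite <- exp_0. apply exp_le. generalize (exp_pos (kappa * Rabs x)). lra. }
  assert (WW' : forall u v, wbound nfact (fun x => u <= x <= v) W').
  { intros u v. exists (exp (6 * exp (kappa * (Rabs u + Rabs v)))), (20 * kappa).
    split; [apply exp_pos|]. split; [lra|]. intros n x Hx.
    eapply Rle_trans; [now apply expcosh_fact|]. unfold nfact.
    apply Rmult_le_compat_r; [apply pos_INR|]. apply Rmult_le_compat_r; [apply pow_le; lra|].
    apply exp_le. rewrite (Rabs_pos_eq 5) by lra.
    assert (H : exp (kappa * Rabs x) <= exp (kappa * (Rabs u + Rabs v))).
    { apply exp_le. apply Rmult_le_compat_l; [lra|].
      unfold Rabs. destruct (Rcase_abs x), (Rcase_abs u), (Rcase_abs v); lra. }
    generalize (coshk_bounds kappa x ltac:(lra)) (exp_pos (kappa * Rabs x)). lra. }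
  destruct (decomposition M (prodT W' chi)) as (P & N & TP & TN & E & FP & FN & BP & BN); auto.
  { apply tower_prodT; auto. apply tower_expcosh. }
  { intros u v. apply wbound_prodT; auto. }
  exists (prodT W P), (prodT W N).
  split; [apply tower_prodT; auto; apply tower_expcosh|].
  split; [apply tower_prodT; auto; apply tower_expcosh|].
  split.
  { intros x. cbn [prodT] in *. rewrite <- Cmult_plus_distr_l, <- E.
    rewrite Cmult_assoc. unfold W, W', expcosh. unfold expT. cbn [expTab].
    rewrite <- RtoC_mult, <- exp_plus. replace (-5 * coshk kappa x + 5 * coshk kappa x) with 0 by ring.
    rewrite exp_0. ring. }
  split; [intros u v; apply wbound_prodT; auto|].
  split; [intros u v; apply wbound_prodT; auto|].
  destruct FP as (G1 & r1 & HG1 & Hr1 & FP). destruct FN as (G2 & r2 & HG2 & Hr2 & FN).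
  exists (G1 + G2), (2 * (20 * kappa + (r1 + r2))). repeat split; try lra.
  - intros n x Hx. rewrite (Rmult_comm (G1 + G2)).
    apply prodT_fact; try lra; intros i; [apply WB|].
    eapply Rle_trans; [now apply FP|]. apply (wbound_le nfact); auto; apply pos_INR.
  - intros n x Hx. rewrite (Rmult_comm (G1 + G2)).
    apply prodT_fact; try lra; intros i; [apply WB|].
    eapply Rle_trans; [now apply FN|].
    rewrite (Rplus_comm G1), (Rplus_comm r1). apply (wbound_le nfact); auto; apply pos_INR.
Qed.

Ltac as_C := change (@plus C_AbelianMonoid) with Cplus;
  match goal with |- @eq _ ?l ?r => change (@eq C l r) end.

Lemma sum_n_m_reflect (f : nat -> C) q :
  sum_n_m (fun j => f (q + 1 - j)%nat) 1 q = sum_n_m f 1 q.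
Proof.
  induction q as [|q IH].
  - rewrite !sum_n_m_zero by lia. reflexivity.
  - rewrite sum_Sn_m by lia. rewrite <- sum_n_m_S.
    rewrite (sum_n_m_ext_loc _ (fun j => f (q + 1 - j)%nat)) by (intros; f_equal; lia).
    rewrite IH, (sum_n_Sm f 1 q) by lia. rewrite plus_comm. do 2 f_equal. lia.
Qed.

Lemma sum_n_m_term_le (f : nat -> R) p q j : (forall i, 0 <= f i) -> (p <= j <= q)%nat ->
  f j <= sum_n_m f p q.
Proof.
  intros H Hj.
  assert (S0 : forall a b, 0 <= sum_n_m f a b).
  { intros a b. replace 0 with (sum_n_m (fun _ => 0) a b).
    - apply sum_n_m_le. auto.
    - rewrite (sum_n_m_const a b 0). apply Rmult_0_r. }
  rewrite (sum_n_m_Chasles f p j q) by lia.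
  assert (E : f j <= sum_n_m f p j).
  { destruct j as [|j]; [assert (p = O) as -> by lia; rewrite sum_n_n; lra|].
    rewrite sum_n_Sm by lia. unfold plus; simpl. generalize (S0 p j). lra. }
  unfold plus; simpl. generalize (S0 (S j) q). lra.
Qed.

Lemma finite_min (s : nat -> R) N : (forall j, (j < N)%nat -> 0 < s j) ->
  exists sigma, 0 < sigma /\ forall j, (j < N)%nat -> sigma <= s j.
Proof.
  induction N as [|N IH]; intros H.
  - exists 1. split; [lra | intros; lia].
  - destruct IH as (sg & S1 & S2); [auto|].
    exists (Rmin sg (s N)). split; [apply Rmin_pos; auto|].
    intros j Hj. destruct (Nat.eq_dec j N) as [->|D]; [apply Rmin_r|].
    eapply Rle_trans; [apply Rmin_l | apply S2; lia].
Qed.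

Lemma strip_R delta x : 0 < delta -> strip delta (RtoC x).
Proof. intros H. unfold strip. simpl. now rewrite Rabs_R0. Qed.

(** The threshold on [kappa] depends on the coefficients and shifts only and precedes [chi]: the
    split of the right-hand side is made after [kappa] has been fixed for both directions. *)
Lemma one_sided (M : nat -> R) (q : nat) (alpha : nat -> R) (delta B K : R) (a : nat -> C -> C) :
  (forall n, 0 < M n) -> regular M -> (1 <= q)%nat ->
  (forall j, (1 <= j < q)%nat -> alpha j < alpha q) ->
  0 < delta -> 0 < B -> 0 < K ->
  (forall j z, (1 <= j <= q)%nat -> strip delta z -> cdiff (a j) z) ->
  (forall z, strip delta z -> a q z <> 0%C) ->
  (forall j z, (1 <= j < q)%nat -> strip delta z ->
     Cmod (a j z / a q z)%C <= B * exp (exp (K * Rabs (Re z)))) ->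
  (forall z, strip delta z -> Cmod (1 / a q z)%C <= B * exp (exp (K * Rabs (Re z)))) ->
  exists kappa0, forall kappa, kappa0 <= kappa -> forall chi G r,
  tower (fun _ => True) chi -> (forall u v, wbound M (fun x => u <= x <= v) chi) ->
  0 < G -> 0 < r ->
  (forall n x, x <= - / 2 -> Cmod (chi n x) <= G * exp (- 2 * exp (kappa * Rabs x)) * r ^ n * INR (fact n)) ->
  exists Phi, tower (fun _ => True) Phi /\ (forall u v, wbound M (fun x => u <= x <= v) Phi) /\
  forall x, sum_n_m (fun j => (a j (RtoC x) * Phi O (x + alpha j)%R)%C) 1 q = chi O x.
Proof.
  intros Mpos Mreg Hq Halpha Hd HB HK Ha Hnz Hr1 Hr2.
  set (N := (q - 1)%nat).
  (* Indices are shifted by one: [s j] and [b j] belong to the term j + 1, and x is measured from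
     the last point, so the solution is translated by [alpha q] at the end. *)
  set (s := fun j => alpha q - alpha (S j)).
  destruct (finite_min s N) as (sigma & S1 & S2).
  { intros j Hj. unfold s, N in *. generalize (Halpha (S j) ltac:(lia)). lra. }
  set (b := fun j => DC (fun t => (a (S j) (RtoC t) / a q (RtoC t))%C)).
  set (c := DC (fun t => (1 / a q (RtoC t))%C)).
  assert (Hdel : 0 < delta / 2 < delta) by lra.
  set (K1 := exp (K * (delta / 2))).
  assert (Hb : forall j, (j < N)%nat -> tower (fun _ => True) (b j) /\
    forall n x, Cmod (b j n x) <= 64 * B * exp (K1 * exp (K * Rabs x)) * (/ (delta / 2)) ^ n * INR (fact n)).
  { intros j Hj. unfold N in Hj. apply (strip_tower (fun z => a (S j) z / a q z)%C delta); auto; try lra.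
    - intros z Hz. apply cdiff_div; auto; apply Ha; auto; lia.
    - intros z Hz. apply Hr1; auto. lia. }
  assert (Hc : tower (fun _ => True) c /\
    forall n x, Cmod (c n x) <= 64 * B * exp (K1 * exp (K * Rabs x)) * (/ (delta / 2)) ^ n * INR (fact n)).
  { apply (strip_tower (fun z => 1 / a q z)%C delta); auto; try lra.
    intros z Hz. apply cdiff_div; [apply cdiff_const | apply Ha; auto; lia | auto]. }
  (* The first part beats the growth of the coefficients, the second gives kappa * sigma >= 2. *)
  exists (K + 1 + 2 / sigma). intros kappa Hkappa chi G r Tchi Bchi HG Hr Fchi.
  assert (s2 : 0 < 2 / sigma) by (apply Rdiv_lt_0_compat; lra).
  destruct (forward M N b c s sigma (64 * B) K1 K (/ (delta / 2)) kappa) with (chi := chi) (G := G) (r := r)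
    as (Psi & T & W & E); auto; try lra.
  - apply exp_pos.
  - apply Rinv_0_lt_compat; lra.
  - intros j Hj. now apply Hb.
  - apply Hc.
  - intros j n x Hj. now apply Hb.
  - apply Hc.
  - apply Rle_trans with (2 / sigma * sigma); [right; field; lra|]. apply Rmult_le_compat_r; lra.
  - exists (shiftT (- alpha q) Psi). split; [|split].
    + exact (tower_shiftT (fun _ => True) (- alpha q) Psi T).
    + intros u v. apply (wbound_sub M (fun x => u - alpha q <= x + - alpha q <= v - alpha q)); [intros; lra|].
      exact (wbound_shiftT M (fun x => u - alpha q <= x <= v - alpha q) (- alpha q) Psi (W _ _)).
    + intros x.
      assert (Nz := Hnz (RtoC x) (strip_R delta x Hd)).
      assert (U : forall n, (n <= N)%nat ->
        sum_n_m (fun j => (a j (RtoC x) * shiftT (- alpha q) Psi O (x + alpha j)%R)%C) 1 n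
        = (a q (RtoC x) * Uop b s n Psi O x)%C).
      { induction n as [|n IH]; intros Hn.
        - rewrite sum_n_m_zero by lia. symmetry. apply Cmult_0_r.
        - rewrite sum_n_Sm by lia. rewrite IH by lia. simpl Uop. unfold plusT.
          cbn [prodT].
          change (b n O x) with (Re (a (S n) (RtoC x) / a q (RtoC x))%C, Im (a (S n) (RtoC x) / a q (RtoC x))%C).
          rewrite <- surjective_pairing.
          unfold shiftT, s.
          replace (x + alpha (S n) + - alpha q) with (x + - (alpha q - alpha (S n))) by ring.
          as_C. field. auto. }
      replace q with (S N) at 1 by (unfold N; lia).
      rewrite sum_n_Sm by lia. rewrite U by lia. replace (S N) with q by (unfold N; lia).
      unfold shiftT at 1. replace (x + alpha q + - alpha q) with x by ring.
      rewrite E. change (c O x) with (Re (1 / a q (RtoC x))%C, Im (1 / a q (RtoC x))%C).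
      rewrite <- surjective_pairing.
      as_C. field. auto.
Qed.

(** * Reflection and the two-sided equation *)

Lemma cdiff_opp_arg (f : C -> C) (z : C) : cdiff f (- z)%C -> cdiff (fun w => f (- w)%C) z.
Proof.
  intros [l Hl]. exists (- l)%C. intros e He. destruct (Hl e He) as (eta & E1 & E2).
  exists eta; split; auto. intros w Hw.
  assert (A : Cmod (- w - - z)%C = Cmod (w - z)%C).
  { replace (- w - - z)%C with (- (w - z))%C by ring. apply Cmod_opp. }
  specialize (E2 (- w)%C). rewrite A in E2.
  replace (- l * (w - z))%C with (l * (- w - - z))%C by ring. auto.
Qed.

Lemma strip_opp delta z : strip delta z -> strip delta (- z)%C.
Proof. unfold strip. simpl. now rewrite Rabs_Ropp. Qed.

Lemma bound_to_exp t y B : t * exp (- y) <= B -> t <= B * exp y.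
Proof.
  intros H. replace t with (t * exp (- y) * exp y).
  - apply Rmult_le_compat_r; [left; apply exp_pos | exact H].
  - rewrite Rmult_assoc, <- exp_plus. replace (- y + y) with 0 by ring. rewrite exp_0. ring.
Qed.

Theorem theorem2p2 :
  forall M : nat -> R,
  (forall n : nat, 0 < M n) ->
  regular M ->
  quasianalytic M ->
  forall (q : nat) (alpha : nat -> R) (delta : R) (chi : R -> C)
         (a : nat -> C -> C),
  (3 <= q)%nat ->
  (forall i j : nat, (1 <= i)%nat -> (i < j)%nat -> (j <= q)%nat ->
     alpha i < alpha j) ->
  0 < delta ->
  carleman M chi ->
  (forall j : nat, (1 <= j)%nat -> (j <= q)%nat ->
     holomorphic_on_strip delta (a j)) ->
  (forall z : C, strip delta z -> a 1%nat z <> RtoC 0) ->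
  (forall z : C, strip delta z -> a q z <> RtoC 0) ->
  (exists K : R, 0 < K /\ exists B : R, forall z : C, strip delta z ->
     (sum_n_m (fun j : nat => Cmod (a j z / a 1%nat z)%C) 2 q
      + sum_n_m (fun j : nat => Cmod (a j z / a q z)%C) 1 (q - 1)
      + 1 / Cmod (a 1%nat z) + 1 / Cmod (a q z))
     * exp (- exp (K * Rabs (Re z))) <= B) ->
  exists phi : R -> C, carleman M phi /\
    forall x : R,
      sum_n_m (fun j : nat => (a j (RtoC x) * phi (x + alpha j)%R)%C) 1 q
      = chi x.
Proof.
  intros M Mpos Mreg _ q alpha delta chi a Hq Halpha Hd [D [HD BD]] Ha Ha1 Haq (K & HK & B & HB).
  apply iterated_tower in HD. destruct HD as [D0 TD].
  assert (M0 : forall n, 0 <= M n) by (intros; left; auto).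
  assert (Hol : forall j z, (1 <= j <= q)%nat -> strip delta z -> cdiff (a j) z).
  { intros j z Hj Hz. apply cdiff_ex_derive. apply (Ha j); tauto. }
  (* All quotients and reciprocals in play are summands of one sum of nonnegative terms.
     [Rabs B + 1] replaces [B] because [one_sided] asks for a positive constant. *)
  assert (Bds : forall z, strip delta z -> forall t,
    ((exists j, (2 <= j <= q)%nat /\ t = Cmod (a j z / a 1%nat z)%C) \/
     (exists j, (1 <= j <= q - 1)%nat /\ t = Cmod (a j z / a q z)%C) \/
     t = Cmod (1 / a 1%nat z)%C \/ t = Cmod (1 / a q z)%C) ->
    t <= (Rabs B + 1) * exp (exp (K * Rabs (Re z)))).
  { intros z Hz t Ht.
    assert (H := bound_to_exp _ _ _ (HB z Hz)).
    set (s1 := sum_n_m (fun j : nat => Cmod (a j z / a 1%nat z)%C) 2 q) in *.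
    set (s2 := sum_n_m (fun j : nat => Cmod (a j z / a q z)%C) 1 (q - 1)) in *.
    assert (P1 : forall j, (2 <= j <= q)%nat -> Cmod (a j z / a 1%nat z)%C <= s1).
    { intros j Hj. apply (sum_n_m_term_le (fun j => Cmod (a j z / a 1%nat z)%C)); auto.
      intros; apply Cmod_ge_0. }
    assert (P2 : forall j, (1 <= j <= q - 1)%nat -> Cmod (a j z / a q z)%C <= s2).
    { intros j Hj. apply (sum_n_m_term_le (fun j => Cmod (a j z / a q z)%C)); auto.
      intros; apply Cmod_ge_0. }
    assert (s10 : 0 <= s1) by (eapply Rle_trans; [apply Cmod_ge_0 | apply (P1 2%nat); lia]).
    assert (s20 : 0 <= s2) by (eapply Rle_trans; [apply Cmod_ge_0 | apply (P2 1%nat); lia]).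
    assert (Q1 : Cmod (1 / a 1%nat z)%C = 1 / Cmod (a 1%nat z)) by (rewrite Cmod_div, Cmod_1; auto).
    assert (Q2 : Cmod (1 / a q z)%C = 1 / Cmod (a q z)) by (rewrite Cmod_div, Cmod_1; auto).
    assert (q1 := Cmod_ge_0 (1 / a 1%nat z)). assert (q2 := Cmod_ge_0 (1 / a q z)).
    apply Rle_trans with (B * exp (exp (K * Rabs (Re z)))).
    - eapply Rle_trans; [|exact H].
      destruct Ht as [(j & Hj & ->) | [(j & Hj & ->) | [-> | ->]]];
        [specialize (P1 j Hj) | specialize (P2 j Hj) | |]; lra.
    - apply Rmult_le_compat_r; [left; apply exp_pos|]. generalize (RRle_abs B). lra. }
  assert (B1 : 0 < Rabs B + 1) by (generalize (Rabs_pos B); lra).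
  destruct (one_sided M q alpha delta (Rabs B + 1) K a Mpos Mreg ltac:(lia)
    (fun j Hj => Halpha j q (proj1 Hj) (proj2 Hj) (Nat.le_refl q)) Hd B1 HK Hol Haq) as [k1 Fwd].
  { intros j z Hj Hz. apply Bds; auto. right; left. exists j. split; auto. lia. }
  { intros z Hz. apply Bds; auto. }
  (* Under x -> -x the shifts change sign, so reversing the indices restores their order and makes
     a_1 the leading coefficient. *)
  destruct (one_sided M q (fun j => - alpha (q + 1 - j)%nat) delta (Rabs B + 1) K
    (fun j z => a (q + 1 - j)%nat (- z)%C) Mpos Mreg ltac:(lia)) as [k2 Bwd]; try assumption.
  { intros j Hj. apply Ropp_lt_contravar, Halpha; lia. }
  { intros j z Hj Hz. apply cdiff_opp_arg. apply Hol; [lia | now apply strip_opp]. }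
  { intros z Hz. replace (q + 1 - q)%nat with 1%nat by lia. apply Ha1. now apply strip_opp. }
  { intros j z Hj Hz. replace (q + 1 - q)%nat with 1%nat by lia.
    replace (Rabs (Re z)) with (Rabs (Re (- z)%C)) by (simpl; apply Rabs_Ropp).
    apply Bds; [now apply strip_opp|]. left. exists (q + 1 - j)%nat. split; auto. lia. }
  { intros z Hz. replace (q + 1 - q)%nat with 1%nat by lia.
    replace (Rabs (Re z)) with (Rabs (Re (- z)%C)) by (simpl; apply Rabs_Ropp).
    apply Bds; [now apply strip_opp | auto]. }
  (* The splitting has a single weight, so one [kappa] must serve both directions; the 1 keeps it
     positive. *)
  set (kappa := Rmax 1 (Rmax k1 k2)).
  assert (Hk : 1 <= kappa) by apply Rmax_l.
  assert (Hk1 : k1 <= kappa) by (eapply Rle_trans; [apply Rmax_l | apply Rmax_r]).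
  assert (Hk2 : k2 <= kappa) by (eapply Rle_trans; [apply Rmax_r | apply Rmax_r]).
  destruct (two_sided_split M D kappa) as (P & N & TP & TN & E & BP & BN & G & r & HG & Hr & FP & FN);
    auto; try lra.
  destruct (Fwd kappa Hk1 P G r) as (Phi1 & T1 & W1 & E1); auto.
  destruct (Bwd kappa Hk2 (reflT N) G r) as (Phi2 & T2 & W2 & E2); auto.
  { exact (tower_reflT (fun _ => True) N TN). }
  { intros u v. apply (wbound_sub M (fun x => - v <= - x <= - u)); [intros; lra|].
    exact (wbound_reflT M (fun x => - v <= x <= - u) N (BN _ _)). }
  { intros n x Hx. rewrite Cmod_reflT, <- (Rabs_Ropp x). apply FN. lra. }
  set (Phi := plusT Phi1 (reflT Phi2)).
  exists (Phi O). split.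
  - exists Phi. split.
    + apply iterated_tower. split; [reflexivity|]. apply tower_plusT; auto.
      exact (tower_reflT (fun _ => True) Phi2 T2).
    + intros u v. apply wbound_plusT; auto.
      apply (wbound_sub M (fun x => - v <= - x <= - u)); [intros; lra|].
      exact (wbound_reflT M (fun x => - v <= x <= - u) Phi2 (W2 _ _)).
  - intros x. rewrite <- D0, E, <- E1.
    assert (R0 : forall F y, reflT F O y = F O (- y)).
    { intros F y. unfold reflT. simpl. ring. }
    specialize (E2 (- x)). rewrite R0, Ropp_involutive in E2. rewrite <- E2.
    (* The reflected equation at -x is the original one for the reflection of [Phi2], summed in
       reverse order. *)
    set (f := fun j => (a j (RtoC x) * Phi2 O (- (x + alpha j))%R)%C).
    rewrite (sum_n_m_ext (fun j => (a (q + 1 - j)%nat (- RtoC (- x))%C * Phi2 O (- x + - alpha (q + 1 - j)%nat)%R)%C)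
      (fun j => f (q + 1 - j)%nat)).
    2:{ intros j. unfold f. f_equal; f_equal; [rewrite RtoC_opp; ring | ring]. }
    rewrite sum_n_m_reflect.
    change (Cplus ?u ?v) with (plus (G := C_AbelianMonoid) u v).
    rewrite <- sum_n_m_plus. apply sum_n_m_ext. intros j.
    unfold f, Phi, plusT. rewrite R0.
    as_C. ring.
Qed.
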